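(* In the setting described in the context, assume (A1) and (A2$'$), and let $\nu>0$ satisfy $\frac p2(b_1-b_2e^{\nu\tau})-\nu>0$ and $b_3-b_4e^{\nu\tau}>0$. Then for any $\nu_1\in(0,\nu)$ there exists $\hat\Delta\in(0,1]$ such that for every admissible step size $\Delta\in(0,\hat\Delta]$, $$\limsup_{k\to\infty}\frac{1}{k\Delta}\log\big(\mathbb E|Y^\Delta(t_k)|^p\big)\le-\nu_1\qquad\text{and}\qquad\limsup_{k\to\infty}\frac1{k\Delta}\log|Y^\Delta(t_k)|\le-\frac{\nu_1}{p}\quad\text{a.s.}$$
   Context: Setting: $\tau>0$; $\mathcal C=C([-\tau,0];\mathbb R^n)$ with sup norm $\|\cdot\|$; $|\cdot|$ Euclidean/trace norm; $B$ a $d$-dimensional Brownian motion on a filtered probability space with the usual conditions; $f:\mathcal C\to\mathbb R^n$, $g:\mathcal C\to\mathbb R^{n\times d}$ with $f(\mathbf 0)=0$, $g(\mathbf 0)=0$ ($\mathbf 0$ the zero function); $\xi\in\mathcal C$ the initial datum. $\mathcal W$: bounded Borel $\rho:[-\tau,0]\to[0,\infty)$ with $\int_{-\tau}^0\rho=1$. (A1): for each $\ell>0$ there is $R_\ell>0$ with $|f(\phi)-f(\bar\phi)|\vee|g(\phi)-g(\bar\phi)|\le R_\ell(|\phi(0)-\bar\phi(0)|+\frac1\tau\int_{-\tau}^0|\phi-\bar\phi|\mathrm d\theta)$ whenever $\|\phi\|\vee\|\bar\phi\|\le\ell$. (A2$'$): there are $p\ge2$, $\varrho>0$, $b_1,b_2,b_3,b_4>0$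 with $b_1>b_2$, $b_3>b_4$, and $\rho_3,\rho_4\in\mathcal W$ such that for all $\phi\in\mathcal C$: $2\phi(0)^Tf(\phi)+(p-1)|g(\phi)|^2\le-b_1|\phi(0)|^2+b_2\int_{-\tau}^0|\phi(\theta)|^2\rho_3(\theta)\mathrm d\theta-b_3|\phi(0)|^{2+\varrho}+b_4\int_{-\tau}^0|\phi(\theta)|^{2+\varrho}\rho_4(\theta)\mathrm d\theta$. Scheme: $\Psi(\phi,\bar\phi)=|\phi(0)-\bar\phi(0)|^2+\frac1\tau\int_{-\tau}^0|\phi-\bar\phi|^2\mathrm d\theta$; $\Gamma:[1,\infty)\to[0,\infty)$ strictly increasing continuous, $\Gamma(l)\to\infty$, with $\sup\{\frac{|f(\phi)-f(\bar\phi)|}{\Psi^{1/2}}\vee\frac{|g(\phi)-g(\bar\phi)|^2}{\Psi}:\|\phi\|\vee\|\bar\phi\|\le l,\phi\ne\bar\phi\}\le\Gamma(l)$ for $l\ge1$; $\Gamma^{-1}$ its inverse on $[\Gamma(1),\infty)$; $K=\Gamma(1)\vee|f(\mathbf 0)|\vee|g(\mathbf 0)|^2$; $\lambda\in(0,1/2)$ fixed; $\Delta=\tau/N$ for integer $N\ge\tau$; $t_k=k\Delta$; $\Lambda(x)=(|x|\wedge\Gamma^{-1}(K\Delta^{-\lambda}))x/|x|$ ($x/|x|:=0$ if $x=0$). $\breve Y^\Delta(t_k)=\xi(t_k)$, $k=-N,\dots,0$; $Y^\Delta(t_k)=\Lambda(\breve Y^\Delta(t_k))$, $k\ge-N$;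 $\breve Y^\Delta(t_{k+1})=Y^\Delta(t_k)+f(\bar Y^\Delta_{t_k})\Delta+g(\bar Y^\Delta_{t_k})(B(t_{k+1})-B(t_k))$, $k\ge0$, with $\bar Y^\Delta_{t_k}(\theta)=\frac{(j+1)\Delta-\theta}{\Delta}Y^\Delta(t_{k+j})+\frac{\theta-j\Delta}{\Delta}Y^\Delta(t_{k+j+1})$ on $[j\Delta,(j+1)\Delta]$, $j=-N,\dots,-1$. *)

(* Defs.v *)
From HB Require Import structures.
From mathcomp Require Import all_boot all_order all_algebra.
From mathcomp Require Import all_classical all_reals all_analysis.
Set Implicit Arguments. Unset Strict Implicit. Unset Printing Implicit Defensive.
Import Order.TTheory GRing.Theory Num.Theory.
Import numFieldNormedType.Exports.
Local Open Scope classical_set_scope.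
Local Open Scope ring_scope.

Section Defs.
Variable R : realType.

Definition mnorm (m k : nat) (A : 'M[R]_(m, k)) : R :=
  Num.sqrt (\sum_(i < m) \sum_(j < k) A i j ^+ 2).

Definition dotv (n : nat) (x y : 'cV[R]_n) : R := \sum_(i < n) x i 0 * y i 0.

(* sup norm on C([-tau,0]; R^n); elements of C are represented as
   functions R -> 'cV_n continuous on [-tau,0] (values outside irrelevant) *)
Definition supn (n : nat) (tau : R) (phi : R -> 'cV[R]_n) : R :=
  sup [set mnorm (phi t) | t in `[- tau, 0]].

Definition int_tau (tau : R) (h : R -> R) : R :=
  Rintegral lebesgue_measure `[- tau, 0] h.

Definition is_C (n : nat) (tau : R) (phi : R -> 'cV[R]_n) : Prop :=
  {within `[- tau, 0], continuous phi}.

Definition local_on (n : nat) (X : Type) (tau : R) (F : (R -> 'cV[R]_n) -> X) :=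
  forall phi psi, (forall t, - tau <= t <= 0 -> phi t = psi t) -> F phi = F psi.

Definition PsiD (n : nat) (tau : R) (phi psi : R -> 'cV[R]_n) : R :=
  mnorm (phi 0 - psi 0) ^+ 2 + tau^-1 * int_tau tau (fun t => mnorm (phi t - psi t) ^+ 2).

Definition in_W (tau : R) (rho : R -> R) : Prop :=
  measurable_fun `[- tau, 0] rho /\
  (exists M : R, forall t, - tau <= t <= 0 -> rho t <= M) /\
  (forall t, - tau <= t <= 0 -> 0 <= rho t) /\
  int_tau tau rho = 1.

(* Gamma^{-1} on [Gamma(1), oo) for strictly increasing continuous Gamma *)
Definition Gamma_inv (G : R -> R) (y : R) : R := sup [set l | 1 <= l /\ G l <= y].

Definition trunc (n : nat) (h : R) (x : 'cV[R]_n) : 'cV[R]_n :=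
  if x == 0 then 0 else (Num.min (mnorm x) h / mnorm x) *: x.

Definition hat (Delta : R) (N i : nat) (t : R) : R :=
  Num.max 0 (1 - `| t - (i%:R - N%:R) * Delta | / Delta).
Definition interp (n : nat) (Delta : R) (N : nat) (w : seq 'cV[R]_n) (t : R) : 'cV[R]_n :=
  \sum_(i < N.+1) hat Delta N i t *: nth 0 w i.

(* The truncated EM scheme.  Ys m w = [Y(t_{-N}); ...; Y(t_m)] *)
Fixpoint Ys (n d : nat) (T : Type) (f : (R -> 'cV[R]_n) -> 'cV[R]_n)
  (g : (R -> 'cV[R]_n) -> 'M[R]_(n, d)) (B : R -> T -> 'cV[R]_d)
  (xi : R -> 'cV[R]_n) (h Delta : R) (N : nat) (m : nat) (w : T) : seq 'cV[R]_n :=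
  match m with
  | 0 => [seq trunc h (xi ((i%:R - N%:R) * Delta)) | i <- iota 0 N.+1]
  | m'.+1 =>
    let s := Ys f g B xi h Delta N m' w in
    let Ybar := interp Delta N (drop m' s) in
    rcons s (trunc h (last 0 s + Delta *: f Ybar
                     + g Ybar *m (B (m'.+1%:R * Delta) w - B (m'%:R * Delta) w)))
  end.

Definition Yk (n d : nat) (T : Type) (f : (R -> 'cV[R]_n) -> 'cV[R]_n)
  (g : (R -> 'cV[R]_n) -> 'M[R]_(n, d)) (B : R -> T -> 'cV[R]_d)
  (xi : R -> 'cV[R]_n) (G : R -> R) (lambda tau : R) (N : nat) (k : nat) (w : T) : 'cV[R]_n :=
  let Delta := tau / N%:R in
  let K := Num.max (G 1) (Num.max (mnorm (f (fun _ => 0))) (mnorm (g (fun _ => 0)) ^+ 2)) in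
  last 0 (Ys f g B xi (Gamma_inv G (K * Delta `^ (- lambda))) Delta N k w).

Definition brownian (dsp : measure_display) (T : measurableType dsp)
  (P : probability T R) (d : nat) (B : R -> T -> 'cV[R]_d) : Prop :=
  (forall t (j : 'I_d), 0 <= t -> measurable_fun setT (fun w => B t w j 0)) /\
  {ae P, forall w, B 0 w = 0} /\
  {ae P, forall w, {within `[0, +oo[, continuous (fun t => B t w)}} /\
  (forall (m : nat) (t : nat -> R) (A : nat -> 'I_d -> set R),
     0 <= t 0%N -> (forall i, (i < m)%N -> t i < t i.+1) ->
     (forall i j, measurable (A i j)) ->
     P (\bigcap_(i in `I_m) \bigcap_(j in [set: 'I_d])
          [set w | (B (t i.+1) w - B (t i) w) j 0 \in A i j])
     = (\prod_(i < m) \prod_(j < d) normal_prob 0 (Num.sqrt (t i.+1 - t i)) (A i j))%E).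

End Defs.

(* Main.v *)
Require Import Defs.
From HB Require Import structures.
From mathcomp Require Import all_boot all_order all_algebra.
From mathcomp Require Import ring lra zify.
From mathcomp Require Import all_classical all_reals all_analysis.
From mathcomp Require Import measurable_realfun.
Set Implicit Arguments. Unset Strict Implicit. Unset Printing Implicit Defensive.
Import Order.TTheory GRing.Theory Num.Theory.
Import numFieldNormedType.Exports.
Local Open Scope classical_set_scope.
Local Open Scope ring_scope.

(* Truncation does not increase norms, and sharp Gaussian hypercontractivity
   applied conditionally on the past gives, with no remainder and with x, f, g
   taken at time t_k, E|Y_{k+1}|^p <= E (|x + Delta f|^2 + (p-1) Delta |g|^2)^(p/2).
   By (A2') the right-hand base is |Y_k|^2 plus Delta times the dissipative
   expression, up to Delta^2 |f|^2, which is of order Delta^(1 - 2 lambda) |Y|^2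
   because the truncation bounds Gamma by K Delta^(-lambda).  Since (A2') on
   constant functions also forces |Y|^varrho = O(Delta^(-lambda)), the power p/2 can
   be expanded to first order with a small relative error, so that E|Y_k|^p satisfies
   a linear recursion with delay whose coefficients are close to those of the
   hypothesis on nu.  Summing it against exponential weights gives the decay of the
   moments, and a Borel-Cantelli argument gives the pathwise decay. *)

(** * Gaussian integrals *)

(** Because of the delay, the current value x may be tiny or zero while the noise coefficient, fed
    by past values, is not. Expanding |x + g dB|^p around x would then leave an error that is not
    small relative to |x|^p, which is why a Gaussian inequality without remainder is wanted. It is
    proved for quadratic polynomials [quadf] with [be ^+ 2 <= al * ga]. This class is stable under
    translation and under adding a nonnegative constant, so the bound can be iterated, over dyadic
    pieces of a variance and over the coordinates of the increment. The power q = p/2 is expanded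
    only afterwards, when the base is bounded by a combination of current and past squared norms
    with nonnegative weights, and convexity does the work there. The products of current and past
    powers that arise are split by Young's inequality. This brings in moments of exponent q +
    varrho/2, which run through the recursion as a second sequence: they only have to be finite,
    since their undelayed coefficient dominates the exponentially weighted delayed one. *)

Section density.
Local Open Scope ereal_scope.
Context d (T : measurableType d) (R : realType).
Variables (mu nu : {measure set T -> \bar R}) (phi : T -> R).
Hypothesis mphi : measurable_fun setT phi.
Hypothesis phi0 : forall x, (0 <= phi x)%R.
Hypothesis nuE : forall A, measurable A -> nu A = \int[mu]_(x in A) (phi x)%:E.

Import HBNNSimple.

(** Both sides are monotone limits along the simple approximations of [F]; for a simple function
    they are linear in the indicators of its level sets, where the claim is [nuE]. *)
Lemma ge0_integral_density (F : T -> \bar R) :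
  measurable_fun setT F -> (forall x, 0 <= F x) ->
  \int[nu]_x F x = \int[mu]_x (F x * (phi x)%:E).
Proof.
move=> mF F0.
pose h := nnsfun_approx measurableT mF.
have mphiE : measurable_fun setT (EFin \o phi) by exact/measurable_EFinP.
have m1phi n y : measurable_fun setT
    (fun x => (\1_(h n @^-1` [set y]) x)%:E * (phi x)%:E).
  apply: emeasurable_funM => //; exact/measurable_EFinP/measurable_indic.
have cvgh x : (h n x)%:E @[n --> \oo] --> F x.
  by apply: (@cvg_nnsfun_approx _ _ _ _ measurableT _ mF (fun x _ => F0 x)).
have -> : \int[nu]_x F x = lim (\int[nu]_x (h n x)%:E @[n --> \oo]).
  rewrite -monotone_convergence//.
  - by apply: eq_integral => x _; apply/esym/cvg_lim => //; exact: cvgh.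
  - by move=> n; exact/measurable_EFinP.
  - by move=> n x _; rewrite lee_fin.
  - by move=> x _ a b ab; rewrite lee_fin; exact/lefP/nd_nnsfun_approx.
have -> : \int[mu]_x (F x * (phi x)%:E) =
    lim (\int[mu]_x ((h n x)%:E * (phi x)%:E) @[n --> \oo]).
  rewrite -monotone_convergence//.
  - apply: eq_integral => x _; apply/esym/cvg_lim => //.
    have phifin : (phi x)%:E \is a fin_num by [].
    exact: (cvgeZr phifin (cvgh x)).
  - by move=> n; apply: emeasurable_funM => //; exact/measurable_EFinP.
  - by move=> n x _; rewrite mule_ge0// lee_fin.
  - by move=> x _ a b ab; rewrite lee_wpmul2r ?lee_fin//; exact/lefP/nd_nnsfun_approx.
apply/congr_lim/funext => n.
rewrite integralT_nnsfun sintegralE.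
transitivity (\int[mu]_x (\sum_(y \in range (h n))
    (y%:E * ((\1_(h n @^-1` [set y]) x)%:E * (phi x)%:E)))).
  rewrite ge0_integral_fsum//.
  - apply: eq_fsbigr => y /set_mem [x0 _ <-].
    rewrite ge0_integralZl//; last 2 first.
    + by move=> x _; rewrite mule_ge0// lee_fin.
    + by rewrite lee_fin.
    congr *%E; rewrite nuE// [LHS]integral_mkcond/=.
    by apply: eq_integral => x _; rewrite /= patchE indicE; case: ifPn => _;
      rewrite ?mul1e ?mul0e.
  - by move=> y; apply: emeasurable_funM => //; exact: m1phi.
  - move=> y x _; have [y0|y0] := leP 0%R y.
      by rewrite -!EFinM lee_fin !mulr_ge0.
    by rewrite preimage_nnfun0// indic0 mul0e mule0.
apply: eq_integral => x _; rewrite [in RHS]fimfunE -fsumEFin//.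
rewrite ge0_mule_fsuml; last by move=> y; exact: nnfun_muleindic_ge0.
by apply: eq_fsbigr => y _; rewrite EFinM muleA.
Qed.
End density.

Section lebesgue_translation.
Local Open Scope ereal_scope.
Context (R : realType).
Notation mu := (@lebesgue_measure R).

Let shiftr (a : R) : measurableTypeR R -> measurableTypeR R := fun x => (a + x)%R.

Let measurable_shiftr a : measurable_fun setT (shiftr a).
Proof. exact: measurable_funD. Qed.

HB.instance Definition _ (a : R) := @isMeasurableFun.Build _ _ _ _ (shiftr a) (measurable_shiftr a).

(** The pushforward of Lebesgue measure under a translation gives every half-open interval its
    length, so uniqueness identifies it with Lebesgue measure. *)
Lemma ge0_integral_translation (a : R) (F : R -> \bar R) :
  measurable_fun setT F -> (forall x, 0 <= F x) ->
  \int[mu]_x F (a + x)%R = \int[mu]_x F x.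
Proof.
move=> mF F0.
transitivity (\int[pushforward mu (shiftr a)]_x F x).
  by rewrite ge0_integral_pushforward.
apply: eq_measure_integral => A mA _; apply/esym.
apply: lebesgue_measure_unique => //= _ [[x y]] _ <-.
rewrite /pushforward/= (_ : _ @^-1` _ = `](x - a)%R, (y - a)%R]%classic); last first.
  by apply/seteqP; split => z /=; rewrite /shiftr !in_itv/=; lra.
rewrite !lebesgue_measure_itv/= !lte_fin ltrD2r; case: ifPn => // _.
by rewrite -!EFinB; congr EFin; ring.
Qed.
End lebesgue_translation.

Section gaussian_integrals.
Local Open Scope ereal_scope.
Context (R : realType).
Notation mu := (@lebesgue_measure R).
Implicit Types (F : R -> \bar R) (m s : R).

Lemma ge0_integral_normal_prob m s F :
  measurable_fun setT F -> (forall x, 0 <= F x) ->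
  \int[normal_prob m s]_x F x = \int[mu]_x (F x * (normal_pdf m s x)%:E).
Proof.
move=> mF F0; apply: ge0_integral_density => //.
- exact: measurable_normal_pdf.
- exact: normal_pdf_ge0.
Qed.

Lemma normal_pdf_shift m s x : (s != 0)%R ->
  normal_pdf m s (m + x) = normal_pdf 0 s x.
Proof.
move=> s0; rewrite !normal_pdfE// /normal_fun.
by have -> : (m + x - m = x - 0)%R by rewrite subr0 addrC addKr.
Qed.

Lemma ge0_integral_normal_shift m s F : (s != 0)%R ->
  measurable_fun setT F -> (forall x, 0 <= F x) ->
  \int[normal_prob 0 s]_x F (m + x)%R = \int[normal_prob m s]_x F x.
Proof.
move=> s0 mF F0; pose Fm x := F (m + x)%R.
have mFm : measurable_fun setT Fm.
  by apply: measurableT_comp => //; exact: measurable_funD.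
have mpdf : measurable_fun setT (fun x => (normal_pdf m s x)%:E).
  by apply/measurable_EFinP; exact: measurable_normal_pdf.
transitivity (\int[mu]_x (Fm x * (normal_pdf 0 s x)%:E)).
  exact: ge0_integral_normal_prob.
transitivity (\int[mu]_x (F x * (normal_pdf m s x)%:E)); last first.
  exact/esym/ge0_integral_normal_prob.
rewrite -[RHS](ge0_integral_translation m).
- by apply: eq_integral => x _; rewrite normal_pdf_shift.
- exact: emeasurable_funM.
- by move=> x; rewrite mule_ge0// lee_fin normal_pdf_ge0.
Qed.

(** Completing the square: the exponential times the centred density is a constant times the density
    of mean [a * s ^+ 2]. *)
Lemma normal_mgf (a s : R) : (s != 0)%R ->
  \int[normal_prob 0 s]_x (expR (a * x))%:E = (expR (a ^+ 2 * s ^+ 2 / 2))%:E.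
Proof.
move=> s0; rewrite ge0_integral_normal_prob//; last first.
  by apply/measurable_EFinP; apply: measurableT_comp => //; exact: measurable_funM.
transitivity (\int[mu]_x ((expR (a ^+ 2 * s ^+ 2 / 2))%:E * (normal_pdf (a * s ^+ 2) s x)%:E)).
  apply: eq_integral => x _; rewrite -!EFinM !normal_pdfE// /normal_fun.
  rewrite mulrCA [in RHS]mulrCA -!expRD; congr (_ * expR _)%:E; field.
  by rewrite ?s0.
rewrite ge0_integralZl//.
- by rewrite integral_normal_pdf mule1.
- by apply/measurable_EFinP; exact: measurable_normal_pdf.
- by move=> x _; rewrite lee_fin normal_pdf_ge0.
Qed.

End gaussian_integrals.

Section gaussian_convolution.
Local Open Scope ereal_scope.
Context (R : realType).
Notation mu := (@lebesgue_measure R).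
Implicit Types (F : R -> \bar R) (s : R).

Let neg : measurableTypeR R -> measurableTypeR R := fun x => (- x)%R.

Let measurable_neg : measurable_fun setT neg.
Proof. exact: oppr_measurable. Qed.

HB.instance Definition _ := @isMeasurableFun.Build _ _ _ _ neg measurable_neg.

Lemma ge0_integral_lebesgueN F :
  measurable_fun setT F -> (forall x, 0 <= F x) ->
  \int[mu]_x F (- x)%R = \int[mu]_x F x.
Proof.
move=> mF F0.
transitivity (\int[pushforward mu neg]_x F x).
  by rewrite ge0_integral_pushforward.
by apply: eq_measure_integral => A mA _; exact: lebesgue_measureN.
Qed.

Lemma ge0_integral_normalN s F : (s != 0)%R ->
  measurable_fun setT F -> (forall x, 0 <= F x) ->
  \int[normal_prob 0 s]_x F (- x)%R = \int[normal_prob 0 s]_x F x.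
Proof.
move=> s0 mF F0; pose Fm x := F (- x)%R.
have mFm : measurable_fun setT Fm by apply: measurableT_comp => //; exact: oppr_measurable.
have mpdf : measurable_fun setT (fun x => (normal_pdf 0 s x)%:E).
  by apply/measurable_EFinP; exact: measurable_normal_pdf.
transitivity (\int[mu]_x (Fm x * (normal_pdf 0 s x)%:E)).
  exact: ge0_integral_normal_prob.
transitivity (\int[mu]_x (F x * (normal_pdf 0 s x)%:E)); last first.
  exact/esym/ge0_integral_normal_prob.
rewrite -[RHS]ge0_integral_lebesgueN.
- apply: eq_integral => x _; rewrite !normal_pdfE// /normal_fun.
  by rewrite !subr0 sqrrN.
- exact: emeasurable_funM.
- by move=> x; rewrite mule_ge0// lee_fin normal_pdf_ge0.
Qed.

(** The joint density of X and X + Y, for independent centred normal X and Y of deviation [s], in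
    two ways: law of X times law of the sum given X, and law of the sum times law of X given the
    sum, which is normal with mean [z / 2] and variance s^2 / 2. *)
Lemma normal_pdf_sum s (x z : R) : (s != 0)%R ->
  (normal_pdf 0 s x * normal_pdf x s z =
   normal_pdf 0 (Num.sqrt 2 * s) z * normal_pdf (z / 2) (s / Num.sqrt 2) x)%R.
Proof.
move=> s0.
have r0 : (Num.sqrt 2 != 0 :> R)%R by rewrite gt_eqF// sqrtr_gt0.
have rr : (Num.sqrt 2 ^+ 2 = 2 :> R)%R by rewrite sqr_sqrtr.
rewrite !normal_pdfE ?mulf_neq0 ?invr_eq0//.
rewrite /normal_fun mulrACA [RHS]mulrACA -!expRD; congr (_ * expR _)%R.
- rewrite /normal_peak !exprMn exprVn rr -!invfM; congr (_^-1)%R.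
  have A0 c : (0 <= c -> 0 <= c * pi *+ 2 :> R)%R.
    by move=> c0; rewrite mulrn_wge0// mulr_ge0// pi_ge0.
  rewrite -sqrtrM ?A0 ?sqr_ge0// -sqrtrM; last by rewrite A0// mulr_ge0// sqr_ge0.
  by congr Num.sqrt; field.
- rewrite !exprMn exprVn rr; field.
  by rewrite s0.
Qed.

(** After the substitution z = x + y and an exchange of integrals, [normal_pdf_sum] leaves the inner
    integral of a normal density in [x]. *)
Lemma ge0_integral_normal_conv s F : (s != 0)%R ->
  measurable_fun setT F -> (forall x, 0 <= F x) ->
  \int[normal_prob 0 s]_x \int[normal_prob 0 s]_y F (x + y)%R =
  \int[normal_prob 0 (Num.sqrt 2 * s)]_z F z.
Proof.
move=> s0 mF F0.
have mpdf2 : measurable_fun setT (fun xz : R * R => (normal_pdf xz.1 s xz.2)%:E).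
  apply/measurable_EFinP.
  rewrite (_ : (fun _ => _) = normal_pdf 0 s \o (fun xz : R * R => xz.2 - xz.1)%R).
    apply: measurableT_comp; first exact: measurable_normal_pdf.
    by apply: measurable_funB.
  apply/funext => -[x z] /=.
  by rewrite -[in LHS](subrK x z) addrC normal_pdf_shift.
have mpdf (m t : R) : measurable_fun setT (fun z => (normal_pdf m t z)%:E).
  by apply/measurable_EFinP; exact: measurable_normal_pdf.
have mF2 : measurable_fun setT (fun xz : R * R => F xz.2 * (normal_pdf xz.1 s xz.2)%:E).
  by apply: emeasurable_funM => //; exact: measurableT_comp.
have pdf0 (m t z : R) : 0 <= (normal_pdf m t z)%:E by rewrite lee_fin normal_pdf_ge0.
have Fp0 (xz : R * R) : 0 <= F xz.2 * (normal_pdf xz.1 s xz.2)%:E by rewrite mule_ge0.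
have mG : measurable_fun setT (fun x => \int[mu]_z (F z * (normal_pdf x s z)%:E)).
  exact: (measurable_fun_fubini_tonelli_F (m2 := mu) _ mF2).
transitivity (\int[normal_prob 0 s]_x \int[mu]_z (F z * (normal_pdf x s z)%:E)).
  apply: eq_integral => x _; rewrite (ge0_integral_normal_shift x s0)//.
  exact: ge0_integral_normal_prob.
transitivity (\int[mu]_x ((\int[mu]_z (F z * (normal_pdf x s z)%:E)) * (normal_pdf 0 s x)%:E)).
  by apply: ge0_integral_normal_prob => // x; apply: integral_ge0 => z _; rewrite mule_ge0.
transitivity (\int[mu]_x \int[mu]_z
    (F z * (normal_pdf 0 (Num.sqrt 2 * s) z)%:E * (normal_pdf (z / 2) (s / Num.sqrt 2) x)%:E)).
  apply: eq_integral => x _; rewrite -ge0_integralZr.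
  - apply: eq_integral => z _; rewrite -!muleA -!EFinM; congr (_ * _%:E).
    by rewrite mulrC normal_pdf_sum.
  - exact: measurableT.
  - by apply: emeasurable_funM => //; exact: mpdf.
  - by move=> z _; rewrite mule_ge0.
  - exact: pdf0.
have mF3 : measurable_fun setT (fun xz : R * R =>
   F xz.2 * (normal_pdf 0 (Num.sqrt 2 * s) xz.2)%:E * (normal_pdf (xz.2 / 2) (s / Num.sqrt 2) xz.1)%:E).
  rewrite (_ : (fun _ => _) = fun xz : R * R => F xz.2 * (normal_pdf xz.1 s xz.2)%:E * (normal_pdf 0 s xz.1)%:E).
    by apply: emeasurable_funM => //; exact: (measurableT_comp (mpdf 0%R s) measurable_fst).
  apply/funext => -[x z] /=; rewrite -!muleA -!EFinM; congr (_ * _%:E).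
  by rewrite -normal_pdf_sum// mulrC.
rewrite (fubini_tonelli (m1 := mu) (m2 := mu) (fun xz : R * R => F xz.2 *
   (normal_pdf 0 (Num.sqrt 2 * s) xz.2)%:E * (normal_pdf (xz.2 / 2) (s / Num.sqrt 2) xz.1)%:E))//; last first.
  by move=> xz; rewrite !mule_ge0.
transitivity (\int[mu]_z (F z * (normal_pdf 0 (Num.sqrt 2 * s) z)%:E)); last first.
  exact/esym/ge0_integral_normal_prob.
apply: eq_integral => z _ /=.
rewrite ge0_integralZl.
- by rewrite integral_normal_pdf mule1.
- exact: measurableT.
- exact: mpdf.
- by move=> x _; exact: pdf0.
- by rewrite mule_ge0.
Qed.

End gaussian_convolution.

(** * Taylor bounds for the exponential and for real powers *)

Section exponential_taylor.
Context (R : realType).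
Implicit Types t x q w : R.

Lemma expR_ge1 t : 0 <= t -> 1 <= expR t.
Proof. by move=> t0; rewrite -expR0 ler_expR. Qed.

Lemma expR_taylor0 t : `|expR t - 1| <= `|t| * expR `|t|.
Proof.
have H (u : R) : expR u - 1 <= u * expR u.
  have := expR_ge1Dx (- u); rewrite expRN => h.
  have : (1 - u) * expR u <= 1 by rewrite -ler_pdivlMr ?expR_gt0// mul1r.
  by rewrite mulrBl mul1r; lra.
have [t0|t0] := leP 0 t.
  by rewrite !ger0_norm ?subr_ge0 ?expR_ge1.
rewrite ltr0_norm; last by rewrite subr_lt0 expR_lt1.
rewrite ltr0_norm// opprB.
have h1 := expR_ge1Dx t.
have h2 : 1 <= expR (- t) by rewrite expR_ge1// oppr_ge0 ltW.
by nra.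
Qed.

(** The derivative of the remainder is the remainder of one order less, so the mean value theorem
    adds a factor |t| to the bound of [expR_taylor0]. [expR_taylor2] repeats this; the factorials
    are given up. *)
Lemma expR_taylor1 t : `|expR t - 1 - t| <= `|t| ^+ 2 * expR `|t|.
Proof.
have [-> |t0] := eqVneq t 0; first by rewrite expR0 !subrr normr0 expr0n mul0r.
pose f (u : R) := expR u - 1 - u.
have df x : is_derive x 1 f (expR x - 1) by rewrite /f; apply: is_derive_eq; ring.
have cf a b : {within `[a, b], continuous f}.
  by apply: derivable_within_continuous => x _; exact: ex_derive.
have [c cab cE] : exists2 c, `|c| <= `|t| & f t = (expR c - 1) * t.
  have [t1|t1|] := ltgtP 0 t; last by move=> /esym/eqP; rewrite (negbTE t0).
    have [c] := @MVT_segment _ f (fun x => expR x - 1) 0 t (ltW t1) (fun x _ => df x) (cf _ _).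
    rewrite in_itv/= => /andP[c0 ct].
    rewrite {2}/f expR0 !subr0 subrr subr0 => E; exists c => //.
    by rewrite !ger0_norm// ltW.
  have [c] := @MVT_segment _ f (fun x => expR x - 1) t 0 (ltW t1) (fun x _ => df x) (cf _ _).
  rewrite in_itv/= => /andP[c0 ct].
  rewrite {1}/f expR0 !subr0 subrr sub0r => E; exists c.
    by rewrite !ler0_norm ?lerN2 // ltW.
  by rewrite -[LHS]opprK E sub0r mulrN opprK.
rewrite -/(f t) cE normrM expr2 mulrAC ler_wpM2r//.
apply: (le_trans (expR_taylor0 c)).
by rewrite ler_pM ?expR_ge0// ler_expR.
Qed.

Lemma expR_taylor2 t : `|expR t - 1 - t - t ^+ 2 / 2| <= `|t| ^+ 3 * expR `|t|.
Proof.
have [-> |t0] := eqVneq t 0.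
  by rewrite expR0 expr0n/= mul0r !subrr normr0 expr0n mul0r.
pose f (u : R) := expR u - 1 - u - u ^+ 2 / 2.
have df x : is_derive x 1 f (expR x - 1 - x).
  by rewrite /f; apply: is_derive_eq; rewrite /GRing.scale/=; field.
have cf a b : {within `[a, b], continuous f}.
  by apply: derivable_within_continuous => x _; exact: ex_derive.
have [c cab cE] : exists2 c, `|c| <= `|t| & f t = (expR c - 1 - c) * t.
  have [t1|t1|] := ltgtP 0 t; last by move=> /esym/eqP; rewrite (negbTE t0).
    have [c] := @MVT_segment _ f (fun x => expR x - 1 - x) 0 t (ltW t1) (fun x _ => df x) (cf _ _).
    rewrite in_itv/= => /andP[c0 ct].
    rewrite {2}/f expR0 expr0n/= mul0r !subr0 subrr subr0 => E; exists c => //.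
    by rewrite !ger0_norm// ltW.
  have [c] := @MVT_segment _ f (fun x => expR x - 1 - x) t 0 (ltW t1) (fun x _ => df x) (cf _ _).
  rewrite in_itv/= => /andP[c0 ct].
  rewrite {1}/f expR0 expr0n/= mul0r !subr0 subrr sub0r => E; exists c.
    by rewrite !ler0_norm ?lerN2 // ltW.
  by rewrite -[LHS]opprK E sub0r mulrN opprK.
rewrite -/(f t) cE normrM exprSr mulrAC ler_wpM2r//.
apply: (le_trans (expR_taylor1 c)).
by rewrite ler_pM ?expR_ge0 ?sqr_ge0 ?ler_expR// lerXn2r ?nnegrE.
Qed.

(** Within 1/2 of 1 the power is expanded as exp(q ln x). Elsewhere |x - 1|^3 is at least 1/8 and
    the cubic term absorbs every discrepancy; [w] bounds the growth for large [x] by a factor that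
    Gaussian integrals tolerate. *)
Lemma powR_taylor2 q : 1 <= q -> exists2 C, 0 <= C & forall x w : R, 0 <= x -> 0 <= w ->
  x <= expR (2 * w) ->
  x `^ q <= 1 + q * (x - 1) + q * (q - 1) / 2 * (x - 1) ^+ 2
            + C * (`|x - 1| ^+ 3 * expR (2 * q * w)).
Proof.
move=> q1; have q0 : 0 <= q by lra.
pose E1 : R := expR 1.
have E10 : 0 <= E1 := expR_ge0 _.
(* With u = x - 1 and v = ln x, the summands pay for the Taylor remainder of exp(q v), for the
   remainder [rho] in the linear term, and for replacing v^2 by u^2 in the quadratic one. *)
pose C0 := q ^+ 3 * expR q + q * E1 + q * (q - 1) / 2 * (1 + 2 * E1).
have C00 : 0 <= C0.
  rewrite /C0 !addr_ge0//; rewrite mulr_ge0// ?exprn_ge0 ?expR_ge0//.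
    by rewrite divr_ge0// mulr_ge0// subr_ge0.
  lra.
(* The parts serve [x] near 1, small and large, in this order. Each 8 is 2^3, from |v| <= 2 |u| near
   1 and from |u| >= 1/2 elsewhere. *)
exists (8 * C0 + 8 * q + 8) => [|x w x0 w0 xw]; first lra.
set u := x - 1.
have ew : 1 <= expR (2 * q * w) by rewrite expR_ge1// !mulr_ge0.
have u3 : 0 <= `|u| ^+ 3 by rewrite exprn_ge0.
have qq0 : 0 <= q * (q - 1) / 2 * u ^+ 2.
  by rewrite mulr_ge0 ?sqr_ge0// divr_ge0// mulr_ge0 ?subr_ge0.
have [uh|uh] := ltP u (- 2^-1).
  have xq1 : x `^ q <= 1.
    have x1 : x <= 1 by move: uh; rewrite /u; lra.
    have : x `^ q <= 1 `^ q by rewrite ge0_ler_powR ?nnegrE.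
    by rewrite powR1.
  have ul : 8^-1 <= `|u| ^+ 3.
    rewrite ltr0_norm; last by lra.
    have -> : 8^-1 = (2^-1) ^+ 3 :> R by field.
    by rewrite lerXn2r ?nnegrE; lra.
  have : 8^-1 <= `|u| ^+ 3 * expR (2 * q * w) by nra.
  move: (`|u| ^+ 3 * _) => Z Z8.
  have ugt : -1 <= u by rewrite /u; lra.
  have : (8 * C0 + 8 * q + 8) * Z >= q by nra.
  by nra.
have [uh2|uh2] := ltP (2^-1) u.
  have xq : x `^ q <= expR (2 * q * w).
    rewrite (_ : 2 * q * w = 2 * w * q); last by ring.
    by rewrite expRM ge0_ler_powR ?nnegrE ?expR_ge0.
  have ul : 8^-1 <= `|u| ^+ 3.
    rewrite ger0_norm; last by lra.
    have -> : 8^-1 = (2^-1) ^+ 3 :> R by field.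
    by rewrite lerXn2r ?nnegrE; lra.
  have : expR (2 * q * w) <= 8 * (`|u| ^+ 3 * expR (2 * q * w)).
    by rewrite mulrA ler_peMl ?expR_ge0//; lra.
  have : 0 <= `|u| ^+ 3 * expR (2 * q * w) by rewrite mulr_ge0 ?expR_ge0.
  move: (`|u| ^+ 3 * _) => Z Z0 Z8.
  have : 0 <= (8 * C0 + 8 * q) * Z by rewrite mulr_ge0//; lra.
  have : 0 <= q * u by rewrite mulr_ge0//; lra.
  by rewrite -/u; lra.
have xgt0 : 0 < x by move: uh; rewrite /u; lra.
pose v := ln x.
have xE : x = expR v by rewrite /v lnK.
have vu : `|v| <= 2 * `|u|.
  rewrite ler_norml; apply/andP; split.
    rewrite lerNl /v -lnV ?posrE// (le_trans (y := x^-1 - 1))//.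
      have -> : x^-1 = 1 + (x^-1 - 1) by ring.
      by rewrite (le_trans (le_ln1Dx _))//; have := invr_gt0 x; lra.
    have -> : x^-1 - 1 = - u / x by rewrite /u; field; rewrite gt_eqF.
    rewrite ler_pdivrMr//.
    have : - u <= `|u| by rewrite -normrN ler_norm.
    have : 1 <= 2 * x by move: uh; rewrite /u; lra.
    by have := normr_ge0 u; nra.
  have : v <= u.
    rewrite /v; have -> : x = 1 + u by rewrite /u; ring.
    by apply: le_ln1Dx; lra.
  have := ler_norm u; have := normr_ge0 u; lra.
have u12 : `|u| <= 2^-1 by rewrite ler_norml; lra.
have v1 : `|v| <= 1 by lra.
have v3 : `|v| ^+ 3 <= 8 * `|u| ^+ 3.
  have -> : 8 * `|u| ^+ 3 = (2 * `|u|) ^+ 3 by ring.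
  by rewrite lerXn2r ?nnegrE//; have := normr_ge0 u; lra.
have H1 : x `^ q <= 1 + q * v + (q * v) ^+ 2 / 2 + q ^+ 3 * expR q * `|v| ^+ 3.
  rewrite xE -expRM mulrC.
  have := expR_taylor2 (q * v); rewrite ler_norml => /andP[_].
  have : `|q * v| ^+ 3 * expR `|q * v| <= q ^+ 3 * expR q * `|v| ^+ 3.
    rewrite normrM (ger0_norm q0) exprMn mulrAC ler_wpM2r ?exprn_ge0//.
    by rewrite ler_wpM2l ?exprn_ge0// ler_expR; nra.
  by lra.
pose rho := u - v - v ^+ 2 / 2.
have rhoE : `|rho| <= E1 * `|v| ^+ 3.
  rewrite /rho /u [in leLHS]xE [leRHS]mulrC; apply: (le_trans (expR_taylor2 v)).
  by rewrite ler_wpM2l ?exprn_ge0// ler_expR.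
have uE : u = v + v ^+ 2 / 2 + rho by rewrite /rho; ring.
have v30 : 0 <= `|v| ^+ 3 by rewrite exprn_ge0.
have H2 : u ^+ 2 >= v ^+ 2 - (1 + 2 * E1) * `|v| ^+ 3.
  have a1 : u ^+ 2 >= v ^+ 2 + 2 * v * (v ^+ 2 / 2 + rho).
    by rewrite uE; have := sqr_ge0 (v ^+ 2 / 2 + rho); nra.
  have a2 : v * v ^+ 2 >= - `|v| ^+ 3.
    by have := ler_norm (- (v ^+ 3)); rewrite normrN normrX exprS; lra.
  have a3 : v * rho >= - (E1 * `|v| ^+ 3).
    have := ler_norm (- (v * rho)); rewrite normrN normrM.
    have : `|v| * `|rho| <= E1 * `|v| ^+ 3.
      by rewrite -[leRHS]mul1r ler_pM.
    by lra.
  by lra.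
have H3 : rho >= - (E1 * `|v| ^+ 3) by move: rhoE; rewrite ler_norml => /andP[].
have H4 : C0 * `|v| ^+ 3 <= 8 * C0 * `|u| ^+ 3 by nra.
have H5 : `|u| ^+ 3 <= `|u| ^+ 3 * expR (2 * q * w) by rewrite ler_peMr.
have H6 : q * (q - 1) / 2 * (u ^+ 2) >= q * (q - 1) / 2 * (v ^+ 2 - (1 + 2 * E1) * `|v| ^+ 3).
  by rewrite ler_wpM2l// divr_ge0// mulr_ge0// subr_ge0.
have H7 : q * rho >= q * (- (E1 * `|v| ^+ 3)) by rewrite ler_wpM2l.
have H8 : q * u = q * v + q * (v ^+ 2 / 2) + q * rho by rewrite uE; ring.
have H9 : 8 * C0 * `|u| ^+ 3 <= (8 * C0 + 8 * q + 8) * (`|u| ^+ 3 * expR (2 * q * w)).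
  by nra.
have H10 : C0 * `|v| ^+ 3 = q ^+ 3 * expR q * `|v| ^+ 3 + q * (E1 * `|v| ^+ 3)
     + q * (q - 1) / 2 * ((1 + 2 * E1) * `|v| ^+ 3) by rewrite /C0; ring.
have H11 : q * (q - 1) / 2 * (v ^+ 2 - (1 + 2 * E1) * `|v| ^+ 3) =
  q * (q - 1) / 2 * v ^+ 2 - q * (q - 1) / 2 * ((1 + 2 * E1) * `|v| ^+ 3) by ring.
have H12 : q * (v ^+ 2 / 2) + q * (q - 1) / 2 * v ^+ 2 = (q * v) ^+ 2 / 2 by field.
rewrite -/u; lra.
Qed.

End exponential_taylor.

(** * Gaussian hypercontractivity *)

Section gaussian_hypercontractivity.
Context (R : realType).
Implicit Types q s z : R.

(** The squared norm |v + z u|^2 as a polynomial in [z], with al = |v|^2, be = v.u and ga = |u|^2;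
    the condition [be ^+ 2 <= al * ga] is then the Cauchy-Schwarz inequality, and it survives when
    [al] is increased. *)
Definition quadf (al be ga z : R) := al + 2 * be * z + ga * z ^+ 2.

(** Completing the square. The lower bound [e] has to hold uniformly in [z] because the dyadic
    induction uses the value of the polynomial as a new constant coefficient. *)
Lemma quadf_ge (e al be ga z : R) : e <= al -> 0 <= ga -> be ^+ 2 <= (al - e) * ga ->
  e <= quadf al be ga z.
Proof.
move=> eal ga0 bega; rewrite /quadf.
have [gaE|gaN0] := eqVneq ga 0.
  have b0 : be = 0.
    by apply/eqP; rewrite -sqrf_eq0 eq_le sqr_ge0 andbT (le_trans bega)// gaE mulr0.
  by rewrite gaE b0; lra.
have gagt0 : 0 < ga by rewrite lt0r gaN0.
rewrite -(ler_pM2r gagt0).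
have := sqr_ge0 (ga * z + be); nra.
Qed.

(** Divided by [al], the polynomial is 1 + 2 b z + w^2 with |b z| <= w, hence at most (1 + w)^2 <=
    exp(2 w), as [powR_taylor2] asks. In the coefficient q (2 q - 1) the part q comes from w^2 and
    the part 2 q (q - 1) from the square of 2 b z. *)
Lemma powR_quadf_taylor q : 1 <= q -> exists C k, [/\ 0 <= C, 0 <= k &
  forall al be ga z : R, 0 < al -> 0 <= ga -> be ^+ 2 <= al * ga ->
  forall w, w = Num.sqrt (ga / al) * `|z| ->
  (quadf al be ga z) `^ q <= al `^ q *
   (1 + 2 * q * (be / al) * z + q * (2 * q - 1) * w ^+ 2 + C * (w ^+ 3 * expR (k * w)))].
Proof.
move=> q1; have [C C0 H] := powR_taylor2 q1.
exists (2 * q * (q - 1) + 8 * C), (3 + 2 * q); split; [nra|lra|].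
move=> al be ga z al0 ga0 bega w wE.
set r := Num.sqrt (ga / al).
rewrite -/r in wE.
have r0 : 0 <= r by rewrite sqrtr_ge0.
have r2 : r ^+ 2 = ga / al by rewrite sqr_sqrtr// divr_ge0// ltW.
have w0 : 0 <= w by rewrite wE mulr_ge0.
have w2 : w ^+ 2 = ga / al * z ^+ 2 by rewrite wE exprMn r2 real_normK ?num_real.
pose b := be / al.
have b2 : b ^+ 2 <= r ^+ 2.
  rewrite /b r2 expr_div_n ler_pdivrMr ?exprn_gt0//.
  by rewrite (_ : _ * al ^+ 2 = al * ga)//; field; rewrite gt_eqF.
have br : `|b| <= r by rewrite -ler_sqr ?nnegrE// real_normK ?num_real.
have bz : `|b * z| <= w by rewrite wE normrM ler_wpM2r.
set x := quadf al be ga z / al.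
have xE : x = 1 + 2 * (b * z) + w ^+ 2.
  by rewrite /x /quadf w2 /b; field; rewrite gt_eqF.
have qE : quadf al be ga z = al * x by rewrite /x mulrC divfK// gt_eqF.
have bzl : - w <= b * z by move: bz; rewrite ler_norml => /andP[].
have bzu : b * z <= w by move: bz; rewrite ler_norml => /andP[].
have x0 : 0 <= x by rewrite xE; have := sqr_ge0 (w - 1); nra.
have ew1 : 1 + w <= expR w := expR_ge1Dx w.
have e2w : expR (2 * w) = expR w ^+ 2 by rewrite expRM_natl.
have xw : x <= expR (2 * w).
  have : (1 + w) ^+ 2 <= expR w ^+ 2 by rewrite lerXn2r ?nnegrE//; lra.
  by rewrite e2w xE; nra.
rewrite qE powRM ?ler_wpM2l ?powR_ge0 ?(ltW al0)//.
apply: (le_trans (H x w x0 w0 xw)).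
have uE : x - 1 = 2 * (b * z) + w ^+ 2 by rewrite xE; ring.
have u1 : `|x - 1| <= 2 * (w * expR w).
  rewrite uE; apply: (le_trans (ler_normD _ _)).
  rewrite normrM (ger0_norm (sqr_ge0 w)) (ger0_norm (_ : 0 <= 2))//; nra.
have u3 : `|x - 1| ^+ 3 <= 8 * (w ^+ 3 * expR (3 * w)).
  rewrite expRM_natl (_ : 8 * _ = (2 * (w * expR w)) ^+ 3); last by ring.
  by rewrite lerXn2r ?nnegrE// mulr_ge0// mulr_ge0// expR_ge0.
have eD : expR ((3 + 2 * q) * w) = expR (3 * w) * expR (2 * q * w).
  by rewrite -expRD; congr expR; ring.
have T3 : `|x - 1| ^+ 3 * expR (2 * q * w) <= 8 * (w ^+ 3 * expR ((3 + 2 * q) * w)).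
  by rewrite eD; have := expR_ge0 (2 * q * w); nra.
have e1 : 1 + w <= expR ((3 + 2 * q) * w).
  by apply: (le_trans ew1); rewrite ler_expR; nra.
have w3 : 0 <= w ^+ 3 by rewrite exprn_ge0.
have T2 : (x - 1) ^+ 2 <= 4 * w ^+ 2 + 4 * (w ^+ 3 * expR ((3 + 2 * q) * w)).
  have : (x - 1) ^+ 2 <= 4 * w ^+ 2 + 4 * (w ^+ 3 * (1 + w)).
    have s1 : (b * z) ^+ 2 <= w ^+ 2 by rewrite -[leLHS]real_normK ?num_real// lerXn2r ?nnegrE.
    have s2 : (b * z) * w ^+ 2 <= w ^+ 3 by rewrite exprS ler_wpM2r// sqr_ge0.
    have s4 : 0 <= w ^+ 4 by rewrite exprn_ge0.
    have -> : w ^+ 3 * (1 + w) = w ^+ 3 + w ^+ 4 by ring.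
    have -> : (x - 1) ^+ 2 = 4 * (b * z) ^+ 2 + 4 * ((b * z) * w ^+ 2) + w ^+ 4 by rewrite uE; ring.
    by lra.
  by move/le_trans; apply; rewrite lerD2l ler_wpM2l// ler_wpM2l.
move: (w ^+ 3 * expR ((3 + 2 * q) * w)) T2 T3 => Z T2 T3.
have q21 : 0 <= q * (q - 1) / 2 by rewrite divr_ge0// mulr_ge0//; lra.
have := ler_wpM2l q21 T2; have := ler_wpM2l C0 T3.
rewrite [X in 1 + q * X]uE -/b.
have -> : q * (q - 1) / 2 * (4 * w ^+ 2 + 4 * Z) =
  2 * q * (q - 1) * w ^+ 2 + 2 * q * (q - 1) * Z by field.
by rewrite -/b; lra.
Qed.

(** Averaging over the sign of [z] removes the linear term. The rest is bounded by exponentials of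
    multiples of [z], whose Gaussian means are explicit: [a] makes (a z)^2 / 2 equal to the
    quadratic term, and the cubic remainder is paid for by exponentials at scale [s]. *)
Lemma powR_quadf_sym q : 1 <= q -> exists C k, [/\ 0 <= C, 0 <= k &
  forall al be ga z s : R, 0 < al -> 0 <= ga -> be ^+ 2 <= al * ga -> 0 < s ->
  forall rho a, rho = s * Num.sqrt (ga / al) -> rho <= 1 ->
  a = Num.sqrt (2 * q * (2 * q - 1)) * Num.sqrt (ga / al) ->
  ((quadf al be ga z) `^ q + (quadf al be ga (- z)) `^ q) / 2 <= al `^ q *
   ((expR (a * z) + expR (- a * z)) / 2
    + C * rho ^+ 3 * (expR (k / s * z) + expR (- (k / s) * z)))].
Proof.
move=> q1; have [C [k [C0 k0 H]]] := powR_quadf_taylor q1.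
pose c := Num.sqrt (2 * q * (2 * q - 1)).
have c0 : 0 <= c by rewrite sqrtr_ge0.
have c2 : c ^+ 2 = 2 * q * (2 * q - 1) by rewrite sqr_sqrtr//; nra.
exists (6 * (C + c ^+ 3)), (1 + k + c); split.
- by rewrite mulr_ge0// addr_ge0// exprn_ge0.
- by rewrite !addr_ge0.
move=> al be ga z s al0 ga0 bega s0 rho a; set r := Num.sqrt (ga / al).
move=> rhoE rho1 aE; pose w := r * `|z|.
have := H al be ga z al0 ga0 bega w erefl.
have := H al be ga (- z) al0 ga0 bega w; rewrite normrN => /(_ erefl).
have r0 : 0 <= r by rewrite sqrtr_ge0.
have w0 : 0 <= w by rewrite mulr_ge0.
move=> H1 H2; rewrite -/c in aE.
have alq : 0 <= al `^ q := powR_ge0 _ _.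
have {H1 H2}: ((quadf al be ga z) `^ q + (quadf al be ga (- z)) `^ q) / 2 <=
  al `^ q * (1 + q * (2 * q - 1) * w ^+ 2 + C * (w ^+ 3 * expR (k * w))).
  by move: H1 H2; move: (al `^ q) => A; lra.
move/le_trans; apply; rewrite ler_wpM2l//.
have aw : `|a * z| = c * w by rewrite aE !normrM (ger0_norm c0) (ger0_norm r0) /w mulrA.
have aw2 : (a * z) ^+ 2 / 2 = q * (2 * q - 1) * w ^+ 2.
  by rewrite -[in LHS]real_normK ?num_real// aw exprMn c2; field.
have cosh1 : 1 + q * (2 * q - 1) * w ^+ 2 <= (expR (a * z) + expR (- a * z)) / 2 +
    (c * w) ^+ 3 * expR (c * w).
  have := expR_taylor2 (a * z); have := expR_taylor2 (- a * z).
  rewrite mulNr normrN aw sqrrN aw2 !ler_norml => /andP[h1 _] /andP[h2 _]; lra.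
(* With y = |z| / s one has w = rho y. Then y^3 <= 6 exp(y) leaves [rho ^+ 3] times an exponential,
   and [rho <= 1] lets y replace w in the exponent. *)
have wy : w ^+ 3 * expR ((k + c) * w) <= 6 * rho ^+ 3 *
   (expR ((1 + k + c) / s * z) + expR (- ((1 + k + c) / s) * z)).
  pose y := `|z| / s.
  have y0 : 0 <= y by rewrite divr_ge0// ltW.
  have wE : w = rho * y by rewrite /w rhoE /y; field; rewrite gt_eqF.
  have rho0 : 0 <= rho by rewrite rhoE mulr_ge0// ltW.
  have ey : y ^+ 3 <= 6 * expR y.
    by have := expR_ge1Dxn 2 y0; rewrite (_ : 3`!%:R = 6 :> R)//; have := expR_ge0 y; lra.
  have e1 : expR ((k + c) * w) <= expR ((k + c) * y).
    by rewrite ler_expR ler_wpM2l ?addr_ge0// wE ler_piMl.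
  have e2 : expR y * expR ((k + c) * y) <=
     expR ((1 + k + c) / s * z) + expR (- ((1 + k + c) / s) * z).
    rewrite -expRD (_ : y + _ = (1 + k + c) / s * `|z|); last by rewrite /y; ring.
    rewrite mulNr -mulrN; have [z0|z0] := leP 0 z.
      by rewrite ger0_norm// lerDl expR_ge0.
    by rewrite ltr0_norm// lerDr expR_ge0.
  rewrite wE exprMn -wE.
  apply: (@le_trans _ _ (rho ^+ 3 * (6 * expR y) * expR ((k + c) * y))).
    have y3 : 0 <= y ^+ 3 by exact: exprn_ge0.
    have rho3 : 0 <= rho ^+ 3 by exact: exprn_ge0.
    apply: ler_pM; [exact: mulr_ge0|exact: expR_ge0|exact: ler_wpM2l|exact: e1].
  rewrite (_ : _ * (6 * _) * _ = 6 * rho ^+ 3 * (expR y * expR ((k + c) * y))); last by ring.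
  by rewrite ler_wpM2l// mulr_ge0// exprn_ge0.
have e1 : expR (k * w) <= expR ((k + c) * w) by rewrite ler_expR ler_wpM2r// lerDl.
have e2 : expR (c * w) <= expR ((k + c) * w) by rewrite ler_expR ler_wpM2r// lerDr.
have w3 : 0 <= w ^+ 3 by rewrite exprn_ge0.
have c3 : 0 <= c ^+ 3 by rewrite exprn_ge0.
have t1 := ler_wpM2l C0 (ler_wpM2l w3 e1).
have t2 := ler_wpM2l c3 (ler_wpM2l w3 e2).
have Cc : 0 <= C + c ^+ 3 by rewrite addr_ge0.
have t3 := ler_wpM2l Cc wy.
have c3w : (c * w) ^+ 3 * expR (c * w) = c ^+ 3 * (w ^+ 3 * expR (c * w)) by ring.
rewrite c3w in cosh1.
set X := _ + expR (- ((1 + k + c) / s) * z) in t3 *.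
rewrite (_ : 6 * (C + c ^+ 3) * rho ^+ 3 * X = (C + c ^+ 3) * (6 * rho ^+ 3 * X)); last by ring.
by lra.
Qed.

Lemma normal_cosh (A a s : R) : 0 <= A -> s != 0 ->
  (\int[normal_prob 0 s]_z (A * (expR (a * z) + expR (- a * z)))%:E =
   (2 * A * expR (a ^+ 2 * s ^+ 2 / 2))%:E)%E.
Proof.
move=> A0 s0.
have me (b : R) : measurable_fun setT (fun z : R => (expR (b * z))%:E).
  by apply/measurable_EFinP; apply: measurableT_comp => //; exact: measurable_funM.
under eq_integral do rewrite EFinM EFinD.
rewrite ge0_integralZl.
- rewrite ge0_integralD.
  + rewrite !normal_mgf// sqrrN -EFinD -EFinM; congr EFin; ring.
  + exact: measurableT.
  + by move=> z _; rewrite lee_fin expR_ge0.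
  + exact: me.
  + by move=> z _; rewrite lee_fin expR_ge0.
  + exact: me.
- exact: measurableT.
- by apply: emeasurable_funD; exact: me.
- by move=> z _; rewrite -EFinD lee_fin addr_ge0 ?expR_ge0.
- by rewrite lee_fin.
Qed.

Lemma measurable_powR_quadf q (al be ga : R) :
  measurable_fun setT (fun z : R => ((quadf al be ga z) `^ q)%:E).
Proof.
apply/measurable_EFinP; apply: (measurableT_comp (measurable_powR q)).
apply: measurable_funD; first by apply: measurable_funD => //; exact: measurable_funM.
by apply: measurable_funM => //; exact: measurable_funX.
Qed.

(* The excess factor is cubic in the standard deviation: it disappears when the
   variance is divided by [2 ^ n] and the [2 ^ n] pieces are convolved. *)
Lemma normal_powR_quadf_small q : 1 <= q -> exists2 C, 0 <= C &
  forall al be ga s : R, 0 < al -> 0 <= ga -> be ^+ 2 <= al * ga -> 0 < s ->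
  s * Num.sqrt (ga / al) <= 1 ->
  (\int[normal_prob 0 s]_z ((quadf al be ga z) `^ q)%:E <=
   (expR (C * (s * Num.sqrt (ga / al)) ^+ 3)
     * (al + (2 * q - 1) * ga * s ^+ 2) `^ q)%:E)%E.
Proof.
move=> q1; have [C [k [C0 k0 H]]] := powR_quadf_sym q1.
pose c := Num.sqrt (2 * q * (2 * q - 1)).
have c2 : c ^+ 2 = 2 * q * (2 * q - 1) by rewrite sqr_sqrtr//; nra.
(* The first summand covers the gap between exp(q y) and (1 + y)^q for y = (2 q - 1) rho^2, which is
   of order rho^4; the second is the Gaussian mean of the cubic remainder of [powR_quadf_sym]. *)
exists (q * (2 * q - 1) ^+ 2 + 2 * C * expR (k ^+ 2 / 2)).
  by rewrite addr_ge0 ?mulr_ge0 ?expR_ge0 ?sqr_ge0//; lra.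
move=> al be ga s al0 ga0 bega s0 rho1.
have sN0 : s != 0 by rewrite gt_eqF.
have {}H z := H al be ga z s al0 ga0 bega s0 _ _ erefl rho1 erefl.
set r := Num.sqrt (ga / al) in rho1 H *; set rho := s * r in rho1 H *.
have r0 : 0 <= r by rewrite sqrtr_ge0.
have r2 : r ^+ 2 = ga / al by rewrite sqr_sqrtr// divr_ge0// ltW.
have rho0 : 0 <= rho by rewrite mulr_ge0// ltW.
have rho2 : rho ^+ 2 = s ^+ 2 * (ga / al) by rewrite exprMn r2.
pose F (z : R) := ((quadf al be ga z) `^ q)%:E.
have mF : measurable_fun setT F := measurable_powR_quadf _ _ _ _.
have F0 z : (0 <= F z)%E by rewrite lee_fin powR_ge0.
pose Fm (z : R) := F (- z).
have mFm : measurable_fun setT Fm by apply: measurableT_comp => //; exact: oppr_measurable.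
have symE : (\int[normal_prob 0 s]_z F z =
    \int[normal_prob 0 s]_z (2^-1%:E * (F z + Fm z)))%E.
  rewrite ge0_integralZl.
  - rewrite ge0_integralD.
    + rewrite /Fm (ge0_integral_normalN sN0 mF F0).
      rewrite -mule2n -[(_ *+ 2)%E]mule_natl muleA -EFinM mulVf// mul1e//.
    + exact: measurableT.
    + by [].
    + exact: mF.
    + by move=> z _; exact: F0.
    + exact: mFm.
  - exact: measurableT.
  - exact: emeasurable_funD.
  - by move=> z _; rewrite adde_ge0// /Fm.
  - by rewrite lee_fin.
rewrite -/F symE.
set a := c * r.
have mc (A b : R) : measurable_fun setT (fun z : R => (A * (expR (b * z) + expR (- b * z)))%:E).
  apply/measurable_EFinP; apply: measurable_funM => //; apply: measurable_funD;
  by apply: measurableT_comp => //; exact: measurable_funM.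
have aq0 : 0 <= al `^ q := powR_ge0 _ _.
pose A1 := al `^ q / 2; pose A2 := al `^ q * (C * rho ^+ 3).
have A10 : 0 <= A1 by rewrite divr_ge0.
have A20 : 0 <= A2 by rewrite mulr_ge0// mulr_ge0// exprn_ge0.
have c0 (A b z : R) : 0 <= A -> (0 <= (A * (expR (b * z) + expR (- b * z)))%:E)%E.
  by move=> A0; rewrite lee_fin mulr_ge0// addr_ge0// expR_ge0.
apply: (@le_trans _ _ (\int[normal_prob 0 s]_z
   ((A1 * (expR (a * z) + expR (- a * z)))%:E +
    (A2 * (expR (k / s * z) + expR (- (k / s) * z)))%:E))%E).
  apply: ge0_le_integral.
  - exact: measurableT.
  - move=> z _; apply: mule_ge0; first by rewrite lee_fin.
    exact: adde_ge0 (F0 _) (F0 _).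
  - by apply: emeasurable_funM => //; exact: emeasurable_funD.
  - by apply: emeasurable_funD; exact: mc.
  - move=> z _; rewrite /Fm /F -EFinD -EFinM -EFinD lee_fin mulrC.
    by apply: (le_trans (H z)); rewrite le_eqVlt; apply/orP; left; apply/eqP; rewrite /A1 /A2 /a -/c; field.
rewrite ge0_integralD.
- rewrite !normal_cosh// -EFinD lee_fin.
  have -> : a ^+ 2 * s ^+ 2 / 2 = q * ((2 * q - 1) * rho ^+ 2).
    by rewrite /a exprMn c2 rho2 r2; field; rewrite gt_eqF.
  have -> : (k / s) ^+ 2 * s ^+ 2 / 2 = k ^+ 2 / 2 by field.
  set y := (2 * q - 1) * rho ^+ 2.
  have y0 : 0 <= y by rewrite mulr_ge0 ?sqr_ge0//; lra.
  have -> : al + (2 * q - 1) * ga * s ^+ 2 = al * (1 + y).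
    by rewrite /y rho2; field; rewrite gt_eqF.
  rewrite powRM ?(ltW al0) ?addr_ge0//.
  have ey : expR (q * y) <= (1 + y) `^ q * expR (q * y ^+ 2).
    have e1 : expR (y - y ^+ 2) <= 1 + y.
      rewrite -[leRHS]invrK -[leLHS]invrK lef_pV2 ?posrE ?invr_gt0 ?expR_gt0//; last lra.
      rewrite -expRN opprB; apply: (le_trans _ (expR_ge1Dx _)).
      rewrite -[leLHS]mul1r ler_pdivrMr; last by lra.
      have := exprn_ge0 3 y0; nra.
    have -> : q * y = (y - y ^+ 2) * q + q * y ^+ 2 by ring.
    rewrite expRD expRM ler_wpM2r ?expR_ge0// ge0_ler_powR ?nnegrE ?expR_ge0 ?addr_ge0//; lra.
  have y2 : q * y ^+ 2 <= q * (2 * q - 1) ^+ 2 * rho ^+ 3.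
    rewrite /y exprMn -mulrA ler_wpM2l//; first lra.
    rewrite ler_wpM2l ?sqr_ge0// -exprM (_ : (2 * 2 = 3.+1)%N)// exprS ler_piMl// exprn_ge0//.
  have y1 : 1 <= (1 + y) `^ q.
    have : 1 `^ q <= (1 + y) `^ q by rewrite ge0_ler_powR ?nnegrE ?addr_ge0//; lra.
    by rewrite powR1.
  pose D := 2 * C * expR (k ^+ 2 / 2) * rho ^+ 3.
  have D0 : 0 <= D.
    apply: mulr_ge0; last exact: exprn_ge0.
    by apply: mulr_ge0; [exact: mulr_ge0|exact: expR_ge0].
  have eq1 : 1 <= expR (q * (2 * q - 1) ^+ 2 * rho ^+ 3).
    by rewrite expR_ge1// !mulr_ge0 ?sqr_ge0 ?exprn_ge0//; lra.
  have -> : expR ((q * (2 * q - 1) ^+ 2 + 2 * C * expR (k ^+ 2 / 2)) * rho ^+ 3) =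
      expR (q * (2 * q - 1) ^+ 2 * rho ^+ 3) * expR D.
    by rewrite -expRD /D; congr expR; ring.
  have main : expR (q * y) + D <= (1 + y) `^ q * (expR (q * (2 * q - 1) ^+ 2 * rho ^+ 3) * expR D).
    apply: (@le_trans _ _ ((1 + y) `^ q * expR (q * (2 * q - 1) ^+ 2 * rho ^+ 3) * (1 + D))).
      rewrite mulrDr mulr1 lerD//.
        apply: (le_trans ey); rewrite ler_wpM2l ?powR_ge0// ler_expR//.
      by rewrite ler_peMl// -[leLHS]mul1r ler_pM.
    by rewrite -mulrA ler_wpM2l ?powR_ge0// ler_wpM2l ?expR_ge0// expR_ge1Dx.
  rewrite (_ : 2 * A1 * _ + _ = al `^ q * (expR (q * y) + D)); last by rewrite /A1 /A2 /D; field.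
  by rewrite [leRHS]mulrCA ler_wpM2l// [leRHS]mulrC.
- exact: measurableT.
- by move=> z _; exact: c0.
- exact: mc.
- by move=> z _; exact: c0.
- exact: mc.
Qed.

Lemma quadf_shift (al be ga x y : R) :
  quadf al be ga (x + y) = quadf (quadf al be ga x) (be + ga * x) ga y.
Proof. by rewrite /quadf; ring. Qed.

Lemma quadfD (al be ga c x : R) : quadf al be ga x + c = quadf (al + c) be ga x.
Proof. by rewrite /quadf; ring. Qed.

(* The bounds for the two halves of a Gaussian of doubled variance multiply. *)
Lemma normal_powR_quadf_iter q : 1 <= q -> exists2 C, 0 <= C &
  forall n (e al be ga s : R), 0 < e -> e <= al -> 0 <= ga -> be ^+ 2 <= (al - e) * ga -> 0 < s ->
  s * Num.sqrt (ga / e) <= 1 ->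
  (\int[normal_prob 0 ((Num.sqrt 2) ^+ n * s)]_z ((quadf al be ga z) `^ q)%:E <=
   (expR (C * 2 ^+ n * (s * Num.sqrt (ga / e)) ^+ 3)
     * (al + (2 * q - 1) * ga * (2 ^+ n * s ^+ 2)) `^ q)%:E)%E.
Proof.
move=> q1; have [C C0 H] := normal_powR_quadf_small q1; exists C => //.
elim=> [|n IH] e al be ga s e0 eal ga0 bega s0 rho1.
  have al0 : 0 < al by exact: lt_le_trans eal.
  have rr : s * Num.sqrt (ga / al) <= s * Num.sqrt (ga / e).
    apply: ler_wpM2l; first exact: ltW.
    by apply: ler_wsqrtr; rewrite ler_wpM2l// lef_pV2.
  rewrite !expr0 !mul1r mulr1.
  apply: (le_trans (H al be ga s al0 ga0 _ s0 _)).
  - by apply: (le_trans bega); rewrite ler_wpM2r// gerBl ltW.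
  - exact: le_trans rho1.
  - rewrite lee_fin ler_wpM2r ?powR_ge0// ler_expR ler_wpM2l// lerXn2r// nnegrE mulr_ge0 ?sqrtr_ge0 ?ltW//.
set t := Num.sqrt 2 ^+ n * s.
have t0 : 0 < t by rewrite mulr_gt0// exprn_gt0// sqrtr_gt0.
have tN0 : t != 0 by rewrite gt_eqF.
rewrite exprS -mulrA -/t.
pose F z := ((quadf al be ga z) `^ q)%:E.
have mF : measurable_fun setT F := measurable_powR_quadf _ _ _ _.
have F0 z : (0 <= F z)%E by rewrite lee_fin powR_ge0.
rewrite -(ge0_integral_normal_conv tN0 mF F0).
set K := expR (C * 2 ^+ n * (s * Num.sqrt (ga / e)) ^+ 3).
pose ka := (2 * q - 1) * ga * (2 ^+ n * s ^+ 2).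
have ka0 : 0 <= ka.
  by rewrite !mulr_ge0 ?exprn_ge0 ?sqr_ge0 ?(ltW s0)//; lra.
(* For fixed [x] the integrand is again a [quadf] in [y], and translation leaves [al * ga - be ^+ 2]
   unchanged, so the hypothesis is inherited with the same [e]. The bound only adds the constant
   [ka] to [al], hence the outer integral has the same form. *)
have step x : (\int[normal_prob 0 t]_y F (x + y)%R <= K%:E * ((quadf (al + ka) be ga x) `^ q)%:E)%E.
  under eq_integral do rewrite /F quadf_shift.
  rewrite -quadfD -EFinM; apply: IH => //.
  - exact: quadf_ge.
  - rewrite /quadf; nra.
have mFxy : measurable_fun setT (fun xy : R * R => F (xy.1 + xy.2)%R).
  by apply: measurableT_comp => //; exact: measurable_funD.
apply: (@le_trans _ _ (\int[normal_prob 0 t]_x (K%:E * ((quadf (al + ka) be ga x) `^ q)%:E))%E).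
  apply: ge0_le_integral.
  - exact: measurableT.
  - by move=> x _; apply: integral_ge0 => y _; exact: F0.
  - exact: (measurable_fun_fubini_tonelli_F (m2 := normal_prob 0 t) _ mFxy).
  - by apply: emeasurable_funM => //; exact: measurable_powR_quadf.
  - by move=> x _; exact: step.
rewrite ge0_integralZl; last 4 first.
- exact: measurableT.
- exact: measurable_powR_quadf.
- by move=> x _; rewrite lee_fin powR_ge0.
- by rewrite lee_fin expR_ge0.
apply: (@le_trans _ _ (K%:E * (K * (al + ka + ka) `^ q)%:E)%E).
  rewrite lee_wpmul2l ?lee_fin ?expR_ge0//; apply: IH => //.
  - by rewrite ler_wpDr.
  - by apply: (le_trans bega); rewrite ler_wpM2r//; lra.
rewrite -EFinM lee_fin /K [leLHS]mulrA -expRD le_eqVlt; apply/orP; left; apply/eqP.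
rewrite ![2 ^+ n.+1]exprS; congr (expR _ * _ `^ _); first by ring.
by rewrite /ka; ring.
Qed.

(* Gaussian hypercontractivity: the exponent [q >= 1] is half of the moment [p]. *)
Lemma normal_powR_quadf q (al be ga s : R) :
  1 <= q -> 0 <= al -> 0 <= ga -> be ^+ 2 <= al * ga -> 0 < s ->
  (\int[normal_prob 0 s]_z ((quadf al be ga z) `^ q)%:E <=
   ((al + (2 * q - 1) * ga * s ^+ 2) `^ q)%:E)%E.
Proof.
move=> q1 al0 ga0 bega s0.
set M := al + (2 * q - 1) * ga * s ^+ 2.
have M0 : 0 <= M by rewrite addr_ge0// !mulr_ge0 ?sqr_ge0//; lra.
have q0 : 0 < q by lra.
have [C C0 H] := normal_powR_quadf_iter q1.
(* Raising [al] by [e] makes the stricter discriminant condition of [normal_powR_quadf_iter] hold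
   with this [e]. *)
have Ie e : 0 < e -> (\int[normal_prob 0 s]_z ((quadf al be ga z) `^ q)%:E <= ((M + e) `^ q)%:E)%E.
  move=> e0; set X := (M + e) `^ q.
  have X0 : 0 <= X := powR_ge0 _ _.
  apply/lee_addgt0Pr => d d0.
  set rho := s * Num.sqrt (ga / e).
  have rho0 : 0 <= rho by rewrite mulr_ge0 ?sqrtr_ge0 ?ltW.
  have d1 : 0 < ln (1 + d / (X + 1)).
    by rewrite ln_gt0// ltrDl divr_gt0//; lra.
  (* Cutting the variance into t^2 = 2^n pieces gives the excess exponent C t^2 (rho / t)^3 = C
     rho^3 / t. For t >= B it is at most ln(1 + d / (X + 1)), and each piece satisfies rho / t <=
     1. *)
  pose B := Num.max rho (C * rho ^+ 3 / ln (1 + d / (X + 1))).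
  have [n nB] : exists n, B <= Num.sqrt 2 ^+ n.
    have [n hn] : exists n, B <= 2 ^+ n.
      exists (Num.bound `|B|); apply: (le_trans (ler_norm _)).
      apply: ltW; apply: (lt_trans (archi_boundP (normr_ge0 B))).
      by rewrite -natrX ltr_nat ltn_expl.
    by exists (2 * n)%N; rewrite exprM sqr_sqrtr.
  set t := Num.sqrt 2 ^+ n in nB.
  have t0 : 0 < t by rewrite exprn_gt0// sqrtr_gt0.
  have t2 : t ^+ 2 = 2 ^+ n by rewrite -exprM mulnC exprM sqr_sqrtr.
  have := H n e (al + e) be ga (s / t) e0 _ ga0 _ _ _.
  rewrite [t * _]mulrC divfK ?gt_eqF// => Hn.
  apply: (@le_trans _ _ (\int[normal_prob 0 s]_z ((quadf (al + e) be ga z) `^ q)%:E)%E).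
    apply: ge0_le_integral.
    - exact: measurableT.
    - by move=> z _; rewrite lee_fin powR_ge0.
    - exact: measurable_powR_quadf.
    - exact: measurable_powR_quadf.
    - move=> z _; rewrite lee_fin -quadfD.
      have Q0 : 0 <= quadf al be ga z by apply: quadf_ge => //; rewrite subr0.
      by rewrite ge0_ler_powR ?nnegrE ?lerDl ?(ltW q0) ?(ltW e0)// addr_ge0// ltW.
  apply: (le_trans (Hn _ _ _ _)).
  - by rewrite lerDr.
  - by rewrite addrK.
  - by rewrite divr_gt0.
  - rewrite mulrAC ler_pdivrMr// mul1r -/rho; apply: le_trans nB.
    by rewrite le_max lexx.
  - rewrite -EFinD lee_fin.
    have -> : al + e + (2 * q - 1) * ga * (2 ^+ n * (s / t) ^+ 2) = M + e.
      by rewrite /M expr_div_n t2; field; rewrite expf_neq0.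
    rewrite -/X.
    have : expR (C * 2 ^+ n * (s / t * Num.sqrt (ga / e)) ^+ 3) <= 1 + d / (X + 1).
      rewrite -[leRHS]lnK; last by rewrite posrE addr_gt0// divr_gt0//; lra.
      rewrite ler_expR -t2 (_ : s / t * _ = rho / t); last by rewrite /rho; ring.
      rewrite (_ : C * _ * _ = C * rho ^+ 3 / t); last by field; rewrite gt_eqF.
      rewrite ler_pdivrMr// [leRHS]mulrC -ler_pdivrMr//.
      by apply: le_trans nB; rewrite le_max lexx orbT.
    move=> h; apply: (le_trans (ler_wpM2r X0 h)); rewrite mulrDl mul1r lerD2l.
    by rewrite mulrAC ler_pdivrMr; nra.
apply/lee_addgt0Pr => d d0.
have Mq0 : 0 <= M `^ q := powR_ge0 _ _.
(* The solution of (M + e)^q = M^q + d. *)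
pose e := (M `^ q + d) `^ q^-1 - M.
have e0 : 0 < e.
  have qN0 : q != 0 by rewrite gt_eqF.
  rewrite subr_gt0 -[ltLHS]powRr1// -(mulfV qN0) powRrM.
  by rewrite gt0_ltr_powR ?invr_gt0 ?nnegrE ?addr_ge0 ?(ltW d0)// ltrDl.
apply: (le_trans (Ie e e0)); rewrite -EFinD lee_fin /e addrC subrK -powRrM.
by rewrite mulVf ?gt_eqF// powRr1// addr_ge0// ltW.
Qed.

End gaussian_hypercontractivity.

(** * Increments independent of the past *)

Section freezing.
Local Open Scope ereal_scope.
Context (dsp dU : measure_display) (T : measurableType dsp) (U : measurableType dU).
Context (R : realType) (P : probability T R).
Variables (G : set (set T)) (xi : T -> U) (nu : probability U R).
Hypothesis Gm : G `<=` measurable.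
Hypothesis mxi : measurable_fun setT xi.

Lemma g_sigma_algebra_sub_measurable (S : set T) : <<s G >> S -> measurable S.
Proof. exact: (smallest_sub (@sigma_algebra_measurable _ T) Gm). Qed.

Lemma measurable_fun_g_sigma d' (V : measurableType d') (X : T -> V) :
  measurable_fun (setT : set (g_sigma_algebraType G)) X -> measurable_fun setT X.
Proof.
by move=> mX _ Y mY; apply: g_sigma_algebra_sub_measurable; exact: (mX measurableT Y mY).
Qed.

(** For fixed [C] the two sides are finite measures in [S] that agree on the pi-system [G], hence on
    the sigma-algebra it generates. *)
Lemma independent_g_sigma :
  setI_closed G -> G setT ->
  (forall S C, G S -> measurable C -> P (S `&` xi @^-1` C) = P S * nu C) ->
  forall S C, <<s G >> S -> measurable C -> P (S `&` xi @^-1` C) = P S * nu C.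
Proof.
move=> GI GT H S C GS mC.
have mD : measurable (xi @^-1` C) by rewrite -[X in measurable X]setTI; exact: mxi.
have c0 : (0 <= fine (nu C))%R by rewrite fine_ge0.
have cE : (fine (nu C))%:E = nu C by rewrite fineK// fin_num_measure.
pose m1 : {measure set T -> \bar R} := mrestr P mD.
pose m2 : {measure set T -> \bar R} := mscale (NngNum c0) P.
suff : m1 S = m2 S by rewrite /m1 /m2 /= /mrestr /mscale /= cE muleC.
apply: (g_sigma_algebra_measure_unique G Gm (fun=> setT)) => //.
- by apply/seteqP; split => // x _; exists 0%N.
- by move=> A GA; rewrite /m1 /m2 /= /mrestr /mscale /= cE muleC; exact: H.
- by move=> _; rewrite /m1 /= /mrestr setTI; apply: (le_lt_trans (probability_le1 _ _)); rewrite ?ltry.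
Qed.

Hypothesis indep : forall S C, <<s G >> S -> measurable C -> P (S `&` xi @^-1` C) = P S * nu C.

(** Conditioning without conditional expectations: the past is the identity map into [T] equipped
    with the sigma-algebra generated by [G]. Independence makes the joint law of this map and [xi] a
    product measure, to which Tonelli's theorem applies. *)
Lemma ge0_integral_freezing (F : g_sigma_algebraType G * U -> \bar R) :
  measurable_fun setT F -> (forall z, 0 <= F z) ->
  \int[P]_w F (w, xi w) = \int[P]_w \int[nu]_x F (w, x).
Proof.
move=> mF F0.
pose i0 : T -> g_sigma_algebraType G := id.
have mi0 : measurable_fun setT i0.
  by move=> _ A mA; rewrite setTI; exact: g_sigma_algebra_sub_measurable.
pose j0 (w : T) : g_sigma_algebraType G * U := (w, xi w).
have mj0 : measurable_fun setT j0 by exact: measurable_fun_pair.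
pose i : {mfun T >-> g_sigma_algebraType G} := HB.pack i0 (isMeasurableFun.Build _ _ _ _ _ mi0).
pose j : {mfun T >-> (g_sigma_algebraType G * U)%type} :=
  HB.pack j0 (isMeasurableFun.Build _ _ _ _ _ mj0).
pose P' : probability _ R := distribution P i.
transitivity (\int[distribution P j]_z F z).
  by rewrite (ge0_integral_distribution j mF F0).
transitivity (\int[P' \x nu]_z F z).
  apply: eq_measure_integral => A mA _; apply/esym.
  exact: product_measure_unique.
rewrite (fubini_tonelli1 (m1 := P') (m2 := nu) F mF F0).
rewrite (ge0_integral_distribution i)//.
- exact: (measurable_fun_fubini_tonelli_F (m2 := nu) F mF).
- by move=> w; apply: integral_ge0.
Qed.

End freezing.

Section freezing_gaussian.
Local Open Scope ereal_scope.
Context (dsp : measure_display) (T : measurableType dsp) (R : realType) (P : probability T R).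
Variables (G : set (set T)) (xi : T -> measurableTypeR R) (s : R).
Hypothesis Gm : G `<=` measurable.
Hypothesis mxi : measurable_fun setT xi.
Hypothesis indep : forall S C, <<s G >> S -> measurable C ->
  P (S `&` xi @^-1` C) = P S * normal_prob 0 s C.

(** With the past frozen the coefficients are constants, and [normal_powR_quadf] bounds the inner
    Gaussian integral pointwise. *)
Lemma ge0_integral_quadf_independent (q : R) (al be ga : g_sigma_algebraType G -> R) :
  (1 <= q)%R -> (0 < s)%R ->
  measurable_fun setT al -> measurable_fun setT be -> measurable_fun setT ga ->
  (forall w, 0 <= al w)%R -> (forall w, 0 <= ga w)%R -> (forall w, be w ^+ 2 <= al w * ga w)%R ->
  \int[P]_w ((quadf (al w) (be w) (ga w) (xi w)) `^ q)%:E <=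
  \int[P]_w ((al w + (2 * q - 1) * ga w * s ^+ 2) `^ q)%:E.
Proof.
move=> q1 s0 mal mbe mga al0 ga0 bega.
pose F (z : g_sigma_algebraType G * measurableTypeR R) := ((quadf (al z.1) (be z.1) (ga z.1) z.2) `^ q)%:E.
have mF : measurable_fun setT F.
  apply/measurable_EFinP; apply: (measurableT_comp (measurable_powR q)).
  have m1 (X : g_sigma_algebraType G -> R) : measurable_fun setT X ->
      measurable_fun setT (fun z : g_sigma_algebraType G * measurableTypeR R => X z.1).
    by move=> mX; exact: measurableT_comp.
  apply: measurable_funD.
    apply: measurable_funD; first exact: m1.
    by apply: measurable_funM => //; apply: measurable_funM => //; exact: m1.
  by apply: measurable_funM; [exact: m1|exact: measurable_funX].
have F0 z : 0 <= F z by rewrite lee_fin powR_ge0.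
have mR : measurable_fun (setT : set (g_sigma_algebraType G))
    (fun w => ((al w + (2 * q - 1) * ga w * s ^+ 2) `^ q)%:E).
  apply/measurable_EFinP; apply: (measurableT_comp (measurable_powR q)).
  by apply: measurable_funD => //; do 2 (apply: measurable_funM => //).
rewrite (ge0_integral_freezing (nu := normal_prob 0 s) Gm mxi indep mF F0); apply: ge0_le_integral.
- exact: measurableT.
- by move=> w _; apply: integral_ge0 => x _; exact: F0.
- apply: (measurable_fun_g_sigma Gm).
  exact: (measurable_fun_fubini_tonelli_F (m2 := normal_prob 0 s) F mF).
- exact: (measurable_fun_g_sigma Gm mR).
- by move=> w _; exact: (normal_powR_quadf q1 (al0 w) (ga0 w) (bega w) s0).
Qed.

End freezing_gaussian.

Section vector_norm.
Context (R : realType).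

Lemma mnorm_ge0 m k (A : 'M[R]_(m, k)) : 0 <= mnorm A.
Proof. exact: sqrtr_ge0. Qed.

Lemma mnorm_sqr m k (A : 'M[R]_(m, k)) :
  mnorm A ^+ 2 = \sum_(i < m) \sum_(j < k) A i j ^+ 2.
Proof.
by rewrite sqr_sqrtr// sumr_ge0// => i _; rewrite sumr_ge0// => j _; exact: sqr_ge0.
Qed.

Lemma mnorm_sqr_col m (x : 'cV[R]_m) : mnorm x ^+ 2 = dotv x x.
Proof. by rewrite mnorm_sqr /dotv; apply: eq_bigr => i _; rewrite big_ord1 expr2. Qed.

Lemma dotvDr m (x y z : 'cV[R]_m) : dotv x (y + z) = dotv x y + dotv x z.
Proof. by rewrite /dotv -big_split; apply: eq_bigr => i _; rewrite mxE mulrDr. Qed.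

Lemma dotvC m (x y : 'cV[R]_m) : dotv x y = dotv y x.
Proof. by apply: eq_bigr => i _; rewrite mulrC. Qed.

Lemma dotvZr m (a : R) (x y : 'cV[R]_m) : dotv x (a *: y) = a * dotv x y.
Proof. by rewrite /dotv mulr_sumr; apply: eq_bigr => i _; rewrite mxE mulrCA. Qed.

Lemma mnorm_sqrD m (x y : 'cV[R]_m) :
  mnorm (x + y) ^+ 2 = mnorm x ^+ 2 + 2 * dotv x y + mnorm y ^+ 2.
Proof.
by rewrite !mnorm_sqr_col dotvDr ![dotv (x + y) _]dotvC !dotvDr (dotvC y x); ring.
Qed.

Lemma mnorm_sqrZ m (a : R) (x : 'cV[R]_m) : mnorm (a *: x) ^+ 2 = a ^+ 2 * mnorm x ^+ 2.
Proof. by rewrite !mnorm_sqr_col dotvZr dotvC dotvZr; ring. Qed.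

Lemma mnormZ m (a : R) (x : 'cV[R]_m) : mnorm (a *: x) = `|a| * mnorm x.
Proof.
apply/eqP; rewrite -(@eqrXn2 _ 2)// ?mulr_ge0 ?mnorm_ge0//.
by rewrite mnorm_sqrZ exprMn real_normK ?num_real.
Qed.

Lemma mnorm0 m k : mnorm (0 : 'M[R]_(m, k)) = 0.
Proof.
rewrite /mnorm big1 ?sqrtr0// => i _; rewrite big1// => j _.
by rewrite mxE expr0n.
Qed.

Lemma dotv_sqr_le m (x y : 'cV[R]_m) : dotv x y ^+ 2 <= mnorm x ^+ 2 * mnorm y ^+ 2.
Proof.
have H (a : R) : 0 <= mnorm x ^+ 2 + 2 * (a * dotv x y) + a ^+ 2 * mnorm y ^+ 2.
  by rewrite -dotvZr -mnorm_sqrZ -mnorm_sqrD sqr_ge0.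
move: H; move: (mnorm x ^+ 2) (sqr_ge0 (mnorm x)) (mnorm y ^+ 2) (sqr_ge0 (mnorm y)) => X X0 Y Y0.
move: (dotv x y) => D H.
have [YE|YN0] := eqVneq Y 0.
  have [->|DN0] := eqVneq D 0; first by rewrite expr0n mulr_ge0.
  (* For |y| = 0 the nonnegative expression is affine in [a]; this [a] would give it the value - X -
     2. *)
  have := H (- (X + 1) / D); rewrite YE mulr0 addr0 mulr0.
  by rewrite divfK//; lra.
have Y1 : 0 < Y by rewrite lt0r YN0.
have := H (- D / Y).
have -> : X + 2 * (- D / Y * D) + (- D / Y) ^+ 2 * Y = X - D ^+ 2 / Y by field.
by rewrite subr_ge0 ler_pdivrMr.
Qed.

Lemma ler_dotv m (x y : 'cV[R]_m) : `|dotv x y| <= mnorm x * mnorm y.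
Proof.
rewrite -ler_sqr ?nnegrE ?mulr_ge0 ?mnorm_ge0//.
by rewrite real_normK ?num_real// exprMn dotv_sqr_le.
Qed.

Lemma ler_mnormD m (x y : 'cV[R]_m) : mnorm (x + y) <= mnorm x + mnorm y.
Proof.
rewrite -ler_sqr ?nnegrE ?addr_ge0 ?mnorm_ge0// mnorm_sqrD.
have := ler_dotv x y; rewrite ler_norml => /andP[_]; nra.
Qed.

Lemma ler_mnorm_sum m (I : Type) (r : seq I) (F : I -> 'cV[R]_m) :
  mnorm (\sum_(i <- r) F i) <= \sum_(i <- r) mnorm (F i).
Proof.
elim: r => [|i r IH]; first by rewrite !big_nil mnorm0.
by rewrite !big_cons (le_trans (ler_mnormD _ _))// lerD2l.
Qed.

Lemma mnorm_eq0 m (x : 'cV[R]_m) : mnorm x = 0 -> x = 0.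
Proof.
move=> x0; have : mnorm x ^+ 2 = 0 by rewrite x0 expr0n.
rewrite mnorm_sqr => /eqP; rewrite psumr_eq0; last first.
  by move=> i _; apply: sumr_ge0 => j _; exact: sqr_ge0.
move=> /allP H; apply/colP => i.
have := H i (mem_index_enum _); rewrite /= big_ord1 sqrf_eq0 => /eqP ->.
by rewrite mxE.
Qed.

End vector_norm.

Lemma measurable_sum_cond d (T : measurableType d) (R : realType) (I : Type)
    (r : seq I) (Q : pred I) (h : I -> T -> R) :
  (forall i, Q i -> measurable_fun setT (h i)) ->
  measurable_fun setT (fun x => \sum_(i <- r | Q i) h i x).
Proof.
move=> mh; under eq_fun do rewrite big_mkcond.
apply: (measurable_sum _ (h := fun i x => if Q i then h i x else 0)) => i.
by case: (boolP (Q i)) => // Qi; exact: mh.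
Qed.

Lemma measurable_mnorm (dsp : measure_display) (T : measurableType dsp) (R : realType) m k
    (X : T -> 'M[R]_(m, k)) : (forall i j, measurable_fun setT (fun w => X w i j)) ->
  measurable_fun setT (fun w => mnorm (X w)).
Proof.
move=> mX; rewrite /mnorm; apply: (measurableT_comp (f := @Num.sqrt R)).
  by apply: continuous_measurable_fun; exact: sqrt_continuous.
apply: (measurable_sum_cond _ (h := fun i w => _)) => i _.
apply: (measurable_sum_cond _ (h := fun j w => _)) => j _.
exact: measurable_funX.
Qed.

Section gaussian_increments.
Context (dsp : measure_display) (T : measurableType dsp) (R : realType) (P : probability T R).
Variables (d : nat) (dB : nat -> T -> 'cV[R]_d) (s : R).

(* The generators of the sigma-algebra of all the increments whose index
   [(i, l)] comes before [(k, j)] in the lexicographic order. *)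
Definition past_rect (k j : nat) : set (set T) :=
  [set S | exists A : nat -> 'I_d -> set R,
    [/\ forall i l, measurable (A i l),
        forall i (l : 'I_d), ~~ ((i < k)%N || ((i == k) && (l < j)%N)) -> A i l = setT
      & S = [set w | forall i l, A i l (dB i w l 0)]]].

Definition past (k j : nat) := g_sigma_algebraType (past_rect k j).

Hypothesis mdB : forall i l, measurable_fun setT (fun w => dB i w l 0).
Hypothesis dB_law : forall m (A : nat -> 'I_d -> set R), (forall i l, measurable (A i l)) ->
  (P (\bigcap_(i in `I_m) \bigcap_(l in [set: 'I_d]) [set w | dB i w l 0%R \in A i l])
   = \prod_(i < m) \prod_(l < d) normal_prob 0 s (A i l))%E.

Lemma past_rect_setI k j : setI_closed (past_rect k j).
Proof.
move=> _ _ [A [mA AT ->]] [B [mB BT ->]].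
exists (fun i l => A i l `&` B i l); split.
- by move=> i l; exact: measurableI.
- by move=> i l h; rewrite AT// BT// setTI.
- apply/seteqP; split => [w [hA hB] i l|w h]; first by split; [exact: hA|exact: hB].
  by split => i l; have [] := h i l.
Qed.

Lemma past_rect_setT k j : past_rect k j setT.
Proof. by exists (fun _ _ => setT); split => //; apply/seteqP; split. Qed.

(** Coordinates outside the past carry [setT], so the infinite family of constraints is a finite
    intersection, the form that [dB_law] handles. *)
Lemma past_rectE k j (A : nat -> 'I_d -> set R) :
  (forall i (l : 'I_d), ~~ ((i < k)%N || ((i == k) && (l < j)%N)) -> A i l = setT) ->
  [set w | forall i l, A i l (dB i w l 0)] =
  \bigcap_(i in `I_k.+1) \bigcap_(l in [set: 'I_d]) [set w | dB i w l 0 \in A i l].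
Proof.
move=> AT; apply/seteqP; split => w /= h.
  by move=> i _ l _ /=; rewrite in_setE; exact: h.
move=> i l; have [ik|ik] := ltnP i k.+1; first by have := h i ik l I; rewrite /= in_setE.
by rewrite AT// negb_or negb_and -leqNgt (ltnW ik) (gtn_eqF ik).
Qed.

Lemma past_rect_measurable k j : past_rect k j `<=` measurable.
Proof.
move=> _ [A [mA AT ->]]; rewrite (past_rectE AT).
apply: fin_bigcap_measurable => [|i _]; first exact: finite_II.
apply: fin_bigcap_measurable => [|l _]; first exact: finite_finset.
rewrite (_ : [set w | _] = (fun w => dB i w l 0) @^-1` (A i l)).
  by rewrite -[X in measurable X]setTI; exact: mdB.
by apply/seteqP; split => w /=; rewrite in_setE.
Qed.

Lemma past_rect_sub k j k' j' : (k < k')%N || ((k == k') && (j <= j')%N) ->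
  past_rect k j `<=` past_rect k' j'.
Proof.
move=> h S [A [mA AT ->]]; exists A; split => // i l il; apply: AT.
apply: contra il => /orP[ik|/andP[/eqP -> lj]].
  case/orP: h => [kk|/andP[/eqP <- _]]; last by rewrite ik.
  by rewrite (ltn_trans ik kk).
case/orP: h => [->//|/andP[/eqP <- jj]].
by rewrite eqxx (leq_trans lj jj) orbT.
Qed.

Lemma measurable_past_sub k j k' j' (X : T -> R) :
  (k < k')%N || ((k == k') && (j <= j')%N) ->
  measurable_fun (setT : set (past k j)) X -> measurable_fun (setT : set (past k' j')) X.
Proof.
move=> /past_rect_sub h mX _ Y mY.
exact: (sub_smallest2r _ _ (mX measurableT Y mY)).
Qed.

Lemma measurable_past_dB k j i (l : 'I_d) : (i < k)%N || ((i == k) && (l < j)%N) ->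
  measurable_fun (setT : set (past k j)) (fun w => dB i w l 0).
Proof.
move=> il _ C mC; apply: sub_sigma_algebra.
exists (fun i' l' => if (i' == i) && (l' == l) then C else setT); split.
- by move=> i' l'; case: ifP.
- move=> i' l' h; case: ifPn => // /andP[/eqP ii /eqP ll].
  by move: h; rewrite ii ll il.
- rewrite setTI; apply/seteqP; split => w /=; last by move=> /(_ i l); rewrite !eqxx.
  by move=> h i' l'; case: ifPn => // /andP[/eqP -> /eqP ->].
Qed.

(** A past rectangle leaves coordinate [j] of increment [k] free, so intersecting it with an event
    on that coordinate gives another rectangle, [A'], and [dB_law] factorises both probabilities. *)
Lemma past_independent k (j : 'I_d) (S : set T) (C : set (measurableTypeR R)) :
  <<s past_rect k j >> S -> measurable C ->
  (P (S `&` (fun w => dB k w j 0%R : measurableTypeR R) @^-1` C) = P S * normal_prob 0 s C)%E.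
Proof.
move: S C; apply: (independent_g_sigma (xi := fun w => dB k w j 0 : measurableTypeR R) (nu := normal_prob 0 s)).
- exact: past_rect_measurable.
- exact: mdB.
- exact: past_rect_setI.
- exact: past_rect_setT.
move=> S C [A [mA AT ->]] mC.
pose A' i l := if (i == k) && (l == j) then C else A i l.
have kj : ~~ ((k < k)%N || ((k == k) && (j < j)%N)) by rewrite !ltnn andbF.
have -> : [set w | forall i l, A i l (dB i w l 0)] `&` (fun w => dB k w j 0) @^-1` C =
    [set w | forall i l, A' i l (dB i w l 0)].
  apply/seteqP; split => [w /= [h hC] i l|w /= h].
    by rewrite /A'; case: ifPn => // /andP[/eqP -> /eqP ->].
  split; last by have := h k j; rewrite /A' !eqxx.
  move=> i l; have := h i l; rewrite /A'; case: ifPn => // /andP[/eqP -> /eqP ->] _.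
  by rewrite AT.
have A'T i (l : 'I_d) : ~~ ((i < k)%N || ((i == k) && (l < j.+1)%N)) -> A' i l = setT.
  move=> h; rewrite /A'; case: ifPn => [/andP[/eqP ik /eqP lj]|_].
    by move: h; rewrite ik lj !eqxx ltnSn orbT.
  apply: AT; apply: contra h => /orP[->//|/andP[-> lj]].
  by rewrite ltnS (ltnW lj) orbT.
rewrite (past_rectE AT) (past_rectE A'T) !dB_law//; last first.
  by move=> i l; rewrite /A'; case: ifP.
rewrite !big_ord_recr/= -muleA; congr (_ * _)%E.
  apply: eq_bigr => i _; apply: eq_bigr => l _.
  by rewrite /A' ltn_eqF.
rewrite (bigD1 j)//= [in RHS](bigD1 j)//= /A' !eqxx (AT _ _ kj).
rewrite [X in (_ = X * _ * _)%E](_ : _ = 1%E); last exact: probability_setT.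
rewrite mul1e muleC; congr (_ * _)%E.
by apply: eq_bigr => l lj; rewrite (negbTE lj) andbF.
Qed.

(** The coordinates of the increment are replaced by their variances one at a time. [V j] holds the
    noise of the first [j] columns, [c j] the compensator of the others, and [I0 j] interpolates
    between the two sides. In the comparison of [I0 j.+1] with [I0 j] everything but coordinate [j]
    is measurable for [past k j], and the integrand is a [quadf] in that coordinate. *)
Lemma dB_moment (q : R) (n k : nat) (x : T -> 'cV[R]_n) (g : T -> 'M[R]_(n, d)) :
  0 < s -> 1 <= q ->
  (forall i, measurable_fun (setT : set (past k 0)) (fun w => x w i 0)) ->
  (forall i l, measurable_fun (setT : set (past k 0)) (fun w => g w i l)) ->
  (\int[P]_w ((mnorm (x w + g w *m dB k w) ^+ 2) `^ q)%:E <=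
   \int[P]_w ((mnorm (x w) ^+ 2 + (2 * q - 1) * s ^+ 2 * mnorm (g w) ^+ 2) `^ q)%:E)%E.
Proof.
move=> s0 q1 mx mg.
pose V j w := x w + \sum_(l < d | (l < j)%N) dB k w l 0 *: col l (g w).
pose c j w := (2 * q - 1) * s ^+ 2 * \sum_(l < d | (j <= l)%N) mnorm (col l (g w)) ^+ 2.
pose I0 j := (\int[P]_w ((mnorm (V j w) ^+ 2 + c j w) `^ q)%:E)%E.
have Vd w : V d w = x w + g w *m dB k w.
  congr (_ + _); apply/colP => i; rewrite summxE !mxE; apply: eq_big => [l|l _]; first by rewrite ltn_ord.
  by rewrite !mxE mulrC.
have cd w : c d w = 0 by rewrite /c big1 ?mulr0// => l; rewrite leqNgt ltn_ord.
have V0 w : V 0%N w = x w by rewrite /V big1 ?addr0.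
have c0 w : c 0%N w = (2 * q - 1) * s ^+ 2 * mnorm (g w) ^+ 2.
  rewrite /c; congr (_ * _); rewrite mnorm_sqr exchange_big/=; apply: eq_bigr => l _.
  by rewrite mnorm_sqr; apply: eq_bigr => i _; rewrite big_ord1 mxE.
have step (j : 'I_d) : (I0 j.+1 <= I0 j)%E.
  have VS w : V j.+1 w = V j w + dB k w j 0 *: col j (g w).
    rewrite /V (bigD1 j)//= -addrA [X in _ + X]addrC; congr (_ + (_ + _)).
    by apply: eq_bigl => l; rewrite ltnS [RHS]ltn_neqAle andbC.
  have cS w : c j w = c j.+1 w + (2 * q - 1) * mnorm (col j (g w)) ^+ 2 * s ^+ 2.
    rewrite /c (bigD1 j)//= mulrDr addrC; congr (_ + _); last by ring.
    by congr (_ * _); apply: eq_bigl => l; rewrite [RHS]ltn_neqAle andbC eq_sym.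
  have c0' i w : 0 <= c i w.
    rewrite /c; apply: mulr_ge0; first by rewrite mulr_ge0 ?sqr_ge0//; lra.
    by apply: sumr_ge0 => l _; exact: sqr_ge0.
  have mg' i l : measurable_fun (setT : set (past k j)) (fun w => g w i l).
    by apply: (measurable_past_sub _ (mg i l)); rewrite eqxx orbT.
  have mx' i : measurable_fun (setT : set (past k j)) (fun w => x w i 0).
    by apply: (measurable_past_sub _ (mx i)); rewrite eqxx orbT.
  have mV i : measurable_fun (setT : set (past k j)) (fun w => V j w i 0).
    rewrite (_ : (fun w => _) = (fun w => x w i 0 + \sum_(l < d | (l < j)%N) dB k w l 0 * g w i l)).
      apply: measurable_funD => //.
      apply: (measurable_sum_cond (T := past k j) _ (h := fun l w => dB k w l 0 * g w i l)) => l lj.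
      by apply: measurable_funM => //; apply: measurable_past_dB; rewrite eqxx lj orbT.
    apply/funext => w; rewrite mxE summxE; congr (_ + _); apply: eq_bigr => l _.
    by rewrite !mxE.
  have mcol l : measurable_fun (setT : set (past k j)) (fun w => mnorm (col l (g w)) ^+ 2).
    under eq_fun do rewrite mnorm_sqr.
    apply: (measurable_sum_cond (T := past k j) _ (h := fun i w => _)) => i _.
    apply: (measurable_sum_cond (T := past k j) _ (h := fun o w => _)) => o _.
    rewrite (_ : (fun w => _) = (fun w : past k j => g w i l ^+ 2)).
      exact: measurable_funX.
    by apply/funext => w; rewrite mxE.
  have mc : measurable_fun (setT : set (past k j)) (c j.+1).
    apply: measurable_funM => //.
    exact: (measurable_sum_cond (T := past k j) _ (h := fun l w => mnorm (col l (g w)) ^+ 2)).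
  have mVn : measurable_fun (setT : set (past k j)) (fun w => mnorm (V j w) ^+ 2).
    under eq_fun do rewrite mnorm_sqr.
    apply: (measurable_sum_cond (T := past k j) _ (h := fun i w => _)) => i _.
    apply: (measurable_sum_cond (T := past k j) _ (h := fun o w => _)) => o _.
    by apply: measurable_funX; rewrite ord1.
  rewrite /I0.
  have -> : (fun w => ((mnorm (V j.+1 w) ^+ 2 + c j.+1 w) `^ q)%:E) =
    (fun w => ((quadf (mnorm (V j w) ^+ 2 + c j.+1 w) (dotv (V j w) (col j (g w)))
      (mnorm (col j (g w)) ^+ 2) (dB k w j 0)) `^ q)%:E).
    apply/funext => w; congr ((_ `^ q)%:E); rewrite VS mnorm_sqrD dotvZr mnorm_sqrZ /quadf; ring.
  have -> : (fun w => ((mnorm (V j w) ^+ 2 + c j w) `^ q)%:E) =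
    (fun w => ((mnorm (V j w) ^+ 2 + c j.+1 w + (2 * q - 1) * mnorm (col j (g w)) ^+ 2 * s ^+ 2) `^ q)%:E).
    by apply/funext => w; rewrite cS addrA.
  apply: (ge0_integral_quadf_independent (G := past_rect k j) (xi := fun w => dB k w j 0 : measurableTypeR R)).
  - exact: past_rect_measurable.
  - exact: mdB.
  - exact: past_independent.
  - exact: q1.
  - exact: s0.
  - exact: measurable_funD.
  - apply: (measurable_sum_cond (T := past k j) _ (h := fun i w => _)) => i _.
    rewrite (_ : (fun w => _) = (fun w : past k j => V j w i 0 * g w i j)).
      exact: measurable_funM.
    by apply/funext => w; rewrite [col _ _ _ _]mxE.
  - exact: mcol.
  - by move=> w; rewrite addr_ge0 ?sqr_ge0.
  - by move=> w; rewrite sqr_ge0.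
  - move=> w; apply: (le_trans (dotv_sqr_le _ _)); rewrite ler_wpM2r ?sqr_ge0//.
    by rewrite lerDl.
have mono j : (j <= d)%N -> (I0 j <= I0 0%N)%E.
  elim: j => [_|j IH jd]; first exact: lexx.
  exact: le_trans (step (Ordinal jd)) (IH (ltnW jd)).
have := mono d (leqnn d); rewrite /I0.
under eq_integral do rewrite Vd cd addr0.
by under [X in (_ <= X)%E -> _]eq_integral do rewrite V0 c0.
Qed.

End gaussian_increments.

(** * Power inequality and delayed Gronwall lemma *)

Section powR_inequalities.
Context (R : realType).
Implicit Types q r s x y z : R.

(** Young's inequality for the product of w^(1/r) and 1, where w = 1 + r (z - 1) and the exponents
    are r and r / (r - 1): its right-hand side is exactly [z]. *)
Lemma powR_bernoulli r z : 1 <= r -> 0 <= z -> 1 + r * (z - 1) <= z `^ r.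
Proof.
move=> r1 z0; have [w0|w0] := leP (1 + r * (z - 1)) 0.
  by rewrite (le_trans w0)// powR_ge0.
have [->|rN1] := eqVneq r 1; first by rewrite powRr1//; lra.
have r1' : 1 < r by rewrite lt_neqAle eq_sym rN1.
have r0 : 0 < r by lra.
set w := 1 + _ in w0 *.
have rr : 0 < r / (r - 1) by rewrite divr_gt0// subr_gt0.
have rN0 : r != 0 by rewrite gt_eqF.
have rN1' : r - 1 != 0 by rewrite subr_eq0.
have h : r^-1 + (r / (r - 1))^-1 = 1 by field; rewrite ?rN0 ?rN1'.
have := conjugate_powR (powR_ge0 w r^-1) ler01 r0 rr h.
rewrite mulr1 powR1 -powRrM mulVf ?gt_eqF// powRr1 ?(ltW w0)//.
have -> : w / r + 1 / (r / (r - 1)) = z.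
  by rewrite /w; field; rewrite ?rN0 ?rN1'.
move=> wz; have -> : w = (w `^ r^-1) `^ r by rewrite -powRrM mulVf ?gt_eqF// powRr1// ltW.
by rewrite ge0_ler_powR ?nnegrE ?powR_ge0// ltW.
Qed.

Lemma powR_tangent r x y : 1 <= r -> 0 < y -> 0 <= x ->
  y `^ r + r * y `^ (r - 1) * (x - y) <= x `^ r.
Proof.
move=> r1 y0 x0.
have := powR_bernoulli r1 (divr_ge0 x0 (ltW y0)).
move=> /(ler_wpM2l (powR_ge0 y r)); rewrite -powRM ?divr_ge0 ?(ltW y0)//.
rewrite [y * _]mulrC divfK ?gt_eqF//; apply: le_trans.
rewrite le_eqVlt; apply/orP; left; apply/eqP.
have -> : y `^ r = y * y `^ (r - 1) by rewrite mulr_powRB1//; lra.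
by field; rewrite gt_eqF.
Qed.

(** The tangent-line bound at the weighted mean, summed with the weights. The weights are not
    normalised, which produces the factor S^(r - 1). *)
Lemma powR_jensen (n : nat) (om x : 'I_n -> R) r : 1 <= r ->
  (forall i, 0 <= om i) -> (forall i, 0 <= x i) ->
  (\sum_(i < n) om i * x i) `^ r <=
  (\sum_(i < n) om i) `^ (r - 1) * \sum_(i < n) om i * x i `^ r.
Proof.
move=> r1 om0 x0; set S := \sum_(i < n) om i; set X := \sum_(i < n) om i * x i.
have S0 : 0 <= S by exact: sumr_ge0.
have X0 : 0 <= X by apply: sumr_ge0 => i _; rewrite mulr_ge0.
have RHS0 : 0 <= S `^ (r - 1) * \sum_(i < n) om i * x i `^ r.
  by rewrite mulr_ge0 ?powR_ge0// sumr_ge0// => i _; rewrite mulr_ge0 ?powR_ge0.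
have [XE|XN0] := eqVneq X 0; first by rewrite XE powR0//; lra.
have Xgt0 : 0 < X by rewrite lt0r XN0.
have Sgt0 : 0 < S.
  rewrite lt0r S0 andbT; apply: contra XN0 => /eqP SE.
  apply/eqP; rewrite /X big1// => i _.
  by rewrite (psumr_eq0P (fun i _ => om0 i) SE)// mul0r.
pose m := X / S; have m0 : 0 < m by rewrite divr_gt0.
have tan i : om i * (m `^ r + r * m `^ (r - 1) * (x i - m)) <= om i * x i `^ r.
  by rewrite ler_wpM2l// powR_tangent.
have : \sum_(i < n) om i * (m `^ r + r * m `^ (r - 1) * (x i - m)) <= \sum_(i < n) om i * x i `^ r.
  by apply: ler_sum => i _; exact: tan.
have -> : \sum_(i < n) om i * (m `^ r + r * m `^ (r - 1) * (x i - m)) = S * m `^ r.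
  under eq_bigr do rewrite mulrDr mulrCA mulrBr mulrBr.
  rewrite big_split/= -mulr_suml; under [X in _ + X]eq_bigr do rewrite -mulrBr.
  rewrite -mulr_sumr sumrB -mulr_suml -/X -/S /m.
  by rewrite [S * (X / S)]mulrC divfK ?gt_eqF// subrr mulr0 addr0.
move=> /(ler_wpM2l (powR_ge0 S (r - 1))); apply: le_trans.
rewrite mulrA [_ * S]mulrC mulr_powRB1//; last by lra.
by rewrite -powRM ?(ltW m0)// /m [S * _]mulrC divfK ?gt_eqF.
Qed.

Lemma powR_young q s x y : 0 < q -> 0 < s -> 0 <= x -> 0 <= y ->
  x `^ q * y `^ s <= q / (q + s) * x `^ (q + s) + s / (q + s) * y `^ (q + s).
Proof.
move=> q0 s0 x0 y0; have qs : 0 < q + s by rewrite addr_gt0.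
have P0 : 0 < (q + s) / q by rewrite divr_gt0.
have Q0 : 0 < (q + s) / s by rewrite divr_gt0.
have h : ((q + s) / q)^-1 + ((q + s) / s)^-1 = 1 by field; rewrite !gt_eqF.
have := conjugate_powR (powR_ge0 x q) (powR_ge0 y s) P0 Q0 h.
rewrite -!powRrM ![_ * ((q + s) / _)]mulrC !divfK ?gt_eqF//.
by rewrite !invf_div ![_ / (q + s) * _]mulrC.
Qed.

(* The weights are close to [1 - be] on [y] and small on the [x i]; the bound
   is the first order expansion of the [q]-th power, up to a relative error [eta]. *)
Lemma powR_perturb (n : nat) (om x : 'I_n -> R) q eta dl A be y :
  1 <= q -> 0 < eta <= 1 -> expR 1 * (2 * q) * dl <= eta ->
  (forall i, 0 <= om i) -> (forall i, 0 <= x i) -> 0 <= y -> 0 <= A ->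
  0 <= be <= dl -> \sum_(i < n) om i <= dl ->
  A <= (1 - be) * y + \sum_(i < n) om i * x i ->
  A `^ q <= (1 - q * be * (1 - eta) + (q - 1) * (1 + eta) * \sum_(i < n) om i) * y `^ q
    + (1 + eta) * \sum_(i < n) om i * x i `^ q.
Proof.
move=> q1 /andP[eta0 eta1] dl1 om0 x0 y0 A0 /andP[be0 bedl] Wdl AE.
set W := \sum_(i < n) om i in Wdl *.
have W0 : 0 <= W by exact: sumr_ge0.
have e1 : 1 <= expR 1 :> R by apply: expR_ge1.
have dl0 : 0 <= dl by exact: le_trans bedl.
have qdl : 2 * q * dl <= eta.
  by apply: le_trans dl1; rewrite -[leRHS]mulrA ler_peMl// mulr_ge0//; lra.
have be1 : be <= 1 by nra.
(* The current value joins the family as entry 0 with weight 1 - be, so that convexity treats all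
   terms together. *)
pose om' (i : 'I_n.+1) := if unlift ord0 i is Some j then om j else 1 - be.
pose x' (i : 'I_n.+1) := if unlift ord0 i is Some j then x j else y.
have sumE (F : 'I_n.+1 -> R) (G : 'I_n -> R) c : F ord0 = c -> (forall j, F (lift ord0 j) = G j) ->
    \sum_(i < n.+1) F i = c + \sum_(i < n) G i.
  by move=> Fc FG; rewrite big_ord_recl Fc; congr (_ + _); apply: eq_bigr => j _; rewrite FG.
have om'0 i : 0 <= om' i by rewrite /om'; case: unliftP => // _; rewrite subr_ge0.
have x'0 i : 0 <= x' i by rewrite /x'; case: unliftP.
have := powR_jensen q1 om'0 x'0.
rewrite (sumE om' om (1 - be)) /om' ?unlift_none//; last by move=> j; rewrite liftK.
rewrite (sumE _ (fun i => om i * x i) ((1 - be) * y)); last 2 first.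
- by rewrite /x' !unlift_none.
- by move=> j; rewrite /x' !liftK.
rewrite (sumE _ (fun i => om i * x i `^ q) ((1 - be) * y `^ q)); last 2 first.
- by rewrite /x' !unlift_none.
- by move=> j; rewrite /x' !liftK.
move=> J; have q0 : 0 <= q by lra.
have AJ : A `^ q <= ((1 - be) * y + \sum_(i < n) om i * x i) `^ q.
  by rewrite ge0_ler_powR ?nnegrE//; exact: le_trans AE.
apply: (le_trans (le_trans AJ J)).
have S0 : 0 <= 1 - be + W by lra.
have SE : (1 - be + W) `^ (q - 1) <= expR ((q - 1) * (W - be)).
  rewrite [(q - 1) * _]mulrC expRM ge0_ler_powR ?nnegrE ?expR_ge0//; first by lra.
  by apply: le_trans (expR_ge1Dx _); lra.
have yq : 0 <= y `^ q := powR_ge0 _ _.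
have oxq : 0 <= \sum_(i < n) om i * x i `^ q.
  by apply: sumr_ge0 => i _; rewrite mulr_ge0// powR_ge0.
(* [X] is the first order change of the coefficient of y^q. The condition on [dl] makes the
   remainder |X|^2 exp(|X|) at most [eta] times the first order bound. *)
pose X := - (q * be) + (q - 1) * W.
have Xl : `|X| <= q * be + (q - 1) * W.
  have := mulr_ge0 q0 be0; have q10 : 0 <= q - 1 by lra.
  by have := mulr_ge0 q10 W0; rewrite ler_norml /X => h1 h2; apply/andP; split; lra.
have XX : q * be + (q - 1) * W <= 2 * q * dl.
  have q10 : 0 <= q - 1 by lra.
  by have := ler_wpM2l q0 bedl; have := ler_wpM2l q10 Wdl; lra.
have X1 : `|X| <= 1 by lra.
have T1 : (1 - be) * expR ((q - 1) * (W - be)) <=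
    1 - q * be * (1 - eta) + (q - 1) * (1 + eta) * W.
  apply: (@le_trans _ _ (expR X)).
    rewrite (_ : X = - be + (q - 1) * (W - be)); last by rewrite /X; ring.
    by rewrite expRD ler_wpM2r ?expR_ge0//; exact: expR_ge1Dx.
  have := expR_taylor1 X; rewrite ler_norml => /andP[_].
  have : `|X| ^+ 2 * expR `|X| <= eta * (q * be + (q - 1) * W).
    apply: (@le_trans _ _ (`|X| * (expR 1 * `|X|))).
      rewrite expr2 -mulrA ler_wpM2l// mulrC ler_wpM2r// ler_expR//.
    rewrite mulrC ler_pM ?mulr_ge0 ?expR_ge0//.
    apply: le_trans dl1; rewrite -mulrA ler_wpM2l ?expR_ge0//; lra.
  by rewrite /X; lra.
have T2 : expR ((q - 1) * (W - be)) <= 1 + eta.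
  apply: (@le_trans _ _ (expR ((q - 1) * dl))).
    by rewrite ler_expR ler_wpM2l//; lra.
  have t0 : 0 <= (q - 1) * dl by rewrite mulr_ge0//; lra.
  have := expR_taylor0 ((q - 1) * dl).
  have : expR `|(q - 1) * dl| <= expR 1 by rewrite ler_expR ger0_norm//; lra.
  rewrite !ger0_norm ?subr_ge0 ?expR_ge1// => h /le_trans h2.
  have := h2 _ (ler_wpM2l t0 h); rewrite lerBlDl => /le_trans; apply.
  by rewrite lerD2l; apply: le_trans dl1; have := expR_gt0 (1 : R); nra.
apply: (@le_trans _ _ (expR ((q - 1) * (W - be)) *
   ((1 - be) * y `^ q + \sum_(i < n) om i * x i `^ q))).
  by rewrite ler_wpM2r// addr_ge0// mulr_ge0// subr_ge0.
rewrite mulrDr mulrA [expR _ * (1 - be)]mulrC.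
by rewrite lerD// ler_wpM2r.
Qed.

(** The superlinear terms are read as linear ones with state-dependent weights, y^(1 + s) = y^s y,
    so that [powR_perturb] applies; the two bounds by [dl] say that these weights are small. The
    expansion creates products of y^q with powers s of the [x i], and Young's inequality splits them
    with the fractions q / (q + s) and s / (q + s). *)
Lemma powR_step (n : nat) (B v x : 'I_n -> R) q s eta dl Dt A a1 b3 b4 y :
  1 <= q -> 0 < s -> 0 < eta <= 1 -> expR 1 * (2 * q) * dl <= eta ->
  0 <= Dt -> 0 <= a1 -> 0 <= b3 -> 0 <= b4 ->
  (forall i, 0 <= B i) -> (forall i, 0 <= v i) -> \sum_(i < n) v i = 1 ->
  (forall i, 0 <= x i) -> 0 <= y -> 0 <= A ->
  Dt * (a1 + b3 * y `^ s) <= dl ->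
  Dt * (\sum_(i < n) B i + b4 * \sum_(i < n) v i * x i `^ s) <= dl ->
  A <= y + Dt * (- a1 * y + \sum_(i < n) B i * x i - b3 * y `^ (1 + s)
                + b4 * \sum_(i < n) v i * x i `^ (1 + s)) ->
  A `^ q <= y `^ q + Dt *
    (- (q * a1 * (1 - eta) - (q - 1) * (1 + eta) * \sum_(i < n) B i) * y `^ q
     + (1 + eta) * \sum_(i < n) B i * x i `^ q
     - (q * b3 * (1 - eta) - (q - 1) * (1 + eta) * b4 * (q / (q + s))) * y `^ (q + s)
     + (1 + eta) * b4 * (1 + (q - 1) * (s / (q + s))) * \sum_(i < n) v i * x i `^ (q + s)).
Proof.
move=> q1 s0 eta01 dl1 Dt0 a10 b30 b40 B0 v0 v1 x0 y0 A0 bedl Wdl AE.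
have eta0 : 0 < eta by case/andP: eta01.
have q0 : 0 < q by lra.
pose be := Dt * (a1 + b3 * y `^ s).
pose om i := Dt * (B i + b4 * (v i * x i `^ s)).
have om0 i : 0 <= om i.
  by rewrite mulr_ge0// addr_ge0// mulr_ge0// mulr_ge0// powR_ge0.
have be0 : 0 <= be by rewrite mulr_ge0// addr_ge0// mulr_ge0// powR_ge0.
have omE : \sum_(i < n) om i = Dt * (\sum_(i < n) B i + b4 * \sum_(i < n) v i * x i `^ s).
  by rewrite -mulr_sumr big_split/= -mulr_sumr.
have pD (z a : R) : 0 <= z -> 0 < a -> z `^ s * z `^ a = z `^ (a + s).
  by move=> z0 a0; rewrite addrC powRD//; apply/implyP => /eqP; lra.
have omx : \sum_(i < n) om i * x i = Dt * (\sum_(i < n) B i * x i + b4 * \sum_(i < n) v i * x i `^ (1 + s)).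
  rewrite [b4 * _]mulr_sumr -big_split/= mulr_sumr; apply: eq_bigr => i _.
  by rewrite -(pD _ _ (x0 i) ltr01) powRr1// /om; ring.
have omxq : \sum_(i < n) om i * x i `^ q = Dt * (\sum_(i < n) B i * x i `^ q + b4 * \sum_(i < n) v i * x i `^ (q + s)).
  rewrite [b4 * _]mulr_sumr -big_split/= mulr_sumr; apply: eq_bigr => i _.
  by rewrite -(pD _ _ (x0 i) q0) /om; ring.
have bey : be * y = Dt * (a1 * y + b3 * y `^ (1 + s)).
  by rewrite -(pD _ _ y0 ltr01) powRr1// /be; ring.
have beyq : be * y `^ q = Dt * (a1 * y `^ q + b3 * y `^ (q + s)).
  by rewrite -(pD _ _ y0 q0) /be; ring.
have := @powR_perturb n om x q eta dl A be y q1 eta01 dl1 om0 x0 y0 A0.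
rewrite be0 bedl omE => /(_ isT Wdl); rewrite omx => H.
apply: (le_trans (H _)).
  by apply: (le_trans AE); rewrite mulrBl mul1r bey; lra.
rewrite omxq.
have Y : y `^ q * \sum_(i < n) v i * x i `^ s <=
   q / (q + s) * y `^ (q + s) + s / (q + s) * \sum_(i < n) v i * x i `^ (q + s).
  have -> : q / (q + s) * y `^ (q + s) = \sum_(i < n) v i * (q / (q + s) * y `^ (q + s)).
    by rewrite -mulr_suml v1 mul1r.
  rewrite mulr_sumr [s / _ * _]mulr_sumr -big_split/=; apply: ler_sum => i _.
  have := ler_wpM2l (v0 i) (powR_young q0 s0 y0 (x0 i)).
  by move=> h; lra.
move: Y beyq; move: (\sum_(i < n) v i * x i `^ s) (\sum_(i < n) v i * x i `^ (q + s)) => V Vqs.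
move: (\sum_(i < n) B i) (\sum_(i < n) B i * x i `^ q) => SB SBq.
move: (y `^ q) (y `^ (q + s)) => Yq Yqs Y beyq.
have -> : (1 - q * be * (1 - eta) + (q - 1) * (1 + eta) * (Dt * (SB + b4 * V))) * Yq =
  Yq - q * (1 - eta) * (be * Yq) + Dt * ((q - 1) * (1 + eta) * (SB * Yq))
   + Dt * ((q - 1) * (1 + eta) * b4 * (Yq * V)) by ring.
rewrite beyq.
have c0 : 0 <= Dt * ((q - 1) * (1 + eta) * b4) by rewrite mulr_ge0// !mulr_ge0//; lra.
have := ler_wpM2l c0 Y.
move: (q / (q + s)) (s / (q + s)) => t1 t2.
lra.
Qed.

(** Multiply by [c ^+ (k + N)] with c = exp(nu2 Dt) and sum. Moving a delayed term to its own time
    costs at most the factor c^N, which the conditions on [c1] and [c3] allow for; the first [N]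
    values are left over and go into [M]. Index [k + N] stands for step [k] of the scheme. *)
Lemma delay_gronwall (N : nat) (e a : nat -> R) (C D : 'I_N.+1 -> R) (c1 c3 nu2 Dt : R) :
  (forall k, 0 <= e k) -> (forall k, 0 <= a k) ->
  (forall i, 0 <= C i) -> (forall i, 0 <= D i) -> 0 < Dt -> 0 <= nu2 ->
  nu2 + (\sum_(i < N.+1) C i) * expR (nu2 * (Dt * N%:R)) <= c1 ->
  (\sum_(i < N.+1) D i) * expR (nu2 * (Dt * N%:R)) <= c3 ->
  (forall k, e (k + N).+1 <= e (k + N)%N + Dt * (- c1 * e (k + N)%N
     + \sum_(i < N.+1) C i * e (k + i)%N - c3 * a (k + N)%N + \sum_(i < N.+1) D i * a (k + i)%N)) ->
  exists M : R, 0 <= M /\ forall k, e (k + N)%N <= M * expR (- (nu2 * (k%:R * Dt))).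
Proof.
move=> e0 a0 C0 D0 Dt0 nu20 c1E c3E rec.
pose c := expR (nu2 * Dt).
have c1' : 1 <= c by rewrite expR_ge1// mulr_ge0// ltW.
have cgt0 : 0 < c by exact: expR_gt0.
have cX k : c ^+ k = expR (nu2 * (Dt * k%:R)).
  by rewrite /c -expRM_natl; congr expR; ring.
rewrite -cX in c1E c3E.
pose SC := \sum_(i < N.+1) C i; pose SD := \sum_(i < N.+1) D i.
(* The sum of the delayed terms is bounded by the undelayed one, up to the initial segment. *)
have delay (u : nat -> R) (w : 'I_N.+1 -> R) K : (forall k, 0 <= u k) -> (forall i, 0 <= w i) ->
   \sum_(k < K) c ^+ (k + N) * (\sum_(i < N.+1) w i * u (k + i)%N) <=
   (\sum_(i < N.+1) w i) * c ^+ N * (\sum_(j < N) c ^+ j * u j + \sum_(k < K) c ^+ (k + N) * u (k + N)%N).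
  move=> u0 w0.
  have -> : \sum_(j < N) c ^+ j * u j + \sum_(k < K) c ^+ (k + N) * u (k + N)%N =
     \sum_(j < N + K) c ^+ j * u j.
    rewrite big_split_ord/=; congr (_ + _); apply: eq_bigr => k _.
    by rewrite addnC.
  under eq_bigr do rewrite mulr_sumr.
  rewrite exchange_big/= -mulrA mulr_suml; apply: ler_sum => i _.
  have -> : \sum_(k < K) c ^+ (k + N) * (w i * u (k + i)%N) =
    w i * (c ^+ (N - i) * \sum_(k < K) c ^+ (i + k) * u (i + k)%N).
    rewrite !mulr_sumr; apply: eq_bigr => k _.
    have -> : (k + N = (N - i) + (i + k))%N by have := ltn_ord i; lia.
    by rewrite exprD [(k + i)%N]addnC; ring.
  rewrite ler_wpM2l//.
  have uj0 j : 0 <= c ^+ j * u j by rewrite mulr_ge0 ?exprn_ge0// ltW.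
  apply: ler_pM.
  - by rewrite exprn_ge0 ?ltW.
  - by apply: sumr_ge0 => k _.
  - by rewrite ler_weXn2l// leq_subr.
  - have iN : (i <= N)%N by rewrite -ltnS.
    rewrite (_ : (N + K = i + (K + (N - i)))%N); last by lia.
    rewrite big_split_ord/= ler_wpDl//; first by apply: sumr_ge0 => k _.
    rewrite big_split_ord/= lerDl.
    by apply: sumr_ge0 => k _.
pose Se := \sum_(j < N) c ^+ j * e j; pose Sa := \sum_(j < N) c ^+ j * a j.
have Se0 : 0 <= Se by apply: sumr_ge0 => j _; rewrite mulr_ge0 ?exprn_ge0// ltW.
have Sa0 : 0 <= Sa by apply: sumr_ge0 => j _; rewrite mulr_ge0 ?exprn_ge0// ltW.
pose M := c ^+ N * e N + c * Dt * (SC * c ^+ N * Se + SD * c ^+ N * Sa).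
have SC0 : 0 <= SC by exact: sumr_ge0.
have SD0 : 0 <= SD by exact: sumr_ge0.
have M0 : 0 <= M.
  by rewrite addr_ge0 ?mulr_ge0 ?exprn_ge0 ?addr_ge0 ?mulr_ge0 ?exprn_ge0 // ltW.
have main K : c ^+ (K + N) * e (K + N)%N <= M.
  have telesc : c ^+ (K + N) * e (K + N)%N <= c ^+ N * e N + c * Dt *
     (\sum_(k < K) (c ^+ (k + N) * (\sum_(i < N.+1) C i * e (k + i)%N)
        + c ^+ (k + N) * (\sum_(i < N.+1) D i * a (k + i)%N)
        - (c1 - nu2) * (c ^+ (k + N) * e (k + N)%N) - c3 * (c ^+ (k + N) * a (k + N)%N))).
    elim: K => [|K IH]; first by rewrite big_ord0 mulr0 addr0.
    rewrite big_ord_recr/= [X in _ + X]mulrDr addrA.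
    apply: le_trans (lerD IH (lexx _)).
    rewrite addSn exprS.
    have cN0 : 0 <= c ^+ (K + N) by rewrite exprn_ge0// ltW.
    have := ler_wpM2l (mulr_ge0 (ltW cgt0) cN0) (rec K).
    (* From 1 - x <= exp(- x): the growth of the weight in one step is paid for by the [nu2] in the
       condition on [c1]. *)
    have cc : c - 1 <= c * (nu2 * Dt).
      have := expR_ge1Dx (- (nu2 * Dt)); rewrite expRN -/c => h.
      have := ler_wpM2l (ltW cgt0) h; rewrite mulfV ?gt_eqF//; lra.
    have := ler_wpM2r (mulr_ge0 cN0 (e0 (K + N)%N)) cc.
    move: (\sum_(i < N.+1) C i * e (K + i)%N) (\sum_(i < N.+1) D i * a (K + i)%N) => X Y.
    move: (e (K + N)%N) (a (K + N)%N) (e (K + N).+1) (c ^+ (K + N)) => u v u' z.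
    move=> h1 h2; lra.
  apply: (le_trans telesc); rewrite lerD2l ler_wpM2l//; first by rewrite mulr_ge0 ?ltW.
  rewrite !sumrB big_split/= -!mulr_sumr.
  have := delay e C K e0 C0; have := delay a D K a0 D0; rewrite -/SC -/SD -/Se -/Sa.
  have E0 : 0 <= \sum_(k < K) c ^+ (k + N) * e (k + N)%N.
    by apply: sumr_ge0 => j _; rewrite mulr_ge0 ?exprn_ge0// ltW.
  have A0 : 0 <= \sum_(k < K) c ^+ (k + N) * a (k + N)%N.
    by apply: sumr_ge0 => j _; rewrite mulr_ge0 ?exprn_ge0// ltW.
  have := ler_wpM2r E0 c1E; have := ler_wpM2r A0 c3E; rewrite -/SC -/SD.
  move: (\sum_(k < K) c ^+ (k + N) * e (k + N)%N) (\sum_(k < K) c ^+ (k + N) * a (k + N)%N) => E A.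
  move: (\sum_(k < K) _) (\sum_(k < K) _) => X Y; lra.
exists M; split=> // k.
have := main k; rewrite exprD -mulrA => h.
rewrite expRN -ler_pdivrMr ?invr_gt0 ?expR_gt0// invrK mulrC.
have -> : expR (nu2 * (k%:R * Dt)) = c ^+ k by rewrite cX; congr expR; ring.
apply: le_trans h; rewrite ler_wpM2l ?exprn_ge0 ?(ltW cgt0)//.
by rewrite ler_peMl// exprn_ege1.
Qed.

End powR_inequalities.

(** * Interpolated segments and dissipativity *)

Section hat_functions.
Context (R : realType).
Variables (tau : R) (N : nat).
Hypothesis tau0 : 0 < tau.
Hypothesis N0 : (0 < N)%N.
Let Dt : R := tau / N%:R.

Let N0' : 0 < N%:R :> R. Proof. by rewrite ltr0n. Qed.
Let Dt0 : 0 < Dt. Proof. by rewrite divr_gt0. Qed.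

Lemma hat_ge0 i t : 0 <= hat Dt N i t.
Proof. by rewrite /hat le_max lexx. Qed.

Let clamp (x : R) : R := Num.min 1 (Num.max 0 x).

(** As differences of consecutive ramps the hats telescope, which is how [sum_hat] obtains a
    partition of unity on the delay interval. *)
Lemma hat_clamp i t : hat Dt N i t =
  clamp (t / Dt + N%:R + 1 - i%:R) - clamp (t / Dt + N%:R + 1 - i.+1%:R).
Proof.
have -> : hat Dt N i t = Num.max 0 (1 - `|t / Dt + N%:R - i%:R|).
  rewrite /hat -[in LHS](ger0_norm (ltW Dt0)) -normf_div ger0_norm ?(ltW Dt0)//.
  congr (Num.max 0 (1 - `|_|)); field.
  by rewrite /Dt mulf_neq0 ?invr_neq0 ?gt_eqF.
rewrite -[i.+1]addn1 natrD.
set u := t / Dt + N%:R - i%:R.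
have -> : t / Dt + N%:R + 1 - i%:R = u + 1 by rewrite /u; ring.
have -> : t / Dt + N%:R + 1 - (i%:R + 1) = u by rewrite /u; ring.
rewrite /clamp.
have [u0|u0] := leP 0 u.
  rewrite (ger0_norm u0) (max_idPr (_ : 0 <= u + 1)); last by lra.
  rewrite (min_idPl (_ : 1 <= u + 1)); last by lra.
  have [u1|u1] := leP u 1; first by rewrite (max_idPr _)//; lra.
  by rewrite (max_idPl _) ?subrr//; lra.
rewrite ltr0_norm// opprK (min_idPr ler01) subr0 [1 + u]addrC.
have [u1|u1] := leP 0 (u + 1); first by rewrite (min_idPr _)//; lra.
by rewrite (min_idPr ler01).
Qed.

Lemma sum_hat t : - tau <= t <= 0 -> \sum_(i < N.+1) hat Dt N i t = 1.
Proof.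
move=> /andP[t1 t2].
under eq_bigr do rewrite hat_clamp.
rewrite -(big_mkord xpredT (fun i => clamp (t / Dt + N%:R + 1 - i%:R) - clamp (t / Dt + N%:R + 1 - i.+1%:R))).
under eq_bigr do rewrite -opprB.
rewrite sumrN telescope_sumr// opprB subr0.
have h1 : t / Dt <= 0 by rewrite ler_pdivrMr ?mul0r.
have h2 : - N%:R <= t / Dt.
  by rewrite ler_pdivlMr// /Dt mulNr mulrC divfK ?gt_eqF.
rewrite -[N.+1]addn1 natrD /clamp.
rewrite (max_idPr (_ : 0 <= t / Dt + N%:R + 1)); last by lra.
rewrite (min_idPl (_ : 1 <= t / Dt + N%:R + 1)); last by lra.
by rewrite (max_idPl (_ : _ <= 0)) ?minEle ?ler10 ?subr0//; lra.
Qed.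

Lemma hat_le1 i t : hat Dt N i t <= 1.
Proof. by rewrite /hat ge_max ler01 lerBlDr lerDl divr_ge0// ltW. Qed.

Lemma hat_at0 i : (i <= N)%N -> hat Dt N i 0 = (i == N)%:R.
Proof.
move=> iN; rewrite /hat.
have -> : 0 - (i%:R - N%:R) * Dt = (N%:R - i%:R) * Dt by ring.
rewrite normrM (ger0_norm (ltW Dt0)) mulfK ?(gt_eqF Dt0)//.
have [->|niN] := eqVneq i N; first by rewrite subrr normr0 subr0 maxEle ler01.
have iN' : (i.+1 <= N)%N by rewrite ltn_neqAle niN.
have : (i.+1)%:R <= N%:R :> R by rewrite ler_nat.
rewrite -[i.+1]addn1 natrD => h; rewrite ger0_norm; last by lra.
by rewrite (max_idPl _)//; lra.
Qed.

Lemma continuous_hat i : continuous (hat Dt N i).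
Proof.
rewrite (_ : hat Dt N i = fun t => (1 - `|t - (i%:R - N%:R) * Dt| / Dt + `|1 - `|t - (i%:R - N%:R) * Dt| / Dt|) / 2).
  have h : continuous (fun t : R => 1 - `|t - (i%:R - N%:R) * Dt| / Dt).
    move=> t; apply: cvgB; first exact: cvg_cst.
    apply: cvgM; last exact: cvg_cst.
    by apply: cvg_norm; apply: cvgB; [exact: cvg_id|exact: cvg_cst].
  move=> t; apply: cvgM; last exact: cvg_cst.
  by apply: cvgD; [exact: h|apply: cvg_norm; exact: h].
apply/funext => t; rewrite /hat; set x := 1 - _.
have [x0|x0] := leP 0 x; first by rewrite ger0_norm//; field.
by rewrite ltr0_norm// subrr mul0r.
Qed.

Lemma measurable_hat i : measurable_fun setT (hat Dt N i).
Proof. by apply: continuous_measurable_fun; exact: continuous_hat. Qed.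

Lemma interp0 n (w : seq 'cV[R]_n) : interp Dt N w 0 = nth 0 w N.
Proof.
rewrite /interp big_ord_recr/= hat_at0// eqxx scale1r big1 ?add0r// => i _.
by rewrite hat_at0 ?(ltnW (ltn_ord i))// (ltn_eqF (ltn_ord i)) scale0r.
Qed.

Lemma continuous_colP n (X : R -> 'cV[R]_n) :
  (forall i, continuous (fun t => X t i 0)) -> continuous X.
Proof.
move=> cX t A [Q XQ QA].
have : \forall u \near t, forall i : 'I_n, Q i 0 (X u i 0).
  by apply: (@filter_forall _ _ _ (nbhs t)) => i; exact: (cX i t _ (XQ i 0)).
apply: filterS => u h; apply: QA => i j; rewrite ord1; exact: h.
Qed.

Lemma continuous_sum n (h : 'I_n -> R -> R) : (forall i, continuous (h i)) ->
  continuous (fun t => \sum_(i < n) h i t).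
Proof.
elim: n h => [|n IH] h ch.
  rewrite (_ : (fun t => _) = (fun _ => 0)); first by move=> t; exact: cvg_cst.
  by apply/funext => t; rewrite big_ord0.
rewrite (_ : (fun t => _) = fun t => h ord0 t + \sum_(i < n) h (lift ord0 i) t).
  by move=> t; apply: cvgD; [exact: ch|exact: (IH (fun i => h (lift ord0 i)))].
by apply/funext => t; rewrite big_ord_recl.
Qed.

Lemma interp_is_C n (w : seq 'cV[R]_n) : is_C tau (interp Dt N w).
Proof.
apply: continuous_subspaceT; apply: continuous_colP => i.
rewrite (_ : (fun t => _) = fun t => \sum_(j < N.+1) hat Dt N j t * nth 0 w j i 0).
  apply: continuous_sum => j t; apply: cvgM; last exact: cvg_cst.
  exact: continuous_hat.
by apply/funext => t; rewrite summxE; apply: eq_bigr => j _; rewrite mxE.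
Qed.

Lemma mnorm_interp n (w : seq 'cV[R]_n) t :
  mnorm (interp Dt N w t) <= \sum_(i < N.+1) hat Dt N i t * mnorm (nth 0 w i).
Proof.
apply: (le_trans (ler_mnorm_sum _ _)); apply: ler_sum => i _.
by rewrite mnormZ ger0_norm// hat_ge0.
Qed.

Lemma mnorm_interp_le n (w : seq 'cV[R]_n) h t : - tau <= t <= 0 ->
  (forall i, (i <= N)%N -> mnorm (nth 0 w i) <= h) -> mnorm (interp Dt N w t) <= h.
Proof.
move=> t01 wh; apply: (le_trans (mnorm_interp w t)).
rewrite -[leRHS]mul1r -(sum_hat t01) mulr_suml; apply: ler_sum => i _.
by rewrite ler_wpM2l ?hat_ge0// wh// -ltnS.
Qed.

Lemma mnorm_interp_powR n (w : seq 'cV[R]_n) r t : 1 <= r -> - tau <= t <= 0 ->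
  mnorm (interp Dt N w t) `^ r <= \sum_(i < N.+1) hat Dt N i t * mnorm (nth 0 w i) `^ r.
Proof.
move=> r1 t01.
have := @powR_jensen R N.+1 (fun i => hat Dt N i t) (fun i => mnorm (nth 0 w i)) r r1
  (fun i => hat_ge0 i t) (fun i => mnorm_ge0 _).
rewrite (sum_hat t01) powR1 mul1r; apply: le_trans.
rewrite ge0_ler_powR ?nnegrE ?mnorm_ge0//; first by lra.
- by apply: sumr_ge0 => i _; rewrite mulr_ge0 ?hat_ge0 ?mnorm_ge0.
- exact: mnorm_interp.
Qed.

Lemma measurable_mnorm_interp n (w : seq 'cV[R]_n) :
  measurable_fun setT (fun t => mnorm (interp Dt N w t)).
Proof.
apply: measurable_mnorm => i j.
rewrite (_ : (fun t => _) = fun t => \sum_(l < N.+1) hat Dt N l t * nth 0 w l i j).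
  apply: (measurable_sum_cond _ (h := fun l t => _)) => l _.
  by apply: measurable_funM => //; exact: measurable_hat.
by apply/funext => t; rewrite summxE; apply: eq_bigr => l _; rewrite mxE.
Qed.

End hat_functions.

Section int_tau.
Context (R : realType).
Variable tau : R.
Hypothesis tau0 : 0 < tau.
Notation mu := (@lebesgue_measure R).
Notation D := (`[- tau, 0]%classic : set R).

(** On an interval of finite length this implies integrability and, unlike integrability, it is
    stable under products, such as powers of interpolants times a kernel. *)
Definition bmeas (h : R -> R) := measurable_fun D h /\
  exists M, forall t, - tau <= t <= 0 -> `|h t| <= M.

Lemma bmeas_integrable h : bmeas h -> mu.-integrable D (EFin \o h).
Proof.
move=> [mh [M hM]]; apply: measurable_bounded_integrable => //.
- by rewrite /= lebesgue_measure_itv/= lte_fin; case: ifP => _; rewrite ?ltry.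
- exists M; split; rewrite ?num_real// => x Mx t /=; rewrite in_itv/= => Dt.
  by rewrite (le_trans (hM _ Dt))// ltW.
Qed.

Lemma bmeas_cst c : bmeas (fun _ => c).
Proof. by split; [exact: measurable_cst|exists `|c|]. Qed.

Lemma bmeasM h1 h2 : bmeas h1 -> bmeas h2 -> bmeas (fun t => h1 t * h2 t).
Proof.
move=> [m1 [M1 h1M]] [m2 [M2 h2M]]; split; first exact: measurable_funM.
by exists (M1 * M2) => t tt; rewrite normrM ler_pM// ?h1M ?h2M.
Qed.

Lemma bmeasD h1 h2 : bmeas h1 -> bmeas h2 -> bmeas (fun t => h1 t + h2 t).
Proof.
move=> [m1 [M1 h1M]] [m2 [M2 h2M]]; split; first exact: measurable_funD.
by exists (M1 + M2) => t tt; rewrite (le_trans (ler_normD _ _))// lerD ?h1M ?h2M.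
Qed.

Lemma bmeas_sum n (h : 'I_n -> R -> R) : (forall i, bmeas (h i)) ->
  bmeas (fun t => \sum_(i < n) h i t).
Proof.
elim: n h => [|n IH] h mh.
  by rewrite (_ : (fun t => _) = (fun _ => 0)); [exact: bmeas_cst|apply/funext => t; rewrite big_ord0].
rewrite (_ : (fun t => _) = fun t => h ord0 t + \sum_(i < n) h (lift ord0 i) t).
  by apply: bmeasD => //; exact: IH.
by apply/funext => t; rewrite big_ord_recl.
Qed.

Lemma bmeas_powR (h : R -> R) (r M : R) : 0 <= r -> measurable_fun D h ->
  (forall t, - tau <= t <= 0 -> 0 <= h t <= M) -> bmeas (fun t => h t `^ r).
Proof.
move=> r0 mh hM; split; first exact: (measurableT_comp (measurable_powR r)).
exists (M `^ r) => t tt; have /andP[h0 h1] := hM t tt.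
by rewrite ger0_norm ?powR_ge0// ge0_ler_powR ?nnegrE//; exact: le_trans h1.
Qed.

Lemma int_tau_le h1 h2 : bmeas h1 -> bmeas h2 ->
  (forall t, - tau <= t <= 0 -> h1 t <= h2 t) -> int_tau tau h1 <= int_tau tau h2.
Proof.
move=> b1 b2 h12; apply: le_Rintegral.
- exact: measurable_itv.
- exact: bmeas_integrable.
- exact: bmeas_integrable.
- by move=> t /=; rewrite in_itv/=; exact: h12.
Qed.

Lemma int_tau_ge0 h : (forall t, - tau <= t <= 0 -> 0 <= h t) -> 0 <= int_tau tau h.
Proof. by move=> h0; apply: Rintegral_ge0 => t /=; rewrite in_itv/=; exact: h0. Qed.

Lemma int_tau_eq h1 h2 : (forall t, - tau <= t <= 0 -> h1 t = h2 t) ->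
  int_tau tau h1 = int_tau tau h2.
Proof.
move=> h12; apply: eq_Rintegral => t; rewrite inE/= in_itv/=; exact: h12.
Qed.

Lemma int_tauD h1 h2 : bmeas h1 -> bmeas h2 ->
  int_tau tau (fun t => h1 t + h2 t) = int_tau tau h1 + int_tau tau h2.
Proof.
move=> b1 b2; apply: RintegralD; [exact: measurable_itv|exact: bmeas_integrable..].
Qed.

Lemma int_tauZ c h : bmeas h -> int_tau tau (fun t => c * h t) = c * int_tau tau h.
Proof.
move=> b1; apply: RintegralZl; [exact: measurable_itv|exact: bmeas_integrable].
Qed.

Lemma int_tau_cst c : int_tau tau (fun _ => c) = c * tau.
Proof.
rewrite /int_tau Rintegral_cst; last exact: measurable_itv.
by rewrite /= lebesgue_measure_itv/= lte_fin oppr_lt0 tau0/=; congr (_ * _); ring.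
Qed.

Lemma int_tau_sum n (h : 'I_n -> R -> R) : (forall i, bmeas (h i)) ->
  int_tau tau (fun t => \sum_(i < n) h i t) = \sum_(i < n) int_tau tau (h i).
Proof.
elim: n h => [|n IH] h mh.
  rewrite big_ord0 (_ : (fun t => _) = (fun _ => 0)); last by apply/funext => t; rewrite big_ord0.
  by rewrite int_tau_cst mul0r.
rewrite (_ : (fun t => _) = fun t => h ord0 t + \sum_(i < n) h (lift ord0 i) t).
  by rewrite int_tauD ?IH//; [rewrite big_ord_recl|exact: bmeas_sum].
by apply/funext => t; rewrite big_ord_recl.
Qed.

Lemma in_W_bmeas rho : in_W tau rho -> bmeas rho.
Proof.
move=> [mr [[M rM] [r0 _]]]; split => //; exists M => t tt.
by rewrite ger0_norm ?rM ?r0.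
Qed.

(** The mass that the kernel [rho] gives to node [i]. By convexity a delay integral of a power of an
    interpolant is at most the sum over the nodes with these weights, so the distributed delay
    becomes a finite one. *)
Definition hat_weight (N : nat) (rho : R -> R) (i : 'I_N.+1) : R :=
  int_tau tau (fun t => hat (tau / N%:R) N i t * rho t).

Variable N : nat.
Hypothesis N0 : (0 < N)%N.

Lemma bmeas_hat i : bmeas (hat (tau / N%:R) N i).
Proof.
split; first by apply: measurable_funTS; exact: measurable_hat.
by exists 1 => t _; rewrite ger0_norm ?hat_le1 ?hat_ge0.
Qed.

Lemma hat_weight_ge0 (rho : R -> R) (i : 'I_N.+1) : (forall t, - tau <= t <= 0 -> 0 <= rho t) -> 0 <= hat_weight rho i.
Proof. by move=> r0; apply: int_tau_ge0 => t tt; rewrite mulr_ge0 ?hat_ge0 ?r0. Qed.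

Lemma sum_hat_weight rho : bmeas rho -> \sum_(i < N.+1) hat_weight rho i = int_tau tau rho.
Proof.
move=> mr; rewrite -int_tau_sum; last by move=> i; apply: bmeasM => //; exact: bmeas_hat.
by apply: int_tau_eq => t tt; rewrite -mulr_suml sum_hat// mul1r.
Qed.

Lemma int_tau_interp n (w : seq 'cV[R]_n) rho r : 1 <= r -> bmeas rho ->
  (forall t, - tau <= t <= 0 -> 0 <= rho t) ->
  int_tau tau (fun t => mnorm (interp (tau / N%:R) N w t) `^ r * rho t) <=
  \sum_(i < N.+1) hat_weight rho i * mnorm (nth 0 w i) `^ r.
Proof.
move=> r1 br r0.
have bh i := bmeas_hat i.
have -> : \sum_(i < N.+1) hat_weight rho i * mnorm (nth 0 w i) `^ r =
   int_tau tau (fun t => \sum_(i < N.+1) mnorm (nth 0 w i) `^ r * (hat (tau / N%:R) N i t * rho t)).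
  rewrite int_tau_sum; last by move=> i; apply: bmeasM; [exact: bmeas_cst|exact: bmeasM].
  by apply: eq_bigr => i _; rewrite int_tauZ; [rewrite mulrC|exact: bmeasM].
apply: int_tau_le.
- apply: bmeasM => //.
  apply: (@bmeas_powR _ _ (\sum_(i < N.+1) mnorm (nth 0 w i))); first by lra.
    by apply: measurable_funTS; exact: measurable_mnorm_interp.
  move=> t tt; rewrite mnorm_ge0/=; apply: mnorm_interp_le => // i iN.
  by rewrite (bigD1 (Ordinal (iN : (i < N.+1)%N)))//= lerDl sumr_ge0// => j _; exact: mnorm_ge0.
- by apply: bmeas_sum => i; apply: bmeasM; [exact: bmeas_cst|exact: bmeasM].
- move=> t tt; rewrite (eq_bigr (fun i : 'I_N.+1 => hat (tau / N%:R) N i t * mnorm (nth 0 w i) `^ r * rho t)).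
    by rewrite -mulr_suml ler_wpM2r ?r0//; exact: mnorm_interp_powR.
  by move=> i _; ring.
Qed.

End int_tau.

Definition vanish0 (R : realType) (n m k : nat) (F : (R -> 'cV[R]_n) -> 'M[R]_(m, k)) :=
  F (fun _ => 0) = 0.

(** * Growth of the drift and one step of the squared norm *)

Section drift.
Context (R : realType) (n d : nat) (tau : R).
Variables (f : (R -> 'cV[R]_n) -> 'cV[R]_n) (g : (R -> 'cV[R]_n) -> 'M[R]_(n, d)).
Hypothesis tau0 : 0 < tau.
Hypothesis lf : local_on tau f.
Hypothesis f0 : vanish0 f.
Hypothesis g0 : vanish0 g.
Hypothesis A1 : forall l : R, 0 < l -> exists Rl : R, 0 < Rl /\
     forall phi psi, is_C tau phi -> is_C tau psi ->
       Num.max (supn tau phi) (supn tau psi) <= l ->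
       Num.max (mnorm (f phi - f psi)) (mnorm (g phi - g psi))
       <= Rl * (mnorm (phi 0 - psi 0)
                + tau^-1 * int_tau tau (fun t => mnorm (phi t - psi t))).

Lemma supn_le (phi : R -> 'cV[R]_n) h :
  (forall t, - tau <= t <= 0 -> mnorm (phi t) <= h) -> supn tau phi <= h.
Proof.
move=> ph; apply: ge_sup; last by move=> _ [t /= tt <-]; apply: ph; rewrite in_itv/= in tt.
by exists (mnorm (phi 0)); exists 0 => //=; rewrite in_itv/= lexx oppr_le0 ltW.
Qed.

Lemma is_C_cst (v : 'cV[R]_n) : is_C tau (fun _ => v).
Proof. by apply: continuous_subspaceT => t; exact: cvg_cst. Qed.

Variables (G : R -> R) (h : R).
Hypothesis h1 : 1 <= h.
Hypothesis G0 : 0 <= G h.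
Hypothesis Gf : forall phi psi, is_C tau phi -> is_C tau psi ->
     Num.max (supn tau phi) (supn tau psi) <= h ->
     (exists t, - tau <= t <= 0 /\ phi t <> psi t) ->
     mnorm (f phi - f psi) / Num.sqrt (PsiD tau phi psi) <= G h.

(** The bound by [G h] is applied to [phi] and the zero function. As a quotient it says nothing when
    [PsiD] vanishes, since division by zero gives zero, so the degenerate cases are settled
    separately. *)
Lemma drift_growth (phi : R -> 'cV[R]_n) : is_C tau phi ->
  measurable_fun `[- tau, 0] (fun t => mnorm (phi t)) ->
  (forall t, - tau <= t <= 0 -> mnorm (phi t) <= h) ->
  mnorm (f phi) ^+ 2 <= G h ^+ 2 *
    (mnorm (phi 0) ^+ 2 + tau^-1 * int_tau tau (fun t => mnorm (phi t) `^ 2)).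
Proof.
move=> cphi mphi ph; have h0 : 0 < h := lt_le_trans ltr01 h1.
have c0 := @is_C_cst 0.
have sphi : Num.max (supn tau phi) (supn tau (fun _ => 0 : 'cV[R]_n)) <= h.
  by rewrite ge_max !supn_le// => t _; rewrite mnorm0 ltW.
have PE : PsiD tau phi (fun _ => 0) = mnorm (phi 0) ^+ 2 + tau^-1 * int_tau tau (fun t => mnorm (phi t) `^ 2).
  rewrite /PsiD subr0; congr (_ + _ * _); apply: int_tau_eq => t _.
  by rewrite subr0 powR_mulrn ?mnorm_ge0.
rewrite -PE.
have P0 : 0 <= PsiD tau phi (fun _ => 0).
  rewrite /PsiD addr_ge0 ?sqr_ge0// mulr_ge0 ?invr_ge0 ?(ltW tau0)//.
  by apply: int_tau_ge0 => t _; exact: sqr_ge0.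
have [|nz] := pselect (exists t, - tau <= t <= 0 /\ phi t <> 0); last first.
  have -> : f phi = 0.
    rewrite -(f0 : f _ = 0); apply: lf => t tt; apply: contrapT => pt.
    by apply: nz; exists t.
  by rewrite mnorm0 expr0n mulr_ge0// sqr_ge0.
move=> ex; have := Gf cphi c0 sphi ex; rewrite (f0 : f _ = 0) subr0.
(* A zero [PsiD] forces [phi 0] and the L^2 norm to vanish, hence the L^1 norm, and (A1) then gives
   f phi = 0. *)
have [PZ _|PN0] := eqVneq (PsiD tau phi (fun _ => 0)) 0.
  have b1 : bmeas tau (fun t => mnorm (phi t)).
    by split => //; exists h => t tt; rewrite ger0_norm ?mnorm_ge0 ?ph.
  have b2 : bmeas tau (fun t => mnorm (phi t) `^ 2).
    by apply: (bmeas_powR (M := h)) => // t tt; rewrite mnorm_ge0 ph.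
  have I2 : int_tau tau (fun t => mnorm (phi t) `^ 2) = 0 /\ mnorm (phi 0) = 0.
    have ia : 0 <= int_tau tau (fun t => mnorm (phi t) `^ 2) by apply: int_tau_ge0 => t _; exact: powR_ge0.
    have ti : 0 < tau^-1 by rewrite invr_gt0.
    have := sqr_ge0 (mnorm (phi 0)); have := mulr_ge0 (ltW ti) ia; move: PZ; rewrite PE => PZ h2 h3.
    have E : tau^-1 * int_tau tau (fun t => mnorm (phi t) `^ 2) = 0.
      by move: PZ h2 h3; move=> *; lra.
    split; first by move/eqP: E; rewrite mulf_eq0 gt_eqF//= => /eqP.
    by apply/eqP; rewrite -sqrf_eq0; apply/eqP; move: PZ E h3; move=> *; lra.
  case: I2 => I2 p0.
  have I1 : int_tau tau (fun t => mnorm (phi t)) <= 0.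
    apply/ler_addgt0Pr => e e0; rewrite add0r.
    (* The bound z <= c + z^2 / c passes from L^2 to L^1, and this [c] makes the constant part
       integrate to [e]. *)
    pose c := e / tau; have cp : 0 < c by rewrite divr_gt0.
    apply: (@le_trans _ _ (int_tau tau (fun t => c + c^-1 * mnorm (phi t) `^ 2))).
      apply: int_tau_le => //; first by apply: bmeasD; [exact: bmeas_cst|apply: bmeasM => //; exact: bmeas_cst].
      move=> t _; rewrite powR_mulrn ?mnorm_ge0//.
      have := sqr_ge0 (mnorm (phi t) - c); have := mnorm_ge0 (phi t); move: (mnorm (phi t)) => z.
      move=> z0 zc; rewrite -(ler_pM2l cp).
      have -> : c * (c + c^-1 * z ^+ 2) = c ^+ 2 + z ^+ 2 by field; rewrite gt_eqF.
      by nra.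
    rewrite int_tauD; [|exact: bmeas_cst|by apply: bmeasM => //; exact: bmeas_cst].
    by rewrite int_tau_cst// int_tauZ// I2 mulr0 addr0 /c divfK ?gt_eqF.
  have [Rl [Rl0 HR]] := A1 h0.
  have := HR _ _ cphi c0 sphi; rewrite (f0 : f _ = 0) (g0 : g _ = 0) !subr0 p0 add0r ge_max => /andP[hf _].
  have E : int_tau tau (fun t => mnorm (phi t - 0)) = int_tau tau (fun t => mnorm (phi t)).
    by apply: int_tau_eq => t _; rewrite subr0.
  rewrite E in hf.
  have fz : mnorm (f phi) = 0.
    apply/le_anti; rewrite mnorm_ge0 andbT (le_trans hf)//.
    rewrite mulr_ge0_le0 ?(ltW Rl0)// mulr_ge0_le0 ?invr_ge0 ?(ltW tau0)//.
  by rewrite fz expr0n mulr_ge0// sqr_ge0.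
have Pgt0 : 0 < PsiD tau phi (fun _ => 0) by rewrite lt0r PN0.
rewrite ler_pdivrMr ?sqrtr_gt0// => hf.
rewrite -[X in _ <= _ * X]sqr_sqrtr// -exprMn lerXn2r ?nnegrE ?mnorm_ge0//.
by rewrite mulr_ge0// sqrtr_ge0.
Qed.

Variables (p varrho b1 b2 b3 b4 : R) (rho3 rho4 : R -> R).
Hypothesis p2 : 2 <= p.
Hypothesis vr0 : 0 < varrho.
Hypothesis b20 : 0 < b2.
Hypothesis b40 : 0 < b4.
Hypothesis b21 : b2 < b1.
Hypothesis b43 : b4 < b3.
Hypothesis W3 : in_W tau rho3.
Hypothesis W4 : in_W tau rho4.
Hypothesis A2 : forall phi, is_C tau phi ->
     2 * dotv (phi 0) (f phi) + (p - 1) * mnorm (g phi) ^+ 2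
     <= - b1 * mnorm (phi 0) ^+ 2
        + b2 * int_tau tau (fun t => mnorm (phi t) ^+ 2 * rho3 t)
        - b3 * mnorm (phi 0) `^ (2 + varrho)
        + b4 * int_tau tau (fun t => mnorm (phi t) `^ (2 + varrho) * rho4 t).

(* The dissipativity condition is applied to a constant function. *)
Lemma dissipation_growth (v : 'cV[R]_n) : mnorm v <= h ->
  (b3 - b4) * (mnorm v ^+ 2) `^ (varrho / 2) <= 2 * Num.sqrt 2 * G h.
Proof.
move=> vh.
have rE : (mnorm v ^+ 2) `^ (varrho / 2) = mnorm v `^ varrho.
  by rewrite -powR_mulrn ?mnorm_ge0// -powRrM mulrC divfK.
rewrite rE.
have [v0|vN0] := eqVneq (mnorm v) 0.
  by rewrite v0 powR0 ?gt_eqF// mulr0 mulr_ge0// mulr_ge0// sqrtr_ge0.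
have vp : 0 < mnorm v by rewrite lt0r vN0 mnorm_ge0.
have := A2 (@is_C_cst v).
have [_ [_ [_ I3]]] := W3; have [_ [_ [_ I4]]] := W4.
rewrite !int_tauZ; [|exact: in_W_bmeas..].
rewrite I3 I4 !mulr1 => H.
have FG := drift_growth (@is_C_cst v) (measurable_cst _) (fun _ _ => vh).
(* For a constant function both parts of [PsiD] equal |v|^2, whence the factor sqrt 2. *)
have E : mnorm v ^+ 2 + tau^-1 * int_tau tau (fun=> mnorm v `^ 2) = 2 * mnorm v ^+ 2.
  rewrite int_tau_cst// powR_mulrn ?mnorm_ge0// mulrCA mulVf ?gt_eqF// mulr1; ring.
rewrite E in FG.
have fle : mnorm (f (fun _ => v)) <= G h * (Num.sqrt 2 * mnorm v).
  rewrite -ler_sqr ?nnegrE ?mnorm_ge0// ?mulr_ge0 ?sqrtr_ge0 ?mnorm_ge0//.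
  have s2 : Num.sqrt 2 ^+ 2 = 2 :> R by rewrite sqr_sqrtr.
  by rewrite exprMn [(Num.sqrt 2 * _) ^+ 2]exprMn s2.
have dl : - (mnorm v * mnorm (f (fun _ => v))) <= dotv v (f (fun _ => v)).
  by have := ler_dotv v (f (fun _ => v)); rewrite ler_norml => /andP[].
have pw : mnorm v `^ (2 + varrho) = mnorm v ^+ 2 * mnorm v `^ varrho.
  by rewrite powRD ?vN0 ?implybT// powR_mulrn ?mnorm_ge0.
rewrite pw in H.
have g2 : 0 <= (p - 1) * mnorm (g (fun _ => v)) ^+ 2 by rewrite mulr_ge0 ?sqr_ge0//; move: p2; move=> *; lra.
have v2 : 0 < mnorm v ^+ 2 by rewrite exprn_gt0.
rewrite -(ler_pM2l v2).
have := ler_wpM2l (ltW vp) fle.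
have bb : 0 <= (b1 - b2) * mnorm v ^+ 2 by rewrite mulr_ge0 ?sqr_ge0// subr_ge0 ltW.
have -> : mnorm v * (G h * (Num.sqrt 2 * mnorm v)) = mnorm v ^+ 2 * (Num.sqrt 2 * G h) by ring.
by move: H g2 bb dl => *; lra.
Qed.

Variable N : nat.
Hypothesis N0 : (0 < N)%N.
Notation Dt := (tau / N%:R).

(** In |Y + Dt f|^2 the cross term joins (p - 1) Dt |g|^2 and (A2') bounds both. By [drift_growth],
    Dt^2 |f|^2 is at most Dt e times |Y|^2 plus its mean over the segment: this lowers [b1] by [e]
    and adds [e] times the weights of the uniform kernel. *)
Lemma drift_step (w : seq 'cV[R]_n) (y : nat -> R) (e : R) :
  (forall i, (i <= N)%N -> mnorm (nth 0 w i) <= h) ->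
  (forall i, y i = mnorm (nth 0 w i) ^+ 2) -> e = Dt * G h ^+ 2 ->
  mnorm (nth 0 w N + Dt *: f (interp Dt N w)) ^+ 2
    + (p - 1) * Dt * mnorm (g (interp Dt N w)) ^+ 2 <=
  y N + Dt * (- (b1 - e) * y N
    + \sum_(i < N.+1) (b2 * hat_weight tau rho3 i + e * hat_weight tau (fun _ => tau^-1) i) * y i
    - b3 * y N `^ (1 + varrho / 2)
    + b4 * \sum_(i < N.+1) hat_weight tau rho4 i * y i `^ (1 + varrho / 2)).
Proof.
move=> wh yE eE; set phi := interp Dt N w.
have Dt0 : 0 < Dt by rewrite divr_gt0// ltr0n.
have cphi : is_C tau phi by exact: interp_is_C.
have phi0 : phi 0 = nth 0 w N by exact: interp0.
have phih t : - tau <= t <= 0 -> mnorm (phi t) <= h by move=> tt; exact: mnorm_interp_le.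
have mphi : measurable_fun `[- tau, 0] (fun t => mnorm (phi t)).
  by apply: measurable_funTS; exact: measurable_mnorm_interp.
have FG := drift_growth cphi mphi phih.
have A2p := A2 cphi.
have [_ [_ [r30 _]]] := W3; have [_ [_ [r40 _]]] := W4.
have y2 i : mnorm (nth 0 w i) `^ 2 = y i by rewrite yE powR_mulrn ?mnorm_ge0.
have yr i : mnorm (nth 0 w i) `^ (2 + varrho) = y i `^ (1 + varrho / 2).
  by rewrite -y2 -powRrM; congr (_ `^ _); field.
have i3 : int_tau tau (fun t => mnorm (phi t) ^+ 2 * rho3 t) <= \sum_(i < N.+1) hat_weight tau rho3 i * y i.
  have := int_tau_interp tau0 N0 w (ler1n _ 2) (in_W_bmeas W3) r30.
  under [X in _ <= X]eq_bigr do rewrite y2; apply: le_trans.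
  by rewrite le_eqVlt; apply/orP; left; apply/eqP; apply: int_tau_eq => t _; rewrite powR_mulrn ?mnorm_ge0.
have i4 : int_tau tau (fun t => mnorm (phi t) `^ (2 + varrho) * rho4 t) <=
    \sum_(i < N.+1) hat_weight tau rho4 i * y i `^ (1 + varrho / 2).
  have r1 : 1 <= 2 + varrho by move: vr0; move=> *; lra.
  have := int_tau_interp tau0 N0 w r1 (in_W_bmeas W4) r40.
  by under [X in _ <= X]eq_bigr do rewrite yr.
have iu : tau^-1 * int_tau tau (fun t => mnorm (phi t) `^ 2) <=
    \sum_(i < N.+1) hat_weight tau (fun _ => tau^-1) i * y i.
  have ti t : - tau <= t <= 0 -> 0 <= tau^-1 by move=> _; rewrite invr_ge0 ltW.
  have := int_tau_interp tau0 N0 w (ler1n _ 2) (bmeas_cst tau tau^-1) ti.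
  under [X in _ <= X]eq_bigr do rewrite y2; apply: le_trans.
  rewrite -int_tauZ; last by apply: (bmeas_powR (M := h)) => // t tt; rewrite mnorm_ge0 phih.
  by rewrite le_eqVlt; apply/orP; left; apply/eqP; apply: int_tau_eq => t _; rewrite mulrC.
rewrite phi0 -yE yr in A2p; rewrite phi0 -yE in FG.
rewrite mnorm_sqrD dotvZr mnorm_sqrZ -yE.
under eq_bigr do rewrite mulrDl -!mulrA.
rewrite big_split/= -!mulr_sumr.
have G20 : 0 <= G h ^+ 2 by exact: sqr_ge0.
have t1 := ler_wpM2l (ltW b20) i3; have t2 := ler_wpM2l (ltW b40) i4.
have t3 := ler_wpM2l G20 iu.
have t4 := ler_wpM2l (ltW Dt0) A2p.
have D2 : 0 <= Dt ^+ 2 by exact: sqr_ge0.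
rewrite mulrDr in FG.
have FG' : mnorm (f phi) ^+ 2 <= G h ^+ 2 * y N + G h ^+ 2 * \sum_(i < N.+1) hat_weight tau (fun _ => tau^-1) i * y i.
  by move: FG t3; move=> *; lra.
have t5 := ler_wpM2l D2 FG'.
have t6 := ler_wpM2l (ltW Dt0) t1; have t7 := ler_wpM2l (ltW Dt0) t2.
rewrite eE.
move: (int_tau tau _) (int_tau tau _) t1 t2 t3 t4 t6 t7 => I3 I4 t1 t2 t3 t4 t6 t7.
move: (\sum_(i < N.+1) _) (\sum_(i < N.+1) _) (\sum_(i < N.+1) _) t1 t2 t3 t4 t5 t6 t7 => S1 S2 S3; move=> *; lra.
Qed.

End drift.

(** * Measurability of the truncated scheme *)

Section adapted_measurability.
Context (R : realType) (n N : nat) (tau : R).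
Hypothesis tau0 : 0 < tau.
Hypothesis N0 : (0 < N)%N.
Notation Dt := (tau / N%:R).

Lemma ler_mx_entry a b (A : 'M[R]_(a, b)) i j : `|A i j| <= mnorm A.
Proof.
rewrite -ler_sqr ?nnegrE ?mnorm_ge0// real_normK ?num_real// mnorm_sqr.
rewrite (bigD1 i)//= (bigD1 j)//= -addrA lerDl addr_ge0//.
  by apply: sumr_ge0 => l _; exact: sqr_ge0.
by apply: sumr_ge0 => k _; apply: sumr_ge0 => l _; exact: sqr_ge0.
Qed.

Lemma mnorm_le_entries (v : 'cV[R]_n) c : 0 <= c -> (forall j, `|v j 0| <= c) ->
  mnorm v <= n.+1%:R * c.
Proof.
move=> c0 vc; rewrite -ler_sqr ?nnegrE ?mnorm_ge0 ?mulr_ge0//.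
apply: (@le_trans _ _ (\sum_(i < n) c ^+ 2)).
  rewrite mnorm_sqr; apply: ler_sum => i _; rewrite big_ord1.
  by rewrite -[leLHS]real_normK ?num_real// lerXn2r ?nnegrE.
have -> : \sum_(i < n) c ^+ 2 = n%:R * c ^+ 2 by rewrite sumr_const card_ord mulr_natl.
rewrite [leRHS]exprMn ler_wpM2r ?sqr_ge0//.
by rewrite -natrX ler_nat (leq_trans (leqnSn n))// leq_pmull.
Qed.

(** [F] is arbitrary: every preimage is a countable union of fibres of [c]. *)
Lemma measurable_countable_comp d (U : measurableType d) (C : countType) (c : U -> C) (F : C -> R) :
  (forall a, measurable [set w | c w = a]) -> measurable_fun setT (F \o c).
Proof.
move=> mc _ A mA; rewrite setTI.
rewrite (_ : _ @^-1` A = \bigcup_a [set w | A (F a) /\ c w = a]).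
  apply: countable_bigcupT_measurable => // a.
  have [Aa|nAa] := pselect (A (F a)).
    by rewrite (_ : [set w | _] = [set w | c w = a])//; apply/seteqP; split => w //= [].
  by rewrite (_ : [set w | _] = set0)//; apply/seteqP; split => w //= [].
apply/seteqP; split => [w /= Aw|w [a _ [Aa cwa]]]; first by exists (c w).
by rewrite /= cwa.
Qed.

Definition loc_lip a b (F : (R -> 'cV[R]_n) -> 'M[R]_(a, b)) :=
  forall l : R, 0 < l -> exists Rl : R, 0 < Rl /\
     forall phi psi, is_C tau phi -> is_C tau psi ->
       Num.max (supn tau phi) (supn tau psi) <= l ->
       mnorm (F phi - F psi) <= Rl * (mnorm (phi 0 - psi 0)
                + tau^-1 * int_tau tau (fun t => mnorm (phi t - psi t))).

(* [F] is continuous on interpolants: it is approximated by its values on the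
   interpolants of data rounded to a grid, which are countably many. *)
Lemma measurable_interp d (U : measurableType d) a b (F : (R -> 'cV[R]_n) -> 'M[R]_(a, b))
    (s : U -> seq 'cV[R]_n) h i0 j0 :
  loc_lip F -> 0 <= h ->
  (forall i j, (i <= N)%N -> measurable_fun setT (fun w => nth 0 (s w) i j 0)) ->
  (forall w i, (i <= N)%N -> mnorm (nth 0 (s w) i) <= h) ->
  measurable_fun setT (fun w => F (interp Dt N (s w)) i0 j0).
Proof.
move=> LF h0 ms sh.
pose grid (k : nat) (c : 'M[int]_(n, N.+1)) : seq 'cV[R]_n :=
  [seq \col_j ((c j i)%:~R / k.+1%:R) | i <- enum 'I_N.+1].
pose rd (k : nat) (w : U) : 'M[int]_(n, N.+1) :=
  \matrix_(j, i) Num.floor (k.+1%:R * nth 0 (s w) i j 0).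
pose S k w := grid k (rd k w).
have nthS k w i (iN : (i <= N)%N) j : nth 0 (S k w) i j 0 =
    (Num.floor (k.+1%:R * nth 0 (s w) i j 0))%:~R / k.+1%:R.
  have iN' : (i < N.+1)%N by [].
  rewrite /S /grid (nth_map (Ordinal iN')) ?size_enum_ord// !mxE.
  by rewrite nth_enum_ord.
have k0 k : 0 < k.+1%:R :> R by rewrite ltr0n.
have diff k w i : (i <= N)%N -> mnorm (nth 0 (s w) i - nth 0 (S k w) i) <= n.+1%:R / k.+1%:R.
  move=> iN; apply: mnorm_le_entries => [|j]; first by rewrite invr_ge0 ltW.
  rewrite !mxE nthS//; set x := nth 0 (s w) i j 0.
  have /andP[fl1 fl2] := floor_itv (k.+1%:R * x).
  have -> : x - (Num.floor (k.+1%:R * x))%:~R / k.+1%:R =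
     (k.+1%:R * x - (Num.floor (k.+1%:R * x))%:~R) / k.+1%:R by field; rewrite gt_eqF.
  rewrite normrM [`|_^-1|]ger0_norm ?invr_ge0 ?(ltW (k0 k))//.
  rewrite ler_piMl ?invr_ge0 ?(ltW (k0 k))//.
  rewrite ger0_norm ?subr_ge0// lerBlDr; apply: ltW; apply: (lt_le_trans fl2).
  by rewrite intrD addrC.
have Sk k w i : (i <= N)%N -> mnorm (nth 0 (S k w) i) <= h + n.+1%:R.
  move=> iN; have := ler_mnormD (nth 0 (s w) i) (- (nth 0 (s w) i - nth 0 (S k w) i)).
  rewrite opprB addrC subrK -opprB.
  have -> : mnorm (- (nth 0 (s w) i - nth 0 (S k w) i)) = mnorm (nth 0 (s w) i - nth 0 (S k w) i).
    by rewrite -scaleN1r mnormZ normrN1 mul1r.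
  move=> /le_trans; apply; apply: lerD; first exact: sh.
  apply: (le_trans (diff k w i iN)); rewrite ler_piMr// invf_le1 ?ltr0n//.
  by rewrite ler1n.
(* Rounded data stay within this radius for every [k], so one Lipschitz constant serves all
   grids. *)
have l0 : 0 < h + n.+1%:R by rewrite ltr_wpDl// ltr0n.
have [L [L0 HL]] := LF _ l0.
have est k w : mnorm (F (interp Dt N (s w)) - F (interp Dt N (S k w))) <=
    L * (n.+1%:R / k.+1%:R + n.+1%:R / k.+1%:R).
  have sup1 (u : seq 'cV[R]_n) : (forall i, (i <= N)%N -> mnorm (nth 0 u i) <= h + n.+1%:R) ->
      supn tau (interp Dt N u) <= h + n.+1%:R.
    by move=> hu; apply: supn_le => // t tt; exact: mnorm_interp_le.
  have cI (u : seq 'cV[R]_n) : is_C tau (interp Dt N u) by exact: interp_is_C.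
  apply: (le_trans (HL _ _ (cI _) (cI _) _)).
    rewrite ge_max !sup1// => i iN; first exact: Sk.
    by rewrite (le_trans (sh w i iN))// lerDl.
  have idiff t : interp Dt N (s w) t - interp Dt N (S k w) t =
      interp Dt N [seq nth 0 (s w) i - nth 0 (S k w) i | i <- iota 0 N.+1] t.
    rewrite /interp -sumrB; apply: eq_bigr => i _.
    by rewrite (nth_map 0%N) ?size_iota// nth_iota// add0n scalerBr.
  have dn t : - tau <= t <= 0 -> mnorm (interp Dt N (s w) t - interp Dt N (S k w) t) <= n.+1%:R / k.+1%:R.
    move=> tt; rewrite idiff; apply: mnorm_interp_le => // i iN.
    by rewrite (nth_map 0%N) ?size_iota// nth_iota// add0n diff.
  rewrite ler_wpM2l ?(ltW L0)//; apply: lerD; first by rewrite dn// lexx oppr_le0 ltW.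
  have bm : bmeas tau (fun t => mnorm (interp Dt N (s w) t - interp Dt N (S k w) t)).
    split; last by exists (n.+1%:R / k.+1%:R) => t tt; rewrite ger0_norm ?mnorm_ge0 ?dn.
    rewrite (_ : (fun t => _) = fun t => mnorm (interp Dt N
      [seq nth 0 (s w) i - nth 0 (S k w) i | i <- iota 0 N.+1] t)).
      by apply: measurable_funTS; exact: measurable_mnorm_interp.
    by apply/funext => t; rewrite idiff.
  have := int_tau_le bm (bmeas_cst _ _) dn.
  by rewrite (int_tau_cst tau0) -ler_pdivrMr// mulrC.
apply: (measurable_fun_cvg (h := fun k w => F (interp Dt N (S k w)) i0 j0)).
  move=> k; apply: (@measurable_countable_comp _ _ _ (rd k) (fun c => F (interp Dt N (grid k c)) i0 j0)) => c.
  rewrite (_ : [set w | _] = \bigcap_(p in [set: 'I_n * 'I_N.+1])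
      (fun w => k.+1%:R * nth 0 (s w) p.2 p.1 0) @^-1` `[(c p.1 p.2)%:~R, (c p.1 p.2 + 1)%:~R[).
    apply: fin_bigcap_measurable => [|[j i] _]; first exact: finite_finset.
    rewrite -[X in measurable X]setTI.
    have mf : measurable_fun setT (fun w => k.+1%:R * nth 0 (s w) i j 0).
      by apply: measurable_funM => //; apply: ms; rewrite -ltnS.
    by apply: mf => //; exact: measurable_itv.
  apply/seteqP; split => [w /= <- [j i] _ /=|w /= H].
    by rewrite !mxE in_itv/=; exact: floor_itv.
  apply/matrixP => j i; have := H (j, i) I; rewrite /= in_itv/= -floor_eq mxE.
  by move=> /eqP.
move=> w _; apply/cvgrPdist_le => e e0.
near=> k.
have -> : F (interp Dt N (s w)) i0 j0 - F (interp Dt N (S k w)) i0 j0 =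
    (F (interp Dt N (s w)) - F (interp Dt N (S k w))) i0 j0 by rewrite !mxE.
apply: (le_trans (ler_mx_entry _ _ _)); apply: (le_trans (est k w)).
rewrite -mulrDl mulrA ler_pdivrMr//.
rewrite [leRHS]mulrC -ler_pdivrMr// ltW//.
apply: (@lt_le_trans _ _ (Num.bound (L * (n.+1%:R + n.+1%:R) / e))%:R).
  by apply: archi_boundP; rewrite divr_ge0 ?(ltW e0)// mulr_ge0// ltW.
rewrite ler_nat leqW//; near: k; exact: nbhs_infty_ge.
Unshelve. all: by end_near. Qed.

End adapted_measurability.

Section scheme.
Context (dsp : measure_display) (T : measurableType dsp) (R : realType) (n d : nat) (tau : R).
Variables (f : (R -> 'cV[R]_n) -> 'cV[R]_n) (g : (R -> 'cV[R]_n) -> 'M[R]_(n, d)).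
Variables (B : R -> T -> 'cV[R]_d) (xi : R -> 'cV[R]_n) (h : R) (N : nat).
Hypothesis tau0 : 0 < tau.
Hypothesis N0 : (0 < N)%N.
Hypothesis h0 : 0 <= h.
Notation Dt := (tau / N%:R).
Notation Y m w := (Ys f g B xi h Dt N m w).

(** The value at time t_(i - N). The list of stage [i] already contains entry [i], and later stages
    only append, so [nth_YsE] may read the entry from any stage that has it. *)
Definition scheme_at i w := nth 0 (Y i w) i.
Definition incr m w : 'cV[R]_d := B (m.+1%:R * Dt) w - B (m%:R * Dt) w.

Lemma size_Ys m w : size (Y m w) = (N.+1 + m)%N.
Proof. by elim: m => [|m IH]; rewrite /= ?size_map ?size_iota ?addn0// size_rcons IH addnS. Qed.

Lemma nth_Ys m k w i : (i < N.+1 + m)%N -> nth 0 (Y (m + k) w) i = nth 0 (Y m w) i.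
Proof.
move=> im; elim: k => [|k IH]; first by rewrite addn0.
by rewrite addnS /= nth_rcons size_Ys ifT// (leq_trans im)// leq_add2l leq_addr.
Qed.

Lemma nth_YsE m w i : (i < N.+1 + m)%N -> nth 0 (Y m w) i = scheme_at i w.
Proof.
move=> im; rewrite /scheme_at; have [mi|im'] := leqP m i.
  by rewrite -(nth_Ys (i - m) w im) subnKC.
rewrite -[in LHS](subnKC (ltnW im')) nth_Ys//.
by rewrite addSn ltnS leq_addl.
Qed.

Lemma last_Ys m w : last 0 (Y m w) = scheme_at (m + N) w.
Proof. by rewrite -nth_last size_Ys addSn/= nth_YsE ?[(N + m)%N]addnC// addSn ltnS addnC. Qed.

Lemma nth_drop_Ys m w i : (i <= N)%N -> nth 0 (drop m (Y m w)) i = scheme_at (m + i) w.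
Proof. by move=> iN; rewrite nth_drop nth_YsE// addnC ltn_add2r. Qed.

Lemma scheme_atS m w : scheme_at (m + N).+1 w =
  trunc h (scheme_at (m + N) w + Dt *: f (interp Dt N (drop m (Y m w)))
           + g (interp Dt N (drop m (Y m w))) *m incr m w).
Proof.
rewrite -(@nth_YsE m.+1); last by rewrite addSn addnS !ltnS addnC.
have -> : (m + N).+1 = (N.+1 + m)%N by rewrite addSn addnC.
by rewrite /= nth_rcons size_Ys ltnn eqxx last_Ys.
Qed.

(** At the origin the general formula already gives zero, so no case distinction stands in the way
    of measurability. *)
Lemma truncE (x : 'cV[R]_n) : trunc h x = (Num.min (mnorm x) h / mnorm x) *: x.
Proof. by rewrite /trunc; case: eqVneq => // ->; rewrite scaler0. Qed.

Lemma mnorm_trunc (x : 'cV[R]_n) : mnorm (trunc h x) = Num.min (mnorm x) h.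
Proof.
rewrite /trunc; case: eqVneq => [->|x0]; first by rewrite mnorm0 (min_idPl _).
have xp : 0 < mnorm x.
  by rewrite lt0r mnorm_ge0 andbT; apply: contra x0 => /eqP/mnorm_eq0 ->.
rewrite mnormZ ger0_norm ?divfK ?gt_eqF// divr_ge0 ?mnorm_ge0//.
by rewrite le_min mnorm_ge0.
Qed.

Lemma mnorm_scheme_at i w : mnorm (scheme_at i w) <= h.
Proof.
rewrite /scheme_at; suff H m j : (j < N.+1 + m)%N -> mnorm (nth 0 (Y m w) j) <= h.
  by apply: H; rewrite addSn ltnS leq_addl.
elim: m j => [|m IH] j jm.
  rewrite addn0 in jm.
  have -> : Y 0 w = [seq trunc h (xi ((i%:R - N%:R) * Dt)) | i <- iota 0 N.+1] by [].
  by rewrite (nth_map 0%N) ?size_iota// mnorm_trunc ge_min lexx orbT.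
rewrite /= nth_rcons size_Ys; case: ltnP => [/IH//|mj].
have -> : j = (N.+1 + m)%N by apply/eqP; rewrite eqn_leq mj andbT -ltnS -addnS.
by rewrite eqxx mnorm_trunc ge_min lexx orbT.
Qed.

Hypothesis Lf : loc_lip tau f.
Hypothesis Lg : loc_lip tau g.

Lemma measurable_interp_past m a b (F : (R -> 'cV[R]_n) -> 'M[R]_(a, b)) i0 j0 : loc_lip tau F ->
  (forall i j, (i < N.+1 + m)%N -> measurable_fun (setT : set (past incr m 0)) (fun w => nth 0 (Y m w) i j 0)) ->
  measurable_fun (setT : set (past incr m 0)) (fun w => F (interp Dt N (drop m (Y m w))) i0 j0).
Proof.
move=> LF IH; apply: (measurable_interp tau0 N0 (h := h)) => //.
  move=> i j iN; under eq_fun do rewrite nth_drop.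
  by apply: IH; rewrite addnC ltn_add2r.
by move=> w i iN; rewrite nth_drop_Ys// mnorm_scheme_at.
Qed.

(** The initial entries are deterministic. The entry added at step [m] depends on earlier entries
    and on increment [m], and [past incr m.+1 0] contains the information of both. *)
Lemma adapted_Ys m i j : (i < N.+1 + m)%N ->
  measurable_fun (setT : set (past incr m 0)) (fun w => nth 0 (Y m w) i j 0).
Proof.
elim: m i j => [|m IH] i j im.
  by rewrite /=; exact: measurable_cst.
have [im'|mi] := ltnP i (N.+1 + m)%N.
  under eq_fun do rewrite /= nth_rcons size_Ys im'.
  apply: (@measurable_past_sub _ _ _ _ incr m 0); first by rewrite ltnSn.
  exact: IH.
have -> : i = (N.+1 + m)%N by apply/eqP; rewrite eqn_leq mi andbT -ltnS -addnS.
under eq_fun do rewrite /= nth_rcons size_Ys ltnn eqxx truncE mxE.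
have up (X : T -> R) : measurable_fun (setT : set (past incr m 0)) X ->
    measurable_fun (setT : set (past incr m.+1 0)) X.
  by apply: measurable_past_sub; rewrite ltnSn.
pose V w := last 0 (Y m w) + Dt *: f (interp Dt N (drop m (Y m w))) + g (interp Dt N (drop m (Y m w))) *m incr m w.
have mV o : measurable_fun (setT : set (past incr m.+1 0)) (fun w => V w o 0).
  rewrite (_ : (fun w => _) = fun w => nth 0 (Y m w) (m + N) o 0 +
     Dt * f (interp Dt N (drop m (Y m w))) o 0 +
     \sum_(l < d) g (interp Dt N (drop m (Y m w))) o l * incr m w l 0); last first.
    apply/funext => w; rewrite /V last_Ys !mxE nth_YsE//.
    by rewrite addSn ltnS addnC.
  apply: measurable_funD.
    apply: measurable_funD.
      by apply: up; apply: IH; rewrite addSn ltnS addnC.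
    apply: measurable_funM => //; apply: up; exact: measurable_interp_past.
  apply: (measurable_sum_cond (T := past incr m.+1 0) _ (h := fun l w => _)) => l _.
  apply: measurable_funM; first by apply: up; exact: measurable_interp_past.
  by apply: measurable_past_dB; rewrite ltnSn.
have mVn : measurable_fun (setT : set (past incr m.+1 0)) (fun w => mnorm (V w)).
  by apply: (measurable_mnorm (T := past incr m.+1 0) (X := V)) => o o'; rewrite ord1.
apply: measurable_funM; last exact: mV.
apply: measurable_funM; first exact: measurable_minr.
(* On nonnegative numbers, zero included, the inverse is the power -1, and powers are measurable. *)
rewrite (_ : (fun w => _) = fun w => mnorm (V w) `^ (-1)).
  exact: (measurableT_comp (measurable_powR (-1))).
by apply/funext => w; rewrite powR_inv1 ?mnorm_ge0.
Qed.

End scheme.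

(** * Step sizes and rates *)

Section truncation_level.
Context (R : realType) (G : R -> R).
Hypothesis G_cont : {within `[1, +oo[, continuous G}.
Hypothesis G_unbounded : forall M : R, exists L : R, forall l, L <= l -> M <= G l.

(** The supremum is finite because [G] tends to infinity. If [G] exceeded [y] there, continuity
    would make it exceed [y] at nearby points of the set as well. *)
Lemma Gamma_inv_bounds y : G 1 <= y -> 1 <= Gamma_inv G y /\ G (Gamma_inv G y) <= y.
Proof.
move=> y1; rewrite /Gamma_inv; set S := [set l | _].
have S1 : S 1 by split.
have hS : has_sup S.
  split; first by exists 1.
  have [L HL] := G_unbounded (y + 1); exists L => l [l1 Gl].
  by rewrite leNgt; apply/negP => /ltW/HL yl; lra.
have h1 : 1 <= sup S by apply: sup_ubound => //; exact: hS.2.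
split=> //; rewrite leNgt; apply/negP => yh.
move/subspace_continuousP: (G_cont) => /(_ (sup S)).
rewrite /= in_itv/= andbT => /(_ h1) /cvgrPdist_lt /(_ (G (sup S) - y)).
rewrite subr_gt0 => /(_ yh); rewrite /within/= => -[e /= e0 He].
have [l Sl hl] := sup_adherent e0 hS.
have lh : l <= sup S by apply: sup_ubound => //; exact: hS.2.
have := He l; rewrite /ball_ /= in_itv/= andbT => /(_ _ Sl.1).
rewrite ger0_norm ?subr_ge0// => /(_ _) Hl.
have : `|G (sup S) - G l| < G (sup S) - y by apply: Hl; lra.
by have := ler_norm (G (sup S) - G l); have := Sl.2; move=> *; lra.
Qed.

End truncation_level.

Lemma small_powR (R : realType) (c dl ka : R) : 0 <= c -> 0 < dl -> 0 < ka ->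
  exists D : R, 0 < D <= 1 /\ forall x, 0 < x <= D -> c * x `^ ka <= dl.
Proof.
move=> c0 dl0 ka0.
(* Solves (c + 1) r^ka = dl; taking c + 1 instead of [c] allows c = 0. *)
pose r := (dl / (c + 1)) `^ ka^-1.
have c1 : 0 < c + 1 by lra.
have r0 : 0 < r by rewrite powR_gt0// divr_gt0.
exists (Num.min 1 r); split; first by rewrite lt_min ltr01 r0 ge_min lexx.
move=> x /andP[x0]; rewrite le_min => /andP[x1 xr].
have : x `^ ka <= dl / (c + 1).
  have -> : dl / (c + 1) = r `^ ka.
    by rewrite /r -powRrM mulVf ?gt_eqF// powRr1// divr_ge0// ltW.
  by rewrite ge0_ler_powR ?nnegrE// ltW.
rewrite ler_pdivlMr// => h; have := powR_ge0 x ka => h0.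
by rewrite (le_trans _ h)// mulrC ler_wpM2l//; lra.
Qed.

Lemma powRN_ge1 (R : realType) (x r : R) : 0 < x <= 1 -> 0 <= r -> 1 <= x `^ (- r).
Proof.
move=> /andP[x0 x1] r0; rewrite powRN invf_ge1; last exact: powR_gt0.
apply: (@le_trans _ _ (1 `^ r)); last by rewrite powR1.
by apply: ge0_ler_powR; rewrite ?nnegrE// ltW.
Qed.

(** With L = Dt^(- lambda) >= 1 one has Dt <= Dt L <= Dt L^2 = Dt^(1 - 2 lambda), a positive power
    since lambda < 1/2, and all three quantities are at most a constant times it. The product c0 L
    stands for the bound on |Y|^varrho. *)
Lemma step_size (R : realType) (b1 b2 b3 b4 K c0 eta dl lambda : R) :
  0 <= b1 -> 0 <= b2 -> 0 <= b3 -> 0 <= b4 -> 0 <= K -> 0 <= c0 ->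
  0 < eta <= 1 -> 0 < dl -> 0 < lambda < 1 / 2 ->
  exists D : R, 0 < D <= 1 /\ forall Dt G, 0 < Dt <= D -> 0 <= G <= K * Dt `^ (- lambda) ->
    [/\ Dt * G ^+ 2 <= eta, Dt * (b1 + b3 * (c0 * Dt `^ (- lambda))) <= dl &
        Dt * (b2 + Dt * G ^+ 2 + b4 * (c0 * Dt `^ (- lambda))) <= dl].
Proof.
move=> b10 b20 b30 b40 K0 c00 /andP[eta0 eta1] dl0 /andP[la0 la2].
have bC3 : 0 <= b3 * c0 by exact: mulr_ge0.
have bC4 : 0 <= b4 * c0 by exact: mulr_ge0.
have K20 : 0 <= K ^+ 2 by exact: sqr_ge0.
have c10 : 0 <= b1 + b3 * c0 by exact: addr_ge0.
have c20 : 0 <= b2 + 1 + b4 * c0 by rewrite addr_ge0// addr_ge0.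
have c_ge0 : 0 <= K ^+ 2 + (b1 + b3 * c0) + (b2 + 1 + b4 * c0) by rewrite addr_ge0// addr_ge0.
have ka0 : 0 < 1 - 2 * lambda by lra.
have m0 : 0 < Num.min eta dl by rewrite lt_min eta0.
have [D [D01 HD]] := small_powR c_ge0 m0 ka0.
exists D; split=> // Dt G DtD /andP[G0 GK].
have /andP[Dt0 DtD'] := DtD.
have Dt1 : 0 < Dt <= 1 by case/andP: D01 => _ D1; rewrite Dt0 (le_trans DtD').
move: (HD Dt DtD); set x := Dt `^ _; rewrite le_min => /andP[cxe cxd].
have L1 := powRN_ge1 Dt1 (ltW la0).
set L := Dt `^ (- lambda) in GK L1 *.
have L0 : 0 <= L by exact: le_trans L1.
have x0 : 0 <= x by exact: powR_ge0.
have LE : Dt * L ^+ 2 = x.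
  rewrite -powR_mulrn ?powR_ge0// -powRrM -{1}(powRr1 (ltW Dt0)) -powRD; last by rewrite (gt_eqF Dt0) implybT.
  by congr (_ `^ _); ring.
have Lx : Dt * L <= x by rewrite -LE ler_wpM2l ?(ltW Dt0)// expr2 ler_peMr.
have Dx : Dt <= x by apply: le_trans Lx; rewrite ler_peMr// ltW.
have eK : Dt * G ^+ 2 <= K ^+ 2 * x.
  rewrite -LE [leRHS]mulrCA -exprMn ler_wpM2l ?(ltW Dt0)// lerXn2r// nnegrE.
  exact: mulr_ge0.
clearbody x L.
move: cxe cxd; rewrite 2!mulrDl => cxe cxd.
have t1 : 0 <= K ^+ 2 * x by exact: mulr_ge0.
have t2 : 0 <= (b1 + b3 * c0) * x by exact: mulr_ge0.
have t3 : 0 <= (b2 + 1 + b4 * c0) * x by exact: mulr_ge0.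
have e1 : Dt * G ^+ 2 <= eta.
  apply: (le_trans eK); apply: le_trans cxe; rewrite -addrA lerDl; exact: addr_ge0.
split=> //.
  apply: (@le_trans _ _ ((b1 + b3 * c0) * x)).
    have -> : Dt * (b1 + b3 * (c0 * L)) = b1 * Dt + b3 * c0 * (Dt * L) by ring.
    by rewrite mulrDl lerD// ler_wpM2l.
  by apply: le_trans cxd; rewrite -addrA addrCA lerDl addr_ge0.
apply: (@le_trans _ _ ((b2 + 1 + b4 * c0) * x)); last by apply: le_trans cxd; rewrite lerDr addr_ge0.
apply: (@le_trans _ _ ((b2 + 1) * Dt + (b4 * c0) * (Dt * L))).
  have -> : (b2 + 1) * Dt + b4 * c0 * (Dt * L) = Dt * (b2 + 1 + b4 * (c0 * L)) by ring.
  by rewrite ler_wpM2l ?(ltW Dt0)// lerD2r lerD2l (le_trans e1).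
by rewrite [leRHS]mulrDl lerD// ler_wpM2l// addr_ge0.
Qed.

(* The perturbation [eta] of the coefficients absorbs both the error of the power
   inequality and the [Dt * Gamma(h)^2] error of the drift. *)
Lemma margin (R : realType) (q s b1 b2 b3 b4 E nu nu2 : R) :
  1 <= q -> 0 < s -> 0 < b1 -> 0 < b2 -> 0 < b3 -> 0 < b4 -> 1 <= E ->
  nu < q * (b1 - b2 * E) -> nu2 < nu -> 0 < b3 - b4 * E ->
  exists eta : R, 0 < eta <= 1 /\ eta <= b1 /\
    forall e E2, 0 <= e <= eta -> 1 <= E2 <= E ->
      nu2 + (1 + eta) * (b2 + e) * E2 <=
        q * (b1 - e) * (1 - eta) - (q - 1) * (1 + eta) * (b2 + e) /\
      (1 + eta) * b4 * (1 + (q - 1) * (s / (q + s))) * E2 <=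
        q * b3 * (1 - eta) - (q - 1) * (1 + eta) * b4 * (q / (q + s)).
Proof.
move=> q1 s0 b10 b20 b30 b40 E1 nuq nu2n b34.
have q0 : 0 < q by lra.
have E0 : 0 < E by lra.
have bE : 0 < b4 * E by exact: mulr_gt0.
have bE2 : 0 < E * (2 + b2) by rewrite mulr_gt0//; lra.
have d1 : 0 < q * (1 + b1 + E * (2 + b2)) by rewrite mulr_gt0//; lra.
have d2 : 0 < b3 + b4 * E by lra.
(* The last two entries are the slack in the two conditions on [nu], divided by a bound on the rate
   at which [eta] consumes it; [b1] ensures e <= b1. *)
pose eta := Num.min (Num.min 1 b1)
  (Num.min ((nu - nu2) / (q * (1 + b1 + E * (2 + b2)))) ((b3 - b4 * E) / (b3 + b4 * E))).
have eta0 : 0 < eta by rewrite !lt_min ltr01 b10 !divr_gt0// subr_gt0.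
have : eta <= eta by [].
rewrite {2}/eta !le_min => /andP[/andP[eta1 etab]] /andP[].
rewrite ler_pdivlMr// ler_pdivlMr// => h1 h2.
exists eta; rewrite eta0 eta1 etab; split=> //; split=> // e E2 /andP[e0 ee] /andP[E21 E2E].
clearbody eta; split.
  have k1 : (1 + eta) * (b2 + e) <= b2 + eta * (2 + b2) by nra.
  have k0 : 0 <= (1 + eta) * (b2 + e) by rewrite mulr_ge0//; lra.
  have k2 : b1 - eta - b1 * eta <= (b1 - e) * (1 - eta) by nra.
  (* The share q - 1 of the delay coefficient falls on the current moment and carries no exponential
     weight. Since E >= 1 it may be counted with weight [E] too, which yields the q E of the
     hypothesis. *)
  have k3 : q - 1 + E2 <= q * E.
    have : 0 <= (q - 1) * (E - 1) by rewrite mulr_ge0// subr_ge0.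
    by nra.
  have k4 : (1 + eta) * (b2 + e) * (q - 1 + E2) <= (1 + eta) * (b2 + e) * (q * E).
    by rewrite ler_wpM2l.
  have k5 : (1 + eta) * (b2 + e) * (q * E) <= (b2 + eta * (2 + b2)) * (q * E).
    by rewrite ler_wpM2r// mulr_ge0// ltW.
  have k6 : q * (b1 - eta - b1 * eta) <= q * ((b1 - e) * (1 - eta)) by rewrite ler_wpM2l// ltW.
  by lra.
have qs : 0 < q + s by lra.
have -> : s / (q + s) = 1 - q / (q + s) by field; rewrite gt_eqF.
have r0 : 0 <= q / (q + s) by rewrite divr_ge0// ltW.
have r1 : q / (q + s) <= 1 by rewrite ler_pdivrMr//; lra.
move: (q / (q + s)) r0 r1 => r r0 r1.
have g0 : 0 <= (1 + eta) * b4 by rewrite mulr_ge0 ?ltW//; lra.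
have k1 : (q - 1) * r + (1 + (q - 1) * (1 - r)) * E2 <= q * E.
  have a1 : 0 <= (q - 1) * r by rewrite mulr_ge0//; lra.
  have a2 : 0 <= 1 + (q - 1) * (1 - r).
    by rewrite addr_ge0// mulr_ge0//; lra.
  have a3 := ler_wpM2l a2 E2E.
  have a4 : (q - 1) * r * 1 <= (q - 1) * r * E by rewrite ler_wpM2l.
  by lra.
have k2 := ler_wpM2l g0 k1.
have k3 : q * ((1 + eta) * (b4 * E)) <= q * (b3 * (1 - eta)) by rewrite ler_wpM2l ?(ltW q0)//; lra.
by lra.
Qed.

(** * From a geometric moment bound to decay rates *)

Section exponential_decay.
Context (dsp : measure_display) (T : measurableType dsp) (R : realType) (P : probability T R).
Variables (X : nat -> T -> R) (p nu1 nu2 Dt M : R).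
Hypothesis p0 : 0 < p.
Hypothesis nu12 : nu1 < nu2.
Hypothesis Dt0 : 0 < Dt.
Hypothesis M0 : 0 <= M.
Hypothesis X0 : forall k w, 0 <= X k w.
Hypothesis mX : forall k, measurable_fun setT (X k).
Hypothesis XM : forall k, (\int[P]_w (X k w `^ p)%:E <= (M * expR (- (nu2 * (k%:R * Dt))))%:E)%E.

Lemma eventually_le_expR (c a : R) : 0 < a ->
  exists k0 : nat, forall k : nat, (k0 <= k)%N -> c <= expR (a * (k%:R * Dt)).
Proof.
move=> a0; exists (Num.bound (Num.max 0 c / (a * Dt))) => k kk.
have aD : 0 < a * Dt by exact: mulr_gt0.
have : Num.max 0 c / (a * Dt) < k%:R.
  apply: (lt_le_trans (archi_boundP _)); last by rewrite ler_nat.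
  by rewrite divr_ge0 ?(ltW aD)// le_max lexx.
rewrite ltr_pdivrMr// => h; apply: (@le_trans _ _ (Num.max 0 c)); first by rewrite le_max lexx orbT.
apply: (le_trans (ltW h)); have := expR_ge1Dx (k%:R * (a * Dt)).
by rewrite mulrCA => ?; lra.
Qed.

Lemma moment_decay eps : 0 < eps -> exists k0 : nat, forall k : nat, (k0 <= k)%N ->
  (\int[P]_w (X k w `^ p)%:E <= (expR ((- nu1 + eps) * (k%:R * Dt)))%:E)%E.
Proof.
move=> eps0; have nu0 : 0 < nu2 - nu1 by rewrite subr_gt0.
have [k0 Hk] := eventually_le_expR M nu0; exists k0 => k kk.
apply: (le_trans (XM k)); rewrite lee_fin.
apply: (le_trans (ler_wpM2r (expR_ge0 _) (Hk k kk))).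
rewrite -expRD ler_expR.
have := mulr_ge0 (ltW eps0) (mulr_ge0 (ler0n R k) (ltW Dt0)) => ?; lra.
Qed.

(** After integration the weights exp(nu1 k Dt) leave a geometric series of ratio exp(- (nu2 - nu1)
    Dt). *)
Lemma sum_moments : (\int[P]_w \sum_(0 <= k <oo) (expR (nu1 * (k%:R * Dt)) * X k w `^ p)%:E < +oo)%E.
Proof.
pose r := expR (- ((nu2 - nu1) * Dt)).
have r0 : 0 < r by exact: expR_gt0.
have r1 : r < 1 by rewrite expR_lt1 oppr_lt0 mulr_gt0// subr_gt0.
have mXp k : measurable_fun setT (fun w => X k w `^ p) by exact: (measurableT_comp (measurable_powR p)).
rewrite integral_nneseries//; last 2 first.
- move=> k; apply/measurable_EFinP; apply: measurable_funM => //.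
- by move=> k w _; rewrite lee_fin mulr_ge0 ?expR_ge0 ?powR_ge0.
apply: (@le_lt_trans _ _ (M / (1 - r))%:E); last by rewrite ltry.
apply: lime_le.
  apply: is_cvg_nneseries => k _ _; apply: integral_ge0 => w _.
  by rewrite lee_fin mulr_ge0 ?expR_ge0 ?powR_ge0.
apply: nearW => n /=.
apply: (@le_trans _ _ (\sum_(0 <= k < n) (M * r ^+ k)%:E)%E).
  apply: lee_sum => k _.
  rewrite (_ : (fun w => _) = (fun w => (expR (nu1 * (k%:R * Dt)))%:E * (X k w `^ p)%:E)%E)//.
  rewrite ge0_integralZl_EFin ?expR_ge0//; last 2 first.
  - by move=> w _; rewrite lee_fin powR_ge0.
  - exact/measurable_EFinP.
  apply: (le_trans (lee_wpmul2l _ (XM k))); first by rewrite lee_fin expR_ge0.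
  rewrite -EFinM lee_fin mulrCA -expRD /r -expRM_natl.
  by rewrite ler_wpM2l// ler_expR le_eqVlt; apply/orP; left; apply/eqP; ring.
rewrite sumEFin lee_fin -mulr_sumr ler_wpM2l// -[leRHS]mul1r ler_pdivlMr ?subr_gt0//.
have -> : (\sum_(0 <= k < n) r ^+ k) * (1 - r) = 1 - r ^+ n.
  elim: n => [|n IH]; first by rewrite big_nil mul0r expr0 subrr.
  by rewrite big_nat_recr//= mulrDl IH exprS; ring.
by rewrite lerBlDr lerDl exprn_ge0// ltW.
Qed.

(** The series of [sum_moments] is integrable, hence finite almost surely, and it bounds each of its
    terms. Taking the p-th root, [eps] absorbs the random constant. The exceptional set is that of
    the series, the same for all [eps]. *)
Lemma pathwise_decay : {ae P, forall w, forall eps : R, 0 < eps ->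
  exists k0 : nat, forall k : nat, (k0 <= k)%N ->
    X k w <= expR ((- nu1 / p + eps) * (k%:R * Dt))}.
Proof.
pose F w := (\sum_(0 <= k <oo) (expR (nu1 * (k%:R * Dt)) * X k w `^ p)%:E)%E.
have t0 k w : (0 <= (expR (nu1 * (k%:R * Dt)) * X k w `^ p)%:E)%E.
  by rewrite lee_fin mulr_ge0 ?expR_ge0 ?powR_ge0.
have F0 w : (0 <= F w)%E by exact: nneseries_ge0.
have mF : measurable_fun setT F.
  apply: ge0_emeasurable_sum => // k _; apply/measurable_EFinP.
  by apply: measurable_funM => //; exact: (measurableT_comp (measurable_powR p)).
have iF : P.-integrable setT F.
  apply/integrableP; split=> //.
  by under eq_integral do rewrite gee0_abs//; exact: sum_moments.
apply: filterS (integrable_ae measurableT iF) => w /(_ I) Fw eps eps0.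
have [c Fc] : exists c, F w = c%:E by exists (fine (F w)); rewrite fineK.
have pe : 0 < p * eps by exact: mulr_gt0.
have [k0 Hk] := eventually_le_expR c pe; exists k0 => k kk.
have ck : expR (nu1 * (k%:R * Dt)) * X k w `^ p <= c.
  rewrite -lee_fin -Fc; apply: le_trans (nneseries_lim_ge k.+1 _); last by move=> *; exact: t0.
  by rewrite big_nat_recr//= leeDr// sume_ge0.
have Xp : X k w `^ p <= expR ((- nu1 / p + eps) * (k%:R * Dt)) `^ p.
  rewrite -expRM -(ler_pM2l (expR_gt0 (nu1 * (k%:R * Dt)))) -expRD.
  apply: (le_trans ck); apply: (le_trans (Hk k kk)).
  rewrite ler_expR le_eqVlt; apply/orP; left; apply/eqP; field; rewrite gt_eqF//.
rewrite leNgt; apply/negP => lt_X; move: Xp; apply/negP; rewrite -ltNge.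
by rewrite gt0_ltr_powR ?nnegrE ?expR_ge0.
Qed.

End exponential_decay.

(** * Moment recursion *)

Section brownian_increments.
Context (dsp : measure_display) (T : measurableType dsp) (R : realType) (P : probability T R).
Variables (d : nat) (B : R -> T -> 'cV[R]_d) (tau : R) (N : nat).
Hypothesis BB : brownian P B.
Hypothesis Dt0 : 0 < tau / N%:R.
Notation Dt := (tau / N%:R).

Lemma measurable_incr i l : measurable_fun setT (fun w => incr tau B N i w l 0).
Proof.
have [mB _] := BB.
rewrite (_ : (fun w => _) = fun w => B (i.+1%:R * Dt) w l 0 - B (i%:R * Dt) w l 0).
  by apply: measurable_funB; apply: mB; rewrite mulr_ge0// ltW.
by apply/funext => w; rewrite !mxE.
Qed.

Lemma incr_law m (A : nat -> 'I_d -> set R) : (forall i l, measurable (A i l)) ->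
  P (\bigcap_(i in `I_m) \bigcap_(l in [set: 'I_d])
       [set w | incr tau B N i w l 0%R \in A i l]) =
  (\prod_(i < m) \prod_(l < d) normal_prob 0 (Num.sqrt Dt) (A i l))%E.
Proof.
have [_ [_ [_ law]]] := BB => mA.
have t0 : 0 <= 0%:R * Dt by rewrite mul0r.
have tS i : (i < m)%N -> i%:R * Dt < i.+1%:R * Dt by move=> _; rewrite ltr_pM2r// ltr_nat.
rewrite (law m (fun i => i%:R * Dt) A t0 tS mA).
apply: eq_bigr => i _; apply: eq_bigr => l _.
have -> : i.+1%:R * Dt - i%:R * Dt = Dt by rewrite -[i.+1]addn1 natrD; ring.
by [].
Qed.

End brownian_increments.

Section bounded_expectation.
Context (dsp : measure_display) (T : measurableType dsp) (R : realType) (P : probability T R).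

(** The moment recursion subtracts expectations, so these have to be finite; truncation at [h] puts
    all nonnegative powers of the scheme into this class. *)
Definition bounded_rv (X : T -> R) := measurable_fun setT X /\ exists M, forall w, `|X w| <= M.

Lemma bounded_rv_integrable X : bounded_rv X -> P.-integrable setT (EFin \o X).
Proof.
move=> [mX [M XM]]; apply: measurable_bounded_integrable => //.
  by rewrite /= probability_setT ltry.
exists M; split; rewrite ?num_real// => x Mx w _ /=.
by rewrite (le_trans (XM w))// ltW.
Qed.

Lemma bounded_rvD X1 X2 : bounded_rv X1 -> bounded_rv X2 -> bounded_rv (fun w => X1 w + X2 w).
Proof.
move=> [m1 [M1 h1]] [m2 [M2 h2]]; split; first exact: measurable_funD.
by exists (M1 + M2) => w; rewrite (le_trans (ler_normD _ _))// lerD.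
Qed.

Lemma bounded_rvZ c X : bounded_rv X -> bounded_rv (fun w => c * X w).
Proof.
move=> [m1 [M1 h1]]; split; first exact: measurable_funM.
by exists (`|c| * M1) => w; rewrite normrM ler_wpM2l.
Qed.

Lemma bounded_rv_sum m (X : 'I_m -> T -> R) : (forall i, bounded_rv (X i)) ->
  bounded_rv (fun w => \sum_(i < m) X i w).
Proof.
elim: m X => [|m IH] X bX.
  rewrite (_ : (fun w => _) = fun=> 0); last by apply/funext => w; rewrite big_ord0.
  by split; [exact: measurable_cst|exists 0 => w; rewrite normr0].
rewrite (_ : (fun w => _) = fun w => X ord0 w + \sum_(i < m) X (lift ord0 i) w).
  by apply: bounded_rvD => //; exact: IH.
by apply/funext => w; rewrite big_ord_recl.
Qed.

Lemma bounded_rv_powR (X : T -> R) (r M : R) : 0 <= r -> measurable_fun setT X -> (forall w, 0 <= X w <= M) ->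
  bounded_rv (fun w => X w `^ r).
Proof.
move=> r0 mX XM; split; first exact: (measurableT_comp (measurable_powR r)).
exists (M `^ r) => w; have /andP[w0 wM] := XM w.
by rewrite ger0_norm ?powR_ge0// ge0_ler_powR ?nnegrE//; exact: le_trans wM.
Qed.

Lemma EFin_Rintegral X : bounded_rv X -> (Rintegral P setT X)%:E = (\int[P]_w (X w)%:E)%E.
Proof. by move=> bX; rewrite /Rintegral fineK//; exact: (integrable_fin_num measurableT (bounded_rv_integrable bX)). Qed.

Lemma RintegralD_bounded X1 X2 : bounded_rv X1 -> bounded_rv X2 ->
  Rintegral P setT (fun w => X1 w + X2 w) = Rintegral P setT X1 + Rintegral P setT X2.
Proof. by move=> b1 b2; apply: RintegralD => //; exact: bounded_rv_integrable. Qed.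

Lemma RintegralZ_bounded c X : bounded_rv X ->
  Rintegral P setT (fun w => c * X w) = c * Rintegral P setT X.
Proof. by move=> b1; apply: RintegralZl => //; exact: bounded_rv_integrable. Qed.

Lemma Rintegral_sum_bounded m (X : 'I_m -> T -> R) : (forall i, bounded_rv (X i)) ->
  Rintegral P setT (fun w => \sum_(i < m) X i w) = \sum_(i < m) Rintegral P setT (X i).
Proof.
elim: m X => [|m IH] X bX.
  rewrite big_ord0 (_ : (fun w => _) = fun=> 0); last by apply/funext => w; rewrite big_ord0.
  by rewrite Rintegral_cst// mul0r.
rewrite (_ : (fun w => _) = fun w => X ord0 w + \sum_(i < m) X (lift ord0 i) w).
  by rewrite RintegralD_bounded ?IH//; [rewrite big_ord_recl|exact: bounded_rv_sum].
by apply/funext => w; rewrite big_ord_recl.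
Qed.

End bounded_expectation.

Section scheme_moments.
Context (dsp : measure_display) (T : measurableType dsp) (R : realType) (P : probability T R).
Variables (n d : nat) (tau : R) (f : (R -> 'cV[R]_n) -> 'cV[R]_n) (g : (R -> 'cV[R]_n) -> 'M[R]_(n, d)).
Variables (B : R -> T -> 'cV[R]_d) (xi : R -> 'cV[R]_n) (h : R) (N : nat).
Hypothesis BB : brownian P B.
Hypothesis tau0 : 0 < tau.
Hypothesis N0 : (0 < N)%N.
Hypothesis h0 : 0 <= h.
Hypothesis Lf : loc_lip tau f.
Hypothesis Lg : loc_lip tau g.
Notation Dt := (tau / N%:R).
Notation Z := (scheme_at tau f g B xi h N).
Notation Ybar m w := (interp Dt N (drop m (Ys f g B xi h Dt N m w))).

Let Dt0 : 0 < Dt. Proof. by rewrite divr_gt0// ltr0n. Qed.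

Definition pre_drift m w := Z (m + N)%N w + Dt *: f (Ybar m w).
Definition pre_diffusion m w := g (Ybar m w).

Let past_meas m (X : T -> R) :
  measurable_fun (setT : set (past (incr tau B N) m 0)) X -> measurable_fun setT X.
Proof.
exact: (measurable_fun_g_sigma (@past_rect_measurable _ _ _ _ _ (measurable_incr BB Dt0) _ _)).
Qed.

Lemma measurable_mnorm_scheme_at i : measurable_fun setT (fun w => mnorm (Z i w)).
Proof.
apply: measurable_mnorm => j k; rewrite ord1; apply: (@past_meas i).
by apply: adapted_Ys => //; rewrite addSn ltnS leq_addl.
Qed.

Lemma measurable_pre_drift m i :
  measurable_fun (setT : set (past (incr tau B N) m 0)) (fun w => pre_drift m w i 0).
Proof.
rewrite (_ : (fun w => _) = fun w => nth 0 (Ys f g B xi h Dt N m w) (m + N) i 0 + Dt * f (Ybar m w) i 0).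
  apply: measurable_funD; first by apply: adapted_Ys => //; rewrite addSn ltnS addnC.
  apply: measurable_funM => //; apply: measurable_interp_past => // *; exact: adapted_Ys.
by apply/funext => w; rewrite /pre_drift !mxE nth_YsE// addSn ltnS addnC.
Qed.

Lemma measurable_pre_diffusion m i l :
  measurable_fun (setT : set (past (incr tau B N) m 0)) (fun w => pre_diffusion m w i l).
Proof. by apply: measurable_interp_past => // *; exact: adapted_Ys. Qed.

Lemma scheme_moment m q : 1 <= q ->
  (\int[P]_w ((mnorm (Z (m + N).+1 w) ^+ 2) `^ q)%:E <=
   \int[P]_w ((mnorm (pre_drift m w) ^+ 2
     + (2 * q - 1) * Dt * mnorm (pre_diffusion m w) ^+ 2) `^ q)%:E)%E.
Proof.
move=> q1.
have q0 : 0 <= q by lra.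
have s0 : 0 < Num.sqrt Dt by rewrite sqrtr_gt0.
have H := @dB_moment _ T R P d (incr tau B N) (Num.sqrt Dt) (measurable_incr BB Dt0)
  (@incr_law _ T R P d B tau N BB Dt0) q n m (pre_drift m) (pre_diffusion m)
  s0 q1 (@measurable_pre_drift m) (@measurable_pre_diffusion m).
rewrite (sqr_sqrtr (ltW Dt0)) in H.
apply: le_trans H.
have mpow (X : T -> R) : measurable_fun setT X -> measurable_fun setT (fun w => ((X w ^+ 2) `^ q)%:E).
  move=> mX; apply/measurable_EFinP; apply: (measurableT_comp (measurable_powR q)).
  exact: measurable_funX.
apply: ge0_le_integral => //.
- by move=> w _; rewrite lee_fin powR_ge0.
- by apply: mpow; exact: measurable_mnorm_scheme_at.
- apply: mpow; apply: measurable_mnorm => i j; rewrite ord1.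
  rewrite (_ : (fun w => _) = fun w => pre_drift m w i 0 +
      \sum_(l < d) pre_diffusion m w i l * incr tau B N m w l 0).
    apply: measurable_funD; first by apply: (@past_meas m); exact: measurable_pre_drift.
    apply: (measurable_sum_cond _ (h := fun l w => _)) => l _.
    apply: measurable_funM; last exact: (measurable_incr BB Dt0).
    by apply: (@past_meas m); exact: measurable_pre_diffusion.
  by apply/funext => w; rewrite !mxE.
- move=> w _; rewrite lee_fin ge0_ler_powR ?nnegrE ?sqr_ge0//.
  rewrite lerXn2r ?nnegrE ?mnorm_ge0// scheme_atS.
  by rewrite mnorm_trunc// ge_min lexx.
Qed.

Lemma bounded_rv_scheme i r : 0 <= r -> bounded_rv (fun w => (mnorm (Z i w) ^+ 2) `^ r).
Proof.
move=> r0; apply: (bounded_rv_powR (M := h ^+ 2)) => //.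
  by apply: measurable_funX; exact: measurable_mnorm_scheme_at.
by move=> w; rewrite sqr_ge0 lerXn2r ?nnegrE ?mnorm_ge0// mnorm_scheme_at.
Qed.

(** The base is the squared norm, so [r] is half of the usual exponent. *)
Definition moment r i := Rintegral P setT (fun w => (mnorm (Z i w) ^+ 2) `^ r).

Lemma moment_ge0 r i : 0 <= moment r i.
Proof. by apply: Rintegral_ge0 => w _; exact: powR_ge0. Qed.

(** The pathwise bound is integrated. Its left side is compared as an integral in the extended
    reals, while the right side is bounded, so that linearity applies to it. *)
Lemma moment_recursion m q r c1 c3 (C D : 'I_N.+1 -> R) : 1 <= q -> 0 <= r ->
  (forall w, (mnorm (pre_drift m w) ^+ 2 + (2 * q - 1) * Dt * mnorm (pre_diffusion m w) ^+ 2) `^ q <=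
    (mnorm (Z (m + N)%N w) ^+ 2) `^ q + Dt * (- c1 * (mnorm (Z (m + N)%N w) ^+ 2) `^ q
      + \sum_(i < N.+1) C i * (mnorm (Z (m + i)%N w) ^+ 2) `^ q
      - c3 * (mnorm (Z (m + N)%N w) ^+ 2) `^ r
      + \sum_(i < N.+1) D i * (mnorm (Z (m + i)%N w) ^+ 2) `^ r)) ->
  moment q (m + N).+1 <= moment q (m + N)%N + Dt * (- c1 * moment q (m + N)%N
    + \sum_(i < N.+1) C i * moment q (m + i)%N - c3 * moment r (m + N)%N
    + \sum_(i < N.+1) D i * moment r (m + i)%N).
Proof.
move=> q1 r0 H; have q0 : 0 <= q by lra.
have bq i := bounded_rv_scheme i q0.
have br i := bounded_rv_scheme i r0.
pose F w := (mnorm (Z (m + N)%N w) ^+ 2) `^ q + Dt * (- c1 * (mnorm (Z (m + N)%N w) ^+ 2) `^ q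
      + \sum_(i < N.+1) C i * (mnorm (Z (m + i)%N w) ^+ 2) `^ q
      + (- c3 * (mnorm (Z (m + N)%N w) ^+ 2) `^ r
      + \sum_(i < N.+1) D i * (mnorm (Z (m + i)%N w) ^+ 2) `^ r)).
have bS1 : bounded_rv (fun w => \sum_(i < N.+1) C i * (mnorm (Z (m + i)%N w) ^+ 2) `^ q).
  by apply: (@bounded_rv_sum _ _ _ _ (fun i w => _)) => i; exact: bounded_rvZ.
have bS2 : bounded_rv (fun w => \sum_(i < N.+1) D i * (mnorm (Z (m + i)%N w) ^+ 2) `^ r).
  by apply: (@bounded_rv_sum _ _ _ _ (fun i w => _)) => i; exact: bounded_rvZ.
have b1 := bounded_rvD (bounded_rvZ (- c1) (bq (m + N)%N)) bS1.
have b2 := bounded_rvD (bounded_rvZ (- c3) (br (m + N)%N)) bS2.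
have b3 := bounded_rvZ Dt (bounded_rvD b1 b2).
have bF : bounded_rv F := bounded_rvD (bq (m + N)%N) b3.
have sumE r' (C' : 'I_N.+1 -> R) : 0 <= r' ->
    Rintegral P setT (fun w => \sum_(i < N.+1) C' i * (mnorm (Z (m + i)%N w) ^+ 2) `^ r') =
    \sum_(i < N.+1) C' i * moment r' (m + i)%N.
  move=> r'0; have br' i := bounded_rv_scheme i r'0.
  rewrite (@Rintegral_sum_bounded _ _ _ _ _ (fun i w => _)); last by move=> i; exact: bounded_rvZ.
  by apply: eq_bigr => i _; exact: RintegralZ_bounded.
have -> : moment q (m + N)%N + Dt * (- c1 * moment q (m + N)%N
    + \sum_(i < N.+1) C i * moment q (m + i)%N - c3 * moment r (m + N)%N
    + \sum_(i < N.+1) D i * moment r (m + i)%N) = Rintegral P setT F.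
  rewrite (RintegralD_bounded P (bq (m + N)%N) b3) (RintegralZ_bounded P _ (bounded_rvD b1 b2)).
  rewrite (RintegralD_bounded P b1 b2) (RintegralD_bounded P (bounded_rvZ (- c1) (bq (m + N)%N)) bS1).
  rewrite (RintegralD_bounded P (bounded_rvZ (- c3) (br (m + N)%N)) bS2).
  rewrite (RintegralZ_bounded P _ (bq (m + N)%N)) (RintegralZ_bounded P _ (br (m + N)%N)).
  by rewrite (sumE _ _ q0) (sumE _ _ r0) [- c3 * _]mulNr !addrA.
rewrite -lee_fin !EFin_Rintegral//.
apply: (le_trans (scheme_moment m q1)).
apply: ge0_le_integral => //.
- by move=> w _; rewrite lee_fin powR_ge0.
- apply/measurable_EFinP; apply: (measurableT_comp (measurable_powR q)).
  apply: measurable_funD.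
    apply: measurable_funX; apply: measurable_mnorm => i j; rewrite ord1.
    by apply: (@past_meas m); exact: measurable_pre_drift.
  apply: measurable_funM => //; apply: measurable_funX; apply: measurable_mnorm => i j.
  by apply: (@past_meas m); exact: measurable_pre_diffusion.
- by apply/measurable_EFinP; exact: bF.1.
- move=> w _; rewrite lee_fin; apply: (le_trans (H w)).
  suff -> : F w = (mnorm (Z (m + N)%N w) ^+ 2) `^ q + Dt * (- c1 * (mnorm (Z (m + N)%N w) ^+ 2) `^ q
      + \sum_(i < N.+1) C i * (mnorm (Z (m + i)%N w) ^+ 2) `^ q
      - c3 * (mnorm (Z (m + N)%N w) ^+ 2) `^ r
      + \sum_(i < N.+1) D i * (mnorm (Z (m + i)%N w) ^+ 2) `^ r) by [].
  by congr (_ + Dt * _); rewrite [- c3 * _]mulNr addrA.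
Qed.

End scheme_moments.

(** * Decay of the moments for a fixed step size *)

Section stability.
Context (dsp : measure_display) (T : measurableType dsp) (R : realType) (P : probability T R).
Variables (n d : nat) (tau : R) (f : (R -> 'cV[R]_n) -> 'cV[R]_n) (g : (R -> 'cV[R]_n) -> 'M[R]_(n, d)).
Variables (B : R -> T -> 'cV[R]_d) (xi : R -> 'cV[R]_n).
Hypothesis tau0 : 0 < tau.
Hypothesis BB : brownian P B.
Hypothesis lf : local_on tau f.
Hypothesis f0 : vanish0 f.
Hypothesis g0 : vanish0 g.
Hypothesis A1 : forall l : R, 0 < l -> exists Rl : R, 0 < Rl /\
     forall phi psi, is_C tau phi -> is_C tau psi ->
       Num.max (supn tau phi) (supn tau psi) <= l ->
       Num.max (mnorm (f phi - f psi)) (mnorm (g phi - g psi))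
       <= Rl * (mnorm (phi 0 - psi 0)
                + tau^-1 * int_tau tau (fun t => mnorm (phi t - psi t))).
Variables (p varrho b1 b2 b3 b4 : R) (rho3 rho4 : R -> R).
Hypothesis p2 : 2 <= p.
Hypothesis vr0 : 0 < varrho.
Hypothesis b20 : 0 < b2.
Hypothesis b30 : 0 < b3.
Hypothesis b40 : 0 < b4.
Hypothesis b21 : b2 < b1.
Hypothesis b43 : b4 < b3.
Hypothesis W3 : in_W tau rho3.
Hypothesis W4 : in_W tau rho4.
Hypothesis A2 : forall phi, is_C tau phi ->
     2 * dotv (phi 0) (f phi) + (p - 1) * mnorm (g phi) ^+ 2
     <= - b1 * mnorm (phi 0) ^+ 2
        + b2 * int_tau tau (fun t => mnorm (phi t) ^+ 2 * rho3 t)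
        - b3 * mnorm (phi 0) `^ (2 + varrho)
        + b4 * int_tau tau (fun t => mnorm (phi t) `^ (2 + varrho) * rho4 t).
Variables (G : R -> R) (h : R).
Hypothesis h1 : 1 <= h.
Hypothesis G0 : 0 <= G h.
Hypothesis Gf : forall phi psi, is_C tau phi -> is_C tau psi ->
     Num.max (supn tau phi) (supn tau psi) <= h ->
     (exists t, - tau <= t <= 0 /\ phi t <> psi t) ->
     mnorm (f phi - f psi) / Num.sqrt (PsiD tau phi psi) <= G h.
Variable N : nat.
Hypothesis N0 : (0 < N)%N.
Notation Dt := (tau / N%:R).
Notation Z := (scheme_at tau f g B xi h N).
Notation q := (p / 2).
Notation s := (varrho / 2).
Variables (eta c0 e : R).
Hypothesis eta01 : 0 < eta <= 1.
Hypothesis eE : e = Dt * G h ^+ 2.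
Hypothesis eb1 : e <= b1.
Hypothesis c0G : 2 * Num.sqrt 2 * G h <= c0 * (b3 - b4).
Hypothesis small1 : Dt * (b1 + b3 * c0) <= eta / (expR 1 * (2 * q)).
Hypothesis small2 : Dt * (b2 + e + b4 * c0) <= eta / (expR 1 * (2 * q)).

Let Dt0 : 0 < Dt. Proof. by rewrite divr_gt0// ltr0n. Qed.
Let h0 : 0 <= h. Proof. exact: le_trans h1. Qed.
Let e0 : 0 <= e. Proof. by rewrite eE mulr_ge0 ?sqr_ge0// ltW. Qed.
Let q1 : 1 <= q. Proof. by rewrite ler_pdivlMr// mul1r. Qed.
Let s0 : 0 < s. Proof. by rewrite divr_gt0. Qed.

Lemma loc_lip_drift : loc_lip tau f.
Proof.
move=> l l0; have [Rl [Rl0 H]] := A1 l0; exists Rl; split=> // phi psi cp cq pq.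
by have := H _ _ cp cq pq; rewrite ge_max => /andP[].
Qed.

Lemma loc_lip_diffusion : loc_lip tau g.
Proof.
move=> l l0; have [Rl [Rl0 H]] := A1 l0; exists Rl; split=> // phi psi cp cq pq.
by have := H _ _ cp cq pq; rewrite ge_max => /andP[].
Qed.

Definition linear_weight (i : 'I_N.+1) := b2 * hat_weight tau rho3 i + e * hat_weight tau (fun _ => tau^-1) i.
Definition power_weight (i : 'I_N.+1) := hat_weight tau rho4 i.

Lemma linear_weight_ge0 i : 0 <= linear_weight i.
Proof.
have [_ [_ [r30 _]]] := W3.
rewrite addr_ge0// mulr_ge0 ?(ltW b20)// hat_weight_ge0// => t _.
by rewrite invr_ge0 ltW.
Qed.

Lemma power_weight_ge0 i : 0 <= power_weight i.
Proof. by have [_ [_ [r40 _]]] := W4; exact: hat_weight_ge0. Qed.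

Lemma sum_linear_weight : \sum_i linear_weight i = b2 + e.
Proof.
have [_ [_ [_ r31]]] := W3.
rewrite big_split/= -!mulr_sumr !sum_hat_weight//; [|exact: bmeas_cst|exact: in_W_bmeas].
by rewrite r31 int_tau_cst// mulVf ?gt_eqF// !mulr1.
Qed.

Lemma sum_power_weight : \sum_i power_weight i = 1.
Proof. by have [_ [_ [_ r41]]] := W4; rewrite sum_hat_weight//; exact: in_W_bmeas. Qed.

(** Controls the truncated values through [G h] instead of [h] itself; it keeps the state-dependent
    weights of [powR_step] small. *)
Lemma norm_powR_le (v : 'cV[R]_n) : mnorm v <= h -> (mnorm v ^+ 2) `^ s <= c0.
Proof.
move=> vh; have := dissipation_growth tau0 lf f0 g0 A1 h1 G0 Gf p2 vr0 b21 W3 W4 A2 vh.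
have b34 : 0 < b3 - b4 by rewrite subr_gt0.
by move=> /le_trans/(_ c0G); rewrite mulrC ler_pM2r.
Qed.

(** [drift_step] provides the hypothesis of [powR_step] with [a1] = b1 - e, the weights
    [linear_weight] and [power_weight], and dl = eta / (2 q exp 1), the largest value that
    [powR_perturb] admits. *)
Lemma scheme_power_step m w :
  (mnorm (pre_drift tau f g B xi h N m w) ^+ 2
    + (2 * q - 1) * Dt * mnorm (pre_diffusion tau f g B xi h N m w) ^+ 2) `^ q <=
  (mnorm (Z (m + N)%N w) ^+ 2) `^ q + Dt *
   (- (q * (b1 - e) * (1 - eta) - (q - 1) * (1 + eta) * (b2 + e)) * (mnorm (Z (m + N)%N w) ^+ 2) `^ q
    + \sum_(i < N.+1) ((1 + eta) * linear_weight i) * (mnorm (Z (m + i)%N w) ^+ 2) `^ q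
    - (q * b3 * (1 - eta) - (q - 1) * (1 + eta) * b4 * (q / (q + s))) * (mnorm (Z (m + N)%N w) ^+ 2) `^ (q + s)
    + \sum_(i < N.+1) ((1 + eta) * b4 * (1 + (q - 1) * (s / (q + s))) * power_weight i) *
        (mnorm (Z (m + i)%N w) ^+ 2) `^ (q + s)).
Proof.
pose u := drop m (Ys f g B xi h Dt N m w).
have uZ i : (i <= N)%N -> nth 0 u i = Z (m + i)%N w by move=> iN; rewrite nth_drop_Ys.
have uh i : (i <= N)%N -> mnorm (nth 0 u i) <= h by move=> iN; rewrite uZ// mnorm_scheme_at.
pose y i := mnorm (nth 0 u i) ^+ 2.
have yZ i : (i <= N)%N -> y i = mnorm (Z (m + i)%N w) ^+ 2 by move=> iN; rewrite /y uZ.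
have drift := drift_step tau0 lf f0 g0 A1 h1 G0 Gf vr0 b20 b40 W3 W4 A2 N0 uh (fun i => erefl (y i)) eE.
have yc i : (i <= N)%N -> y i `^ s <= c0 by move=> iN; apply: norm_powR_le; exact: uh.
have qE : 2 * q - 1 = p - 1 by rewrite mulrC divfK.
have E0 : 0 < expR 1 * (2 * q) 
  by rewrite mulr_gt0 ?expR_gt0// mulr_gt0// (lt_le_trans ltr01 q1).
rewrite qE.
under [X in _ <= _ + _ * (_ + X - _ + _)]eq_bigr => i _ do rewrite -yZ ?leq_ord// -mulrA.
under [X in _ <= _ + _ * (_ + X)]eq_bigr => i _ do rewrite -yZ ?leq_ord// -mulrA.
rewrite -!mulr_sumr -!yZ// -sum_linear_weight.
have -> : pre_drift tau f g B xi h N m w = nth 0 u N + Dt *: f (interp Dt N u).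
  by rewrite /pre_drift uZ.
apply: (@powR_step _ _ linear_weight power_weight (fun i => y i) q s eta (eta / (expR 1 * (2 * q)))) => //.
- by rewrite mulrC divfK ?gt_eqF.
- exact: ltW.
- by rewrite subr_ge0.
- exact: ltW.
- exact: ltW.
- exact: linear_weight_ge0.
- exact: power_weight_ge0.
- exact: sum_power_weight.
- by move=> i; exact: sqr_ge0.
- exact: sqr_ge0.
- rewrite addr_ge0 ?sqr_ge0// mulr_ge0 ?sqr_ge0// mulr_ge0 ?(ltW Dt0)//.
  by move: p2; move=> *; lra.
- apply: le_trans small1; rewrite ler_wpM2l ?(ltW Dt0)// lerD//; first by rewrite lerBlDr lerDl.
  by rewrite ler_wpM2l ?(ltW b30)// yc.
- apply: le_trans small2; rewrite ler_wpM2l ?(ltW Dt0)// sum_linear_weight lerD2l.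
  rewrite ler_wpM2l ?(ltW b40)//.
  have -> : c0 = \sum_i power_weight i * c0 by rewrite -mulr_suml sum_power_weight mul1r.
  by apply: ler_sum => i _; rewrite ler_wpM2l ?power_weight_ge0// yc// -ltnS.
Qed.

(** The two sequences of [delay_gronwall] are the moments of exponents q and q + s; the delay
    weights have totals b2 + e and 1, up to the common factors, and the delay spans Dt N = tau. *)
Lemma scheme_decay nu2 : 0 <= nu2 ->
  nu2 + (1 + eta) * (b2 + e) * expR (nu2 * tau) <=
        q * (b1 - e) * (1 - eta) - (q - 1) * (1 + eta) * (b2 + e) ->
  (1 + eta) * b4 * (1 + (q - 1) * (s / (q + s))) * expR (nu2 * tau) <=
        q * b3 * (1 - eta) - (q - 1) * (1 + eta) * b4 * (q / (q + s)) ->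
  exists M : R, 0 <= M /\ forall k,
    (\int[P]_w (mnorm (Z (k + N)%N w) `^ p)%:E <= (M * expR (- (nu2 * (k%:R * Dt))))%:E)%E.
Proof.
move=> nu20 c1E c3E.
have q0 : 0 <= q by exact: le_trans q1.
have qs0 : 0 <= q + s by rewrite addr_ge0// ltW.
have eta1 : 0 <= 1 + eta by case/andP: eta01 => *; lra.
have k0 : 0 <= (1 + eta) * b4 * (1 + (q - 1) * (s / (q + s))).
  rewrite mulr_ge0// ?mulr_ge0 ?(ltW b40)// addr_ge0// mulr_ge0 ?subr_ge0//.
  by rewrite divr_ge0// ltW.
have DtN : Dt * N%:R = tau by rewrite divfK// pnatr_eq0 -lt0n.
have [|||||M [M0 HM]] := @delay_gronwall R N (moment P tau f g B xi h N q) (moment P tau f g B xi h N (q + s))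
  (fun i => (1 + eta) * linear_weight i) (fun i => (1 + eta) * b4 * (1 + (q - 1) * (s / (q + s))) * power_weight i)
  (q * (b1 - e) * (1 - eta) - (q - 1) * (1 + eta) * (b2 + e))
  (q * b3 * (1 - eta) - (q - 1) * (1 + eta) * b4 * (q / (q + s))) nu2 Dt
  (moment_ge0 P tau f g B xi h N q) (moment_ge0 P tau f g B xi h N (q + s)) _ _ Dt0 nu20.
- by move=> i; rewrite mulr_ge0// linear_weight_ge0.
- by move=> i; rewrite mulr_ge0// power_weight_ge0.
- by rewrite -mulr_sumr sum_linear_weight DtN.
- by rewrite -mulr_sumr sum_power_weight mulr1 DtN.
- move=> m; apply: (moment_recursion BB tau0 N0 h0 loc_lip_drift loc_lip_diffusion q1 qs0) => w.
  exact: scheme_power_step.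
exists M; split=> // k.
have := HM k; rewrite -lee_fin /moment EFin_Rintegral; last first.
  exact: (bounded_rv_scheme _ BB tau0 N0 h0 loc_lip_drift loc_lip_diffusion _ q0).
apply: le_trans; rewrite le_eqVlt; apply/orP; left; apply/eqP; apply: eq_integral => w _.
by rewrite -powR_mulrn ?mnorm_ge0// -powRrM mulrC divfK.
Qed.

End stability.

(** A bound r on the limsup of log(a_k) / (k Delta) means that for every eps > 0 eventually a_k <=
    exp((r + eps) k Delta); in this form log 0 needs no convention. *)
Theorem theorem4p2 (R : realType) (n d : nat) (tau : R)
  (dsp : measure_display) (T : measurableType dsp) (P : probability T R)
  (B : R -> T -> 'cV[R]_d)
  (f : (R -> 'cV[R]_n) -> 'cV[R]_n) (g : (R -> 'cV[R]_n) -> 'M[R]_(n, d))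
  (xi : R -> 'cV[R]_n)
  (p varrho b1 b2 b3 b4 : R) (rho3 rho4 : R -> R)
  (Gamma : R -> R) (lambda nu nu1 : R) :
  0 < tau ->
  brownian P B ->
  local_on tau f -> local_on tau g ->
  f (fun _ => 0) = 0 -> g (fun _ => 0) = 0 ->
  is_C tau xi ->
  (* (A1) *)
  (forall l : R, 0 < l -> exists Rl : R, 0 < Rl /\
     forall phi psi, is_C tau phi -> is_C tau psi ->
       Num.max (supn tau phi) (supn tau psi) <= l ->
       Num.max (mnorm (f phi - f psi)) (mnorm (g phi - g psi))
       <= Rl * (mnorm (phi 0 - psi 0)
                + tau^-1 * int_tau tau (fun t => mnorm (phi t - psi t)))) ->
  (* (A2') *)
  2 <= p -> 0 < varrho -> 0 < b1 -> 0 < b2 -> 0 < b3 -> 0 < b4 ->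
  b2 < b1 -> b4 < b3 -> in_W tau rho3 -> in_W tau rho4 ->
  (forall phi, is_C tau phi ->
     2 * dotv (phi 0) (f phi) + (p - 1) * mnorm (g phi) ^+ 2
     <= - b1 * mnorm (phi 0) ^+ 2
        + b2 * int_tau tau (fun t => mnorm (phi t) ^+ 2 * rho3 t)
        - b3 * mnorm (phi 0) `^ (2 + varrho)
        + b4 * int_tau tau (fun t => mnorm (phi t) `^ (2 + varrho) * rho4 t)) ->
  (* the function Gamma *)
  (forall l, 1 <= l -> 0 <= Gamma l) ->
  (forall l l', 1 <= l -> l < l' -> Gamma l < Gamma l') ->
  {within `[1, +oo[, continuous Gamma} ->
  (forall M : R, exists L : R, forall l, L <= l -> M <= Gamma l) ->
  (forall l, 1 <= l -> forall phi psi, is_C tau phi -> is_C tau psi ->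
     Num.max (supn tau phi) (supn tau psi) <= l ->
     (exists t, - tau <= t <= 0 /\ phi t <> psi t) ->
     mnorm (f phi - f psi) / Num.sqrt (PsiD tau phi psi) <= Gamma l /\
     mnorm (g phi - g psi) ^+ 2 / PsiD tau phi psi <= Gamma l) ->
  0 < lambda < 1 / 2 ->
  (* nu and nu1 *)
  0 < nu -> p / 2 * (b1 - b2 * expR (nu * tau)) - nu > 0 ->
  b3 - b4 * expR (nu * tau) > 0 ->
  0 < nu1 < nu ->
  exists Dhat : R, 0 < Dhat <= 1 /\
    forall N : nat, tau <= N%:R -> tau / N%:R <= Dhat ->
      (forall eps : R, 0 < eps -> exists k0 : nat, forall k : nat, (k0 <= k)%N ->
         (\int[P]_w ((mnorm (Yk f g B xi Gamma lambda tau N k w)) `^ p)%:E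
          <= (expR ((- nu1 + eps) * (k%:R * (tau / N%:R))))%:E)%E) /\
      {ae P, forall w, forall eps : R, 0 < eps -> exists k0 : nat, forall k : nat, (k0 <= k)%N ->
         mnorm (Yk f g B xi Gamma lambda tau N k w)
         <= expR ((- nu1 / p + eps) * (k%:R * (tau / N%:R)))}.
Proof.
move=> tau0 BB lf _ f0 g0 _ A1 p2 vr0 b10 b20 b30 b40 b21 b43 W3 W4 A2 G0 _ Gc Gu Gfg.
move=> la nu0 nuq nub /andP[nu10 nu1nu].
(* As [f] and [g] vanish at the zero function, the constant of the truncation level is Gamma(1). *)
have KE : Num.max (Gamma 1) (Num.max (mnorm (f (fun _ => 0))) (mnorm (g (fun _ => 0)) ^+ 2)) = Gamma 1.
  by rewrite f0 g0 !mnorm0 expr0n/= maxxx; apply: max_idPl; exact: G0.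
have vf : vanish0 f by [].
have vg : vanish0 g by [].
clear f0 g0.
pose K := Gamma 1; have K0 : 0 <= K by exact: G0.
(* The midpoint leaves room below [nu] for the perturbation by [eta], and above [nu1] for the
   constant [M] and the summation of moments. *)
pose nu2 := (nu1 + nu) / 2.
have nu2n : nu2 < nu by rewrite /nu2; lra.
have nu12 : nu1 < nu2 by rewrite /nu2; lra.
have nu20 : 0 <= nu2 by lra.
have p0 : 0 < p by lra.
have q1 : 1 <= p / 2 by lra.
have s0 : 0 < varrho / 2 by lra.
have nuq' : nu < p / 2 * (b1 - b2 * expR (nu * tau)) by lra.
have E1 : 1 <= expR (nu * tau) by rewrite expR_ge1// mulr_ge0// ltW.
have [eta [eta01 [etab Hm]]] := margin q1 s0 b10 b20 b30 b40 E1 nuq' nu2n nub.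
have [eta0 eta1] := andP eta01.
have b34 : 0 < b3 - b4 by rewrite subr_gt0.
(* The constant in |Y|^varrho <= C0 Dt^(- lambda), from [dissipation_growth] and Gamma(h) <= K Dt^(-
   lambda). *)
pose C0 := 2 * Num.sqrt 2 * K / (b3 - b4).
have C00 : 0 <= C0 by rewrite divr_ge0 ?(ltW b34)// mulr_ge0// mulr_ge0// sqrtr_ge0.
pose dl := eta / (expR 1 * (2 * (p / 2))).
have dl0 : 0 < dl by rewrite divr_gt0// mulr_gt0 ?expR_gt0// mulr_gt0// (lt_le_trans ltr01 q1).
have [Dhat [Dhat01 HD]] := step_size (ltW b10) (ltW b20) (ltW b30) (ltW b40) K0 C00 eta01 dl0 la.
exists Dhat; split=> // N tauN DtD.
have N0 : (0 < N)%N by rewrite -(ltr_nat R) (lt_le_trans tau0).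
have Dt0 : 0 < tau / N%:R by rewrite divr_gt0// ltr0n.
have DtD' : 0 < tau / N%:R <= Dhat by rewrite Dt0.
have Dt1 : 0 < tau / N%:R <= 1 by case/andP: Dhat01 => _; rewrite Dt0; exact: le_trans.
pose L := (tau / N%:R) `^ (- lambda).
(* As Dt <= 1, the argument of the inverse of [Gamma] lies in [Gamma(1), oo), so that h >= 1. *)
have KL : Gamma 1 <= K * L by rewrite ler_peMr// powRN_ge1// ltW//; case/andP: la.
have [h1 Gh] := Gamma_inv_bounds Gc Gu KL.
set h := Gamma_inv Gamma (K * L) in h1 Gh.
have Gh0 : 0 <= Gamma h by exact: G0.
have [ee small1 small2] := HD (tau / N%:R) (Gamma h) DtD' (introT andP (conj Gh0 Gh)).
have c0G : 2 * Num.sqrt 2 * Gamma h <= C0 * L * (b3 - b4).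
  have -> : C0 * L * (b3 - b4) = 2 * Num.sqrt 2 * (K * L) by rewrite /C0; field; rewrite gt_eqF.
  by rewrite ler_wpM2l// mulr_ge0// sqrtr_ge0.
pose e := tau / N%:R * Gamma h ^+ 2.
have e0 : 0 <= e by rewrite mulr_ge0 ?sqr_ge0// ltW.
have E2 : 1 <= expR (nu2 * tau) <= expR (nu * tau).
  apply/andP; split; first by apply: expR_ge1; rewrite mulr_ge0// ltW.
  by rewrite ler_expR ler_pM2r// ltW.
have [c1E c3E] := Hm e (expR (nu2 * tau)) (introT andP (conj e0 ee)) E2.
have Gf phi psi : is_C tau phi -> is_C tau psi ->
     Num.max (supn tau phi) (supn tau psi) <= h ->
     (exists t, - tau <= t <= 0 /\ phi t <> psi t) ->
     mnorm (f phi - f psi) / Num.sqrt (PsiD tau phi psi) <= Gamma h.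
  by move=> cp cq pq ex; have [] := Gfg h h1 phi psi cp cq pq ex.
have [M [M0 HM]] := scheme_decay xi tau0 BB lf vf vg A1 p2 vr0 b20 b30 b40 b21 b43 W3 W4 A2
  h1 Gh0 Gf N0 eta01 (erefl e) (le_trans ee etab) c0G small1 small2 nu20 c1E c3E.
have YE k w : Yk f g B xi Gamma lambda tau N k w = scheme_at tau f g B xi h N (k + N) w.
  by rewrite /Yk KE last_Ys.
have h0 : 0 <= h by exact: le_trans h1.
have mZ k : measurable_fun setT (fun w => mnorm (scheme_at tau f g B xi h N (k + N) w)).
  exact: (measurable_mnorm_scheme_at _ BB tau0 N0 h0 (loc_lip_drift A1) (loc_lip_diffusion A1)).
split.
  move=> eps eps0; have [k0 Hk] := moment_decay nu12 Dt0 HM eps0.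
  by exists k0 => k kk; under eq_integral do rewrite YE; exact: Hk.
have := pathwise_decay p0 nu12 Dt0 M0 (fun k w => mnorm_ge0 _) mZ HM.
apply: filterS => w Hw eps eps0; have [k0 Hk] := Hw eps eps0.
by exists k0 => k kk; rewrite YE; exact: Hk.
Qed.
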